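(* Let $d\ge1$ and let $A$ be a real symmetric positive-definite $d\times d$ matrix. Consider $P=V(x)-\frac12\Delta$ on $L^2(\mathbb{R}^d)$, where $V$ is a potential satisfying Assumption (V) (see context) and having principal symbol $V_A(x)=\frac12 x\cdot Ax$. Let $\omega\subset\mathbb{R}^d$ be a measurable conical set, i.e. for all $x\in\mathbb{R}^d$ and $\lambda>0$, $x\in\omega\Leftrightarrow\lambda x\in\omega$. Assume that $\omega$ observes the Schrödinger equation $i\partial_t\psi=P\psi$ in some time $T>0$. Then for every eigenvector $v$ of $A$, it holds $v\in\overline{\omega}$ or $-v\in\overline{\omega}$.
   Context: Notation: $\langle x\rangle=(1+|x|^2)^{1/2}$. Assumption (V) (here with $m=1$, consistent with the principal symbol $V_A$): $V:\mathbb{R}^d\to\mathbb{R}$ is $C^\infty$ and there exist $C,r>0$ such that $\frac1C\langle x\rangle^{2}\le V(x)\le C\langle x\rangle^{2}$ for all $|x|\ge r$; and for every $\alpha\in\mathbb{N}^d$ there is $C_\alpha>0$ with $|\partial^\alpha V(x)|\le C_\alpha\langle x\rangle^{2-|\alpha|}$ for all $x\in\mathbb{R}^d$. $V$ has principal symbol $V_A$ means: for every $\alpha\in\mathbb{N}^d$ there is $C_\alpha>0$ such that $|\partial^\alpha(V-V_A)(x)|\le C_\alpha\langle x\rangle^{1-|\alpha|}$ for all $x\in\mathbb{R}^d$. $P$ denotes the self-adjoint closure on $L^2(\mathbb{R}^d)$ of $V(x)-\frac12\Delta$ with domain $C_c^\infty(\mathbb{R}^d)$. ''$\omega$ observes the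 Schrödinger equation in time $T$'' means $\mathrm{Obs}(\omega,T)$: there is $C>0$ such that $\|u\|_{L^2(\mathbb{R}^d)}^2\le C\int_0^T\|e^{-itP}u\|_{L^2(\omega)}^2dt$ for all $u\in L^2(\mathbb{R}^d)$. *)

(* Defs.v *)
From HB Require Import structures.
From mathcomp Require Import all_boot all_order all_algebra.
From mathcomp Require Import complex.
From mathcomp Require Import all_classical all_reals all_analysis.

Set Implicit Arguments.
Unset Strict Implicit.
Unset Printing Implicit Defensive.
Import Order.TTheory GRing.Theory Num.Theory.
Import numFieldNormedType.Exports.
Local Open Scope classical_set_scope.
Local Open Scope ring_scope.

(* Points of R^d are row vectors, with the library's topology (that of the sup
   norm, hence the usual one). They carry the sigma-algebra generated by the
   coordinates, that is, the Borel one, built as the library does for tuples. *)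

Definition rV_display : Type -> nat -> measure_display.
Proof. by move=> _ _; exact: default_measure_display. Qed.

Section measurable_rV.
Context {R : realType} (d : nat).

Let coors : 'I_d -> 'rV[R]_d -> measurableTypeR R := fun i x => x 0 i.

Let rV_set0 : g_sigma_preimage coors set0.
Proof. exact: sigma_algebra0. Qed.

Let rV_setC A : g_sigma_preimage coors A -> g_sigma_preimage coors (~` A).
Proof. exact: sigma_algebraC. Qed.

Let rV_bigcup (F : _^nat) : (forall i, g_sigma_preimage coors (F i)) ->
  g_sigma_preimage coors (\bigcup_i (F i)).
Proof. exact: sigma_algebra_bigcup. Qed.

HB.instance Definition _ :=
  @isMeasurable.Build (rV_display R d)
    'rV[R]_d (g_sigma_preimage coors) rV_set0 rV_setC rV_bigcup.

End measurable_rV.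

Section lebesgue_rV.
Context {R : realType}.

Definition cons_rV (d : nat) (p : measurableTypeR R * 'rV[R]_d) : 'rV[R]_d.+1 :=
  \row_i (if unlift ord0 i is Some j then p.2 0 j else p.1).

Lemma measurable_coord_rV (d : nat) (i : 'I_d) :
  measurable_fun setT (fun x : 'rV[R]_d => x 0 i : measurableTypeR R).
Proof.
move=> _ Y mY; rewrite setTI; apply: sub_sigma_algebra => /=.
rewrite -bigcup_seq/=; exists i => /=; first by rewrite mem_index_enum.
by exists Y => //; rewrite setTI.
Qed.

Lemma measurable_cons_rV (d : nat) : measurable_fun setT (@cons_rV d).
Proof.
move=> _ Y mY; rewrite setTI.
have sI : (\big[setU/set0]_(i < d.+1) preimage_set_system setT
    (fun x : 'rV[R]_d.+1 => x 0 i : measurableTypeR R) measurable)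
    `<=` [set A | measurable (@cons_rV d @^-1` A)].
  rewrite -bigcup_seq => A [i _ [B mB <-]] /=; rewrite setTI.
  rewrite (_ : _ @^-1` _ = (fun p : measurableTypeR R * 'rV[R]_d =>
      if unlift ord0 i is Some j then p.2 0 j else p.1 : measurableTypeR R)
      @^-1` B); last by apply/seteqP; split=> p /=; rewrite mxE.
  case: unliftP => [j _|_]; rewrite -[X in measurable X]setTI.
    by apply: (measurableT_comp (measurable_coord_rV j) measurable_snd).
  exact: measurable_fst.
move: Y mY; apply: smallest_sub sI; split => /=.
- by rewrite preimage_set0; exact: measurable0.
- by move=> A mA; rewrite setTD preimage_setC; exact: measurableC.
- by move=> F mF; rewrite preimage_bigcup; exact: bigcup_measurable.
Qed.

Section push_cons.
Context (d : nat) (m : {measure set 'rV[R]_d -> \bar R}).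

Definition push_cons : set 'rV[R]_d.+1 -> \bar R :=
  pushforward (@lebesgue_measure R \x^ m)%E (@cons_rV d).

Let mV (A : set 'rV[R]_d.+1) : measurable A -> measurable (@cons_rV d @^-1` A).
Proof. by move=> mA; rewrite -[X in measurable X]setTI; exact: measurable_cons_rV. Qed.

Let push_cons0 : push_cons set0 = 0%E.
Proof. by rewrite /push_cons /pushforward preimage_set0 measure0. Qed.

Let push_cons_ge0 A : (0 <= push_cons A)%E.
Proof. exact: (measure_ge0 (@lebesgue_measure R \x^ m)%E). Qed.

Let push_cons_sigma_additive : semi_sigma_additive push_cons.
Proof.
move=> F mF tF mUF; rewrite /push_cons /pushforward preimage_bigcup.
apply: measure_semi_sigma_additive => [n||]; first exact: mV.
- apply/trivIsetP => i j _ _ ij; rewrite -preimage_setI.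
  by move/trivIsetP : tF => /(_ _ _ _ _ ij) ->//; rewrite preimage_set0.
- by rewrite -preimage_bigcup; exact: mV.
Qed.

HB.instance Definition _ := isMeasure.Build _ _ _ push_cons
  push_cons0 push_cons_ge0 push_cons_sigma_additive.

End push_cons.

(* Lebesgue measure on R^d, by induction on d as the product of the
   one-dimensional one with the one of R^(d-1). *)
Fixpoint lebesgue_rV (d : nat) : {measure set 'rV[R]_d -> \bar R} :=
  match d with
  | 0 => \d_ (0 : 'rV[R]_0)
  | n.+1 => push_cons (lebesgue_rV n)
  end.

Lemma lebesgue_rV_box (d : nat) (B : 'I_d -> set (measurableTypeR R)) :
  (forall i, measurable (B i)) ->
  lebesgue_rV d [set x | forall i, B i (x 0 i)] =
  (\prod_(i < d) lebesgue_measure (B i))%E.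
Proof.
elim: d B => [|d IH] B mB /=.
  by rewrite big_ord0 diracE mem_set// => -[].
have mBx : measurable [set x : 'rV[R]_d | forall i, B (lift ord0 i) (x 0 i)].
  rewrite (_ : mkset _ = \bigcap_(i in [set` 'I_d])
      ((fun x : 'rV[R]_d => x 0 i : measurableTypeR R) @^-1` B (lift ord0 i))).
    apply: fin_bigcap_measurable => // i _; rewrite -[X in measurable X]setTI.
    exact: measurable_coord_rV.
  by apply/seteqP; split=> x /= h i => //; [move=> _|]; exact: h.
rewrite /push_cons /pushforward big_ord_recl -IH//.
rewrite (_ : _ @^-1` _ =
    B ord0 `*` [set x : 'rV[R]_d | forall i, B (lift ord0 i) (x 0 i)]).
  by rewrite product_measure2E.
apply/seteqP; split=> -[t y] /=.
  move=> h; split; first by have := h ord0; rewrite mxE unlift_none.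
  by move=> i; have := h (lift ord0 i); rewrite mxE liftK.
by move=> [h0 h] i; rewrite mxE; case: unliftP => [j ->|->].
Qed.

End lebesgue_rV.

Section schrodinger.
Context {R : realType} {d : nat}.
Local Notation E := 'rV[R]_d.
Local Notation C := R[i].
Local Notation mu := (@lebesgue_rV R d).

Definition enorm (x : E) : R := Num.sqrt (\sum_i x 0 i ^+ 2).

Definition japanese (x : E) : R := Num.sqrt (1 + enorm x ^+ 2).

(* Measurable with respect to the completion of the Borel sigma-algebra. *)
Definition lebesgue_measurable (A : set E) : Prop :=
  exists2 B, measurable B & mu.-negligible ((A `\` B) `|` (B `\` A)).

Definition conical (A : set E) : Prop :=
  forall (x : E) (l : R), 0 < l -> (A x <-> A (l *: x)).

(* pderiv [:: i; j; k] f is the iterated partial derivative d_i d_j d_k f. *)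
Definition pderiv (s : seq 'I_d) (f : E -> R) : E -> R :=
  foldr (fun i g => 'D_(delta_mx 0 i) g) f s.

Definition mderiv (a : 'I_d -> nat) (f : E -> R) : E -> R :=
  pderiv (flatten [seq nseq (a i) i | i <- enum 'I_d]) f.

Definition mlength (a : 'I_d -> nat) : nat := (\sum_i a i)%N.

Definition smooth (f : E -> R) : Prop := forall s : seq 'I_d,
  continuous (pderiv s f) /\ forall i x, derivable (pderiv s f) x (delta_mx 0 i).

Definition laplacian (f : E -> R) (x : E) : R := \sum_i pderiv [:: i; i] f x.

Definition assumption_V (V : E -> R) : Prop :=
  [/\ smooth V,
      exists c r : R, [/\ 0 < c, 0 < r & forall x, r <= enorm x ->
        c^-1 * japanese x ^+ 2 <= V x <= c * japanese x ^+ 2]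
    & forall a : 'I_d -> nat, exists2 c : R, 0 < c & forall x,
        `|mderiv a V x| <= c * japanese x ^ (2 - (mlength a)%:Z)].

Definition quadratic (A : 'M[R]_d) (x : E) : R := 2^-1 * (x *m A *m x^T) 0 0.

Definition has_principal_symbol (V VA : E -> R) : Prop :=
  forall a : 'I_d -> nat, exists2 c : R, 0 < c & forall x,
    `|mderiv a (V \- VA) x| <= c * japanese x ^ (1 - (mlength a)%:Z).

(* L^2(R^d; C) through Borel representatives: statements about elements of L^2
   are invariant under changing them on a null set. *)
Definition L2norm2 (w : set E) (u : E -> C) : \bar R :=
  (\int[mu]_(x in w) (complex.Re (u x) ^+ 2 + complex.Im (u x) ^+ 2)%:E)%E.

Definition L2 (u : E -> C) : Prop :=
  [/\ measurable_fun setT (fun x => complex.Re (u x)),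
      measurable_fun setT (fun x => complex.Im (u x))
    & (L2norm2 setT u < +oo)%E].

Definition test_function (f : E -> C) : Prop :=
  [/\ smooth (fun x => complex.Re (f x)), smooth (fun x => complex.Im (f x))
    & compact (closure [set x | f x != 0])].

Definition schrodinger0 (V : E -> R) (f : E -> C) (x : E) : C :=
  (V x)%:C%C * f x - (2^-1 : R)%:C%C *
    (laplacian (fun y => complex.Re (f y)) x +i*
     laplacian (fun y => complex.Im (f y)) x)%C.

(* (u, g) is in the graph of P, the closure of V - Delta/2 on C_c^oo. *)
Definition schrodinger (V : E -> R) (u g : E -> C) : Prop :=
  [/\ L2 u, L2 g & exists f : nat -> E -> C,
    [/\ forall n, test_function (f n),
        L2norm2 setT (fun x => f n x - u x) @[n --> \oo] --> 0%E
      & L2norm2 setT (fun x => schrodinger0 V (f n) x - g x)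
          @[n --> \oo] --> 0%E]].

(* U t is exp(-itP) for all t, in the sense of Stone's theorem: U is the
   strongly continuous one-parameter unitary group whose infinitesimal
   generator, with its domain, is -iP. As P is self-adjoint, such a U exists and
   is unique up to null sets. Surjectivity of U t follows from the group law,
   and invariance under changes on null sets from linearity and isometry. *)
Definition is_propagator (V : E -> R) (U : R -> (E -> C) -> E -> C) : Prop :=
  [/\ forall t u, L2 u -> L2 (U t u) /\ L2norm2 setT (U t u) = L2norm2 setT u,
      forall t (a : C) u v, L2 u -> L2 v ->
        {ae mu, forall x, U t (fun y => a * u y + v y) x = a * U t u x + U t v x},
      (forall u, L2 u -> {ae mu, forall x, U 0 u x = u x}) /\
      (forall s t u, L2 u -> {ae mu, forall x, U (s + t) u x = U s (U t u) x}),
      forall u, L2 u -> L2norm2 setT (fun x => U t u x - u x) @[t --> 0] --> 0%E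
    & forall u g, L2 u -> L2 g ->
        (schrodinger V u g <->
         L2norm2 setT (fun x => (t^-1)%:C%C * (U t u x - u x) + 'i%C * g x)
           @[t --> 0^'] --> 0%E)].

(* The inner integral makes sense for Lebesgue measurable w: the
   integral of a nonnegative function being the supremum over the Borel simple
   functions below it, it is unchanged when w is replaced by a Borel set that
   differs from it by a null set. *)
Definition observes (U : R -> (E -> C) -> E -> C) (w : set E) (T : R) : Prop :=
  exists2 c : R, 0 < c & forall u, L2 u ->
    (L2norm2 setT u <=
     c%:E * \int[lebesgue_measure]_(t in `[0%R, T]) L2norm2 w (U t u))%E.

End schrodinger.

(* Main.v *)
(* Write a = nu^2. For large r, a bump centred at r v with zero mean momentum follows the orbit
   r cos(nu t) v of the harmonic oscillator V_A. Centring the form of P on that orbit in phase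
   space gives a quantity
     F(t) = 1/2 |(-i grad + r nu sin(nu t) v) u|^2 + <V_A(x - r cos(nu t) v) u, u>
   whose time derivative only sees the bounded force grad(V - V_A), all terms growing with r
   cancelling because A v = nu^2 v. By Gronwall F is bounded on [0, T] uniformly in r, so that u(t)
   stays at bounded distance from the orbit. If neither v nor -v is in the closure of the cone w,
   then w stays at distance delta r |cos(nu t)| from the orbit, and the mass of u(t) in w tends to
   0 as r grows, for almost every t. By dominated convergence this contradicts observability.

   As P is unbounded, F is the limit along test functions converging in the graph norm, and it is
   a combination of the means of observables bounded by the graph norm (energy, momentum,
   position, V - V_A), each of which can be differentiated in time. *)
Require Import Defs.
From HB Require Import structures.
From mathcomp Require Import all_boot all_order all_algebra.
From mathcomp Require Import complex.
From mathcomp Require Import all_classical all_reals all_analysis.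
From mathcomp Require Import measurable_realfun.
From mathcomp Require Import ring lra.
Import Order.TTheory GRing.Theory Num.Theory.
Import numFieldNormedType.Exports.
Local Open Scope classical_set_scope.
Local Open Scope ring_scope.

(** * Means of graph-bounded observables along a Schrodinger evolution *)

(** The obstacle is that exp(-itP) does not preserve compact supports, whereas every integration by
    parts below is carried out on test functions. An approximating sequence is therefore chosen at
    each time separately, with no coherence between different times. This is enough because the
    increment of the quadratic form of a symmetric observable is bounded by graph norms alone: the
    estimate between two fixed times passes to the limit along the approximants, and only afterwards
    does the time step tend to 0.

    Uniformity in r has two sources. At time 0 the spread of the bump translated by r v around r v
    is that of the bump at the origin. Later, the rate of F is at most kappa (d/2 |u|^2 + F), where
    kappa bounds the partial derivatives of V - V_A. Since the ellipticity of V passes to V_A, F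
    controls the second moment of u(t) around the orbit, and a Chebyshev inequality bounds the mass
    far from it. The set w is compared with Borel supersets depending on r and t, and the time
    integral of the observed mass is treated by monotonicity. *)

Section prehilbert.
Context (R : realType) (H : lmodType R) (L : H -> Prop) (ip : H -> H -> R).
Hypothesis LD : forall u v, L u -> L v -> L (u + v).
Hypothesis LZ : forall (a : R) u, L u -> L (a *: u).
Hypothesis ipC : forall u v, ip u v = ip v u.
Hypothesis ipDl : forall u v w, L u -> L v -> L w -> ip (u + v) w = ip u w + ip v w.
Hypothesis ipZl : forall (a : R) u w, L u -> L w -> ip (a *: u) w = a * ip u w.
Hypothesis ip_ge0 : forall u, 0 <= ip u u.

(** Only a seminorm: functions that agree almost everywhere are not identified. [ip] is a total
    function on [H], but its algebraic laws hold only on the subspace [L] of square integrable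
    elements, hence the membership conditions in all that follows. *)
Definition hnorm u : R := Num.sqrt (ip u u).

Lemma hsubspaceN u : L u -> L (- u).
Proof. by move=> Lu; rewrite -scaleN1r; exact: LZ. Qed.

Lemma hsubspaceB u v : L u -> L v -> L (u - v).
Proof. by move=> Lu Lv; apply: LD => //; exact: hsubspaceN. Qed.

Hint Resolve LD LZ hsubspaceN hsubspaceB : core.

Lemma hip_Nl u w : L u -> L w -> ip (- u) w = - ip u w.
Proof. by move=> Lu Lw; rewrite -scaleN1r ipZl// mulN1r. Qed.

Lemma hip_Bl u v w : L u -> L v -> L w -> ip (u - v) w = ip u w - ip v w.
Proof. by move=> Lu Lv Lw; rewrite ipDl ?hip_Nl//; exact: hsubspaceN. Qed.

Lemma hip_Dr u v w : L u -> L v -> L w -> ip w (u + v) = ip w u + ip w v.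
Proof. by move=> Lu Lv Lw; rewrite ipC ipDl// !(ipC w). Qed.

Lemma hip_Br u v w : L u -> L v -> L w -> ip w (u - v) = ip w u - ip w v.
Proof. by move=> Lu Lv Lw; rewrite ipC hip_Bl// !(ipC w). Qed.

Lemma hip_Zr a u w : L u -> L w -> ip w (a *: u) = a * ip w u.
Proof. by move=> Lu Lw; rewrite ipC ipZl// ipC. Qed.

Lemma hnorm_ge0 u : 0 <= hnorm u. Proof. exact: sqrtr_ge0. Qed.
Hint Resolve hnorm_ge0 : core.

Lemma hnorm_sqr u : hnorm u ^+ 2 = ip u u. Proof. exact: sqr_sqrtr. Qed.

Lemma hcauchy_schwarz u v : L u -> L v -> `|ip u v| <= hnorm u * hnorm v.
Proof.
move=> Lu Lv; rewrite -(@ler_pXn2r _ 2)// ?nnegrE ?mulr_ge0//.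
rewrite exprMn !hnorm_sqr real_normK ?num_real//.
have key a : 0 <= a ^+ 2 * ip u u - 2 * a * ip u v + ip v v.
  have := ip_ge0 (a *: u - v).
  rewrite hip_Bl ?hip_Br ?ipZl ?hip_Zr//; try by do ?apply: hsubspaceB => //; exact: LZ.
  by move=> /le_trans; apply; rewrite (ipC v u); nra.
have := ip_ge0 u; rewrite le_eqVlt => /orP[/eqP u0|u0].
  rewrite -u0 mul0r.
  have : ip u v = 0.
    apply: contrapT => /eqP uv0.
    (* When [ip u u = 0] the polynomial of [key] is affine in [a], and this value of [a] makes it
       equal to -1. *)
    have := key ((ip v v + 1) / (2 * ip u v)).
    rewrite -u0 mulr0 add0r -mulrA [2 * _]mulrA.
    rewrite (_ : _ * _ = ip v v + 1); last by field.
    lra.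
  by move=> ->; rewrite expr0n.
have := key (ip u v / ip u u).
rewrite (_ : _ + _ = (ip u u * ip v v - ip u v ^+ 2) / ip u u); last first.
  by field; exact: lt0r_neq0.
by rewrite pmulr_lge0 ?invr_gt0// subr_ge0.
Qed.

Lemma hnormD u v : L u -> L v -> hnorm (u + v) <= hnorm u + hnorm v.
Proof.
move=> Lu Lv; rewrite -(@ler_pXn2r _ 2)// ?nnegrE ?addr_ge0//.
rewrite hnorm_sqr ipDl ?hip_Dr//; last exact: LD.
rewrite (ipC v u) sqrrD !hnorm_sqr.
by have := hcauchy_schwarz _ _ Lu Lv; rewrite ler_norml => /andP[_]; nra.
Qed.

Lemma hnormZ a u : L u -> hnorm (a *: u) = `|a| * hnorm u.
Proof.
move=> Lu; rewrite /hnorm ipZl ?hip_Zr//; last exact: LZ.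
by rewrite mulrA -expr2 sqrtrM ?sqr_ge0// sqrtr_sqr.
Qed.

Lemma hnormN u : L u -> hnorm (- u) = hnorm u.
Proof. by move=> Lu; rewrite -scaleN1r hnormZ// normrN1 mul1r. Qed.

Lemma hnormB u v : L u -> L v -> hnorm (u - v) <= hnorm u + hnorm v.
Proof. by move=> Lu Lv; rewrite -(hnormN v)//; apply: hnormD => //; exact: hsubspaceN. Qed.

Lemma hdistC u v : L u -> L v -> hnorm (u - v) = hnorm (v - u).
Proof. by move=> Lu Lv; rewrite -opprB hnormN//; exact: hsubspaceB. Qed.

Lemma hnorm_dist u v : L u -> L v -> `|hnorm u - hnorm v| <= hnorm (u - v).
Proof.
move=> Lu Lv; have Luv := hsubspaceB _ _ Lu Lv; have Lvu := hsubspaceB _ _ Lv Lu.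
have := hnormD _ _ Luv Lv; have := hnormD _ _ Lvu Lu.
rewrite !subrK hdistC// ler_norml lerBrDl lerBlDr => ? ?.
by apply/andP; split; lra.
Qed.

Definition hcvg (s : nat -> H) (l : H) := hnorm (s n - l) @[n --> \oo] --> (0 : R).

Lemma hcvgD s l s' l' : (forall n, L (s n)) -> L l -> (forall n, L (s' n)) -> L l' ->
  hcvg s l -> hcvg s' l' -> hcvg (fun n => s n + s' n) (l + l').
Proof.
move=> Ls Ll Ls' Ll' sl sl'.
have h : (hnorm (s n - l) + hnorm (s' n - l')) @[n --> \oo] --> (0 : R).
  by rewrite -[0]addr0; exact: cvgD.
apply: (squeeze_cvgr _ (@cvg_cst _ _ _ _ _) h); apply: nearW => n.
rewrite hnorm_ge0 /= opprD addrACA; apply: hnormD; exact: hsubspaceB.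
Qed.

Lemma hcvgZ a s l : (forall n, L (s n)) -> L l ->
  hcvg s l -> hcvg (fun n => a *: s n) (a *: l).
Proof.
move=> Ls Ll sl; rewrite /hcvg -[0](mulr0 `|a|).
under eq_fun => n do (rewrite -scalerBr hnormZ; last exact: hsubspaceB).
by apply: cvgM => //; exact: cvg_cst.
Qed.

Lemma hcvg_norm s l : (forall n, L (s n)) -> L l -> hcvg s l ->
  hnorm (s n) @[n --> \oo] --> hnorm l.
Proof.
move=> Ls Ll sl; apply/cvgrPdist_le => /= e e0.
have /cvgrPdist_le /(_ _ e0) /= := sl : hnorm (s n - l) @[n --> \oo] --> (0 : R).
apply: filterS => n.
rewrite sub0r normrN ger0_norm ?hnorm_ge0// => h; apply: le_trans h.
by rewrite distrC; exact: hnorm_dist.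
Qed.

(** Cauchy criterion in the form needed for means along approximants: [dl n] is the distance from
    the n-th approximant to its limit. *)
Lemma cvgn_of_dist_bound (z dl : nat -> R) (M : R) : 0 <= M ->
  dl n @[n --> \oo] --> (0 : R) ->
  (\forall N \near \oo, forall n m, (N <= n)%N -> (N <= m)%N ->
     `|z n - z m| <= M * (dl n + dl m)) ->
  cvgn z.
Proof.
move=> M0 dl0 zM; apply/cauchy_cvgP; apply/cauchy_exP => e e0.
(* The summand 1 keeps the denominator positive when [M = 0]. *)
have e1 : 0 < e / (4 * (M + 1)) by rewrite divr_gt0//; lra.
have [N1 _ N1P] := (cvgr_dist_lt _ _ dl0 _ e1).
have [N2 _ N2P] := zM.
pose N := maxn N1 N2; exists (z N); exists N => // n /= Nn.
apply: (le_lt_trans (N2P N2 _ _ _ _ _)) => //=.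
- exact: leq_maxr.
- exact: leq_trans (leq_maxr _ _) Nn.
have := N1P N (leq_maxl _ _); have := N1P n (leq_trans (leq_maxl _ _) Nn).
rewrite /= !sub0r !normrN => /(le_lt_trans (ler_norm _)) h1.
move=> /(le_lt_trans (ler_norm _)) h2.
apply: (@le_lt_trans _ _ (M * (e / (4 * (M + 1)) + e / (4 * (M + 1))))).
  by apply: ler_wpM2l => //; lra.
rewrite (_ : M * _ = (M / (M + 1)) * (e / 2)); last by field; lra.
have : M / (M + 1) < 1 by rewrite ltr_pdivrMr; lra.
nra.
Qed.

(** * Differentiating the mean of an observable in time *)

Section observable.
Context (D : H -> Prop) (K B : H -> H) (C : R).
Hypothesis C0 : 0 <= C.
Hypothesis DL : forall u, D u -> L u.
Hypothesis DB : forall u v, D u -> D v -> D (u - v).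
Hypothesis KL : forall u, D u -> L (K u).
Hypothesis KB : forall u v, D u -> D v -> K (u - v) = K u - K v.
Hypothesis BL : forall u, D u -> L (B u).
Hypothesis BB : forall u v, D u -> D v -> B (u - v) = B u - B v.
Hypothesis Bsym : forall u v, D u -> D v -> ip (B u) v = ip u (B v).
Hypothesis Bbd : forall u, D u -> hnorm (B u) <= C * (hnorm u + hnorm (K u)).

(** As [B] is symmetric, the expansion of its quadratic form is exact: the left side is the absolute
    value of [2 * ip (f - e - h *: K e) (B e) + ip (f - e) (B (f - e))]. Only [B e] and [B (f - e)]
    enter, both controlled by graph norms, so the bound survives in the closure. *)
Lemma observable_increment h e f : D e -> D f ->
  `|ip f (B f) - ip e (B e) - h * (2 * ip (K e) (B e))| <=
  2 * hnorm (f - e - h *: K e) * hnorm (B e) + hnorm (f - e) * hnorm (B (f - e)).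
Proof.
move=> De Df; have Le := DL _ De; have Lf := DL _ Df.
have LBe := BL _ De; have LBf := BL _ Df; have LKe := KL _ De.
have Lfe : L (f - e) by exact: hsubspaceB.
have LhK : L (h *: K e) by exact: LZ.
rewrite (_ : _ - _ = 2 * ip (f - e - h *: K e) (B e) + ip (f - e) (B (f - e))).
  apply: le_trans (ler_normD _ _) _; apply: lerD.
    rewrite normrM ger0_norm// -mulrA ler_pM2l//; apply: hcauchy_schwarz => //.
    exact: hsubspaceB.
  by apply: hcauchy_schwarz => //; apply: BL; exact: DB.
rewrite BB// hip_Bl// (hip_Bl f)// ipZl// (hip_Bl f)//; last exact: hsubspaceB.
by rewrite !hip_Br// -(Bsym e f)// (ipC (B e) f); ring.
Qed.

Context (x y : R -> H) (e : R -> nat -> H).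
Hypothesis Lx : forall t, L (x t).
Hypothesis Ly : forall t, L (y t).
Hypothesis De : forall t n, D (e t n).
Hypothesis ex : forall t, hcvg (e t) (x t).
Hypothesis ey : forall t, hcvg (fun n => K (e t n)) (y t).
Hypothesis xy : forall t,
  hnorm (h^-1 *: (x (t + h) - x t) - y t) @[h --> 0^'] --> (0 : R).
Hypothesis yc : forall t, hnorm (y (t + h) - y t) @[h --> 0^'] --> (0 : R).

(** [B] need not be meaningful at [x t], which only belongs to the domain of the closure; its mean
    and its rate are therefore limits along the approximants [e t]. *)
Definition observable_mean t : R := limn (fun n => ip (e t n) (B (e t n))).
Definition observable_rate t : R := limn (fun n => 2 * ip (K (e t n)) (B (e t n))).

Let G u := hnorm u + hnorm (K u).
Let dl t n := hnorm (e t n - x t) + hnorm (K (e t n) - y t).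

Let dl0 t : dl t n @[n --> \oo] --> (0 : R).
Proof. by rewrite -[0]addr0; apply: cvgD; [exact: ex|exact: ey]. Qed.

Let Le t n : L (e t n). Proof. exact: DL. Qed.
Let LKe t n : L (K (e t n)). Proof. exact: KL. Qed.
Let LBe t n : L (B (e t n)). Proof. exact: BL. Qed.

Let hdist_tri u v w : L u -> L v -> L w -> hnorm (u - v) <= hnorm (u - w) + hnorm (v - w).
Proof.
move=> Lu Lv Lw; rewrite (hdistC v w)//.
rewrite (_ : u - v = (u - w) + (w - v)); last by rewrite addrA subrK.
by apply: hnormD; exact: hsubspaceB.
Qed.

Let Gdl t n m : G (e t n - e t m) <= dl t n + dl t m.
Proof.
rewrite /G /dl KB// addrACA; apply: lerD; exact: hdist_tri.
Qed.

Let G_cvg t : G (e t n) @[n --> \oo] --> hnorm (x t) + hnorm (y t).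
Proof.
by apply: cvgD; apply: hcvg_norm => //.
Qed.

Let G_bd t : exists2 M : R, 0 <= M & \forall n \near \oo, G (e t n) <= M.
Proof.
exists (hnorm (x t) + hnorm (y t) + 1); first by rewrite !addr_ge0.
have /cvgrPdist_le /(_ _ ltr01) /= := G_cvg t; apply: filterS => n.
rewrite distrC => /(le_trans (ler_norm _)); lra.
Qed.

Let G_ge0 u : 0 <= G u. Proof. by rewrite addr_ge0. Qed.

Let Bdist t n m (M : R) : G (e t n) <= M -> G (e t m) <= M ->
  hnorm (B (e t n - e t m)) <= C * (dl t n + dl t m).
Proof.
move=> nM mM; apply: le_trans (Bbd _ (DB _ _ (De t n) (De t m))) _.
by apply: ler_wpM2l => //; exact: Gdl.
Qed.

Let B_le t n (M : R) : G (e t n) <= M -> hnorm (B (e t n)) <= C * M.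
Proof. by move=> nM; apply: le_trans (Bbd _ (De t n)) _; exact: ler_wpM2l. Qed.

Lemma observable_mean_cvg t :
  ip (e t n) (B (e t n)) @[n --> \oo] --> observable_mean t.
Proof.
have [M M0 GM] := G_bd t; apply: (@cvgn_of_dist_bound _ (dl t) (4 * C * M)).
- by rewrite !mulr_ge0.
- exact: dl0.
have [N _ NP] := GM; exists N => // N' NN' n m N'n N'm.
have nM := NP n (leq_trans NN' N'n); have mM := NP m (leq_trans NN' N'm).
(* For h = 0 the expansion compares two approximants at the same time. *)
have := observable_increment 0 (e t m) (e t n) (De t m) (De t n).
rewrite scale0r mul0r !subr0 => /le_trans; apply.
have Bn := B_le _ _ _ nM; have Bm := B_le _ _ _ mM.
have d1 : hnorm (e t n - e t m) <= dl t n + dl t m.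
  by apply: le_trans (Gdl t n m); rewrite lerDl.
have Bnm : hnorm (B (e t n - e t m)) <= 2 * C * M.
  rewrite BB//; apply: (le_trans (hnormB _ _ _ _)) => //; lra.
have h0 := hnorm_ge0 (e t n - e t m).
have CM : 0 <= C * M by exact: mulr_ge0.
apply: (@le_trans _ _ (hnorm (e t n - e t m) * (4 * C * M))); last first.
  by rewrite mulrC; apply: ler_wpM2l => //; lra.
by move: Bm Bnm h0 CM; move: (hnorm _) (hnorm _) (hnorm _) => z1 z2 z3; nra.
Qed.

Lemma observable_rate_cvg t :
  2 * ip (K (e t n)) (B (e t n)) @[n --> \oo] --> observable_rate t.
Proof.
have [M M0 GM] := G_bd t; apply: (@cvgn_of_dist_bound _ (dl t) (4 * C * M)).
- by rewrite !mulr_ge0.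
- exact: dl0.
have [N _ NP] := GM; exists N => // N' NN' n m N'n N'm.
have nM := NP n (leq_trans NN' N'n); have mM := NP m (leq_trans NN' N'm).
rewrite -mulrBr normrM ger0_norm//.
have -> : ip (K (e t n)) (B (e t n)) - ip (K (e t m)) (B (e t m)) =
    ip (K (e t n - e t m)) (B (e t n)) + ip (K (e t m)) (B (e t n - e t m)).
  by rewrite KB// BB// hip_Bl// hip_Br//; ring.
have Lnm : D (e t n - e t m) by exact: DB.
have := hcauchy_schwarz _ _ (KL _ Lnm) (LBe t n).
have := hcauchy_schwarz _ _ (LKe t m) (BL _ Lnm).
have Bn := B_le _ _ _ nM.
have Kd : hnorm (K (e t n - e t m)) <= dl t n + dl t m.
  by apply: le_trans (Gdl t n m); rewrite lerDr.
have Km : hnorm (K (e t m)) <= M by apply: le_trans mM; rewrite lerDr.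
have Bd := Bdist t n m M nM mM.
move=> h1 h2.
have {}h1 := le_trans h1 (ler_pM (hnorm_ge0 _) (hnorm_ge0 _) Km Bd).
have {}h2 := le_trans h2 (ler_pM (hnorm_ge0 _) (hnorm_ge0 _) Kd Bn).
have := ler_normD (ip (K (e t n - e t m)) (B (e t n)))
  (ip (K (e t m)) (B (e t n - e t m))).
by move: (dl t n + dl t m) h1 h2 => dd; nra.
Qed.

Let x_cvg t : hnorm (x (t + h) - x t) @[h --> 0^'] --> (0 : R).
Proof.
have : (`|h| * (hnorm (h^-1 *: (x (t + h) - x t) - y t) + hnorm (y t)))
    @[h --> 0^'] --> (0 : R).
  rewrite -[X in _ --> X](mul0r (0 + hnorm (y t))); apply: cvgM.
    rewrite -[X in _ --> X](@normr0 _ R); apply: cvg_norm.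
    exact: nbhs_dnbhs.
  by apply: cvgD; [exact: xy|exact: cvg_cst].
apply: (squeeze_cvgr _ (@cvg_cst _ _ _ _ _)).
near=> h; have h0 : h != 0 by near: h; exact: nbhs_dnbhs_neq.
rewrite hnorm_ge0 /=.
have Lxx : L (x (t + h) - x t) by exact: hsubspaceB.
rewrite -[X in hnorm X <= _]scale1r -(mulfV h0) -scalerA hnormZ; last exact: LZ.
apply: ler_wpM2l => //.
rewrite -[X in hnorm X <= _](subrK (y t)).
by apply: hnormD => //; apply: hsubspaceB => //; exact: LZ.
Unshelve. all: by end_near. Qed.

(** The expansion is applied between approximants at times [t + h] and [t], and [n] tends to
    infinity at fixed [h], which gives [key]. Divided by h, its first term tends to 0 by
    differentiability of [x]. Its second term is a bounded difference quotient times the graph norm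
    of the increment, which tends to 0 because both [x] and [y] are continuous at [t]. *)
Lemma observable_mean_derive t :
  is_derive t (1 : R) observable_mean (observable_rate t).
Proof.
have key h : `|observable_mean (t + h) - observable_mean t - h * observable_rate t| <=
  2 * hnorm (x (t + h) - x t - h *: y t) * (C * (hnorm (x t) + hnorm (y t))) +
  hnorm (x (t + h) - x t) *
    (C * (hnorm (x (t + h) - x t) + hnorm (y (t + h) - y t))).
  have lhs : `|ip (e (t + h) n) (B (e (t + h) n)) - ip (e t n) (B (e t n)) -
       h * (2 * ip (K (e t n)) (B (e t n)))| @[n --> \oo] -->
     `|observable_mean (t + h) - observable_mean t - h * observable_rate t|.
    apply: cvg_norm; apply: cvgB.
      by apply: cvgB; exact: observable_mean_cvg.
    by apply: cvgM; [exact: cvg_cst|exact: observable_rate_cvg].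
  have Lxx : L (x (t + h) - x t) by exact: hsubspaceB.
  have exx : hcvg (fun n => e (t + h) n - e t n) (x (t + h) - x t).
    apply: hcvgD => //; try by move=> n; exact: hsubspaceN.
    - exact: hsubspaceN.
    - by rewrite -scaleN1r; under eq_fun do rewrite -scaleN1r; exact: hcvgZ.
  have eyy : hcvg (fun n => K (e (t + h) n - e t n)) (y (t + h) - y t).
    under eq_fun do rewrite KB//.
    apply: hcvgD => //; try by move=> n; exact: hsubspaceN.
    - exact: hsubspaceN.
    - by rewrite -scaleN1r; under eq_fun do rewrite -scaleN1r; exact: hcvgZ.
  have exy : hcvg (fun n => e (t + h) n - e t n - h *: K (e t n))
      (x (t + h) - x t - h *: y t).
    have LhK n : L (h *: K (e t n)) by exact: LZ.
    have Lhy : L (h *: y t) by exact: LZ.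
    have Lee n : L (e (t + h) n - e t n) by exact: hsubspaceB.
    apply: hcvgD => //.
    - by move=> n; exact: hsubspaceN.
    - exact: hsubspaceN.
    - rewrite -scaleNr; under eq_fun do rewrite -scaleNr; exact: hcvgZ.
  have rhs : 2 * hnorm (e (t + h) n - e t n - h *: K (e t n)) * (C * G (e t n)) +
     hnorm (e (t + h) n - e t n) * (C * G (e (t + h) n - e t n)) @[n --> \oo] -->
     2 * hnorm (x (t + h) - x t - h *: y t) * (C * (hnorm (x t) + hnorm (y t))) +
     hnorm (x (t + h) - x t) *
     (C * (hnorm (x (t + h) - x t) + hnorm (y (t + h) - y t))).
    have Lee n : L (e (t + h) n - e t n) by exact: hsubspaceB.
    apply: cvgD; apply: cvgM.
    - apply: cvgM; first exact: cvg_cst.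
      apply: hcvg_norm => //; try by move=> *; apply: hsubspaceB => //; exact: LZ.
    - by apply: cvgM; [exact: cvg_cst|exact: G_cvg].
    - exact: hcvg_norm.
    - apply: cvgM; first exact: cvg_cst.
      apply: cvgD; apply: hcvg_norm => //.
      + by move=> n; apply: KL; exact: DB.
      + exact: hsubspaceB.
  apply: (ler_cvg_to lhs rhs); apply: nearW => n.
  apply: (le_trans (observable_increment h _ _ (De t n) (De (t + h) n))).
  apply: lerD; apply: ler_wpM2l => //; first by rewrite mulr_ge0.
  - exact: Bbd.
  - by apply: Bbd; exact: DB.
have q0 : h^-1 * (observable_mean (t + h) - observable_mean t)
    @[h --> 0^'] --> observable_rate t.
  have rhs : (2 * C * (hnorm (x t) + hnorm (y t))) *
      hnorm (h^-1 *: (x (t + h) - x t) - y t) +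
     (hnorm (h^-1 *: (x (t + h) - x t) - y t) + hnorm (y t)) *
     (C * (hnorm (x (t + h) - x t) + hnorm (y (t + h) - y t)))
     @[h --> 0^'] --> (0 : R).
    rewrite -[X in _ --> X](addr0 0); apply: cvgD.
      rewrite -[X in _ --> X](mulr0 (2 * C * (hnorm (x t) + hnorm (y t)))).
      by apply: cvgM; [exact: cvg_cst|exact: xy].
    rewrite -[X in _ --> X](mulr0 (0 + hnorm (y t))).
    apply: cvgM; first by apply: cvgD; [exact: xy|exact: cvg_cst].
    rewrite -[X in _ --> X](mulr0 C); apply: cvgM; first exact: cvg_cst.
    by rewrite -[X in _ --> X](addr0 0); apply: cvgD; [exact: x_cvg|exact: yc].
  apply/cvgrPdist_le => eps eps0; have /cvgrPdist_le /(_ _ eps0) /= bd := rhs.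
  near=> h; have h0 : h != 0 by near: h; exact: nbhs_dnbhs_neq.
  have : `|0 - (2 * C * (hnorm (x t) + hnorm (y t)) *
      hnorm (h^-1 *: (x (t + h) - x t) - y t) +
     (hnorm (h^-1 *: (x (t + h) - x t) - y t) + hnorm (y t)) *
     (C * (hnorm (x (t + h) - x t) + hnorm (y (t + h) - y t))))| <= eps.
    by near: h.
  rewrite sub0r normrN => /(le_trans (ler_norm _)); apply: le_trans; rewrite distrC.
  have Lxx : L (x (t + h) - x t) by exact: hsubspaceB.
  have Lhx : L (h^-1 *: (x (t + h) - x t)) by exact: LZ.
  have Lhxy : L (h^-1 *: (x (t + h) - x t) - y t) by exact: hsubspaceB.
  have n1 : hnorm (x (t + h) - x t - h *: y t) =
      `|h| * hnorm (h^-1 *: (x (t + h) - x t) - y t).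
    by rewrite -hnormZ// scalerBr scalerA mulfV// scale1r.
  have n2 : hnorm (x (t + h) - x t) <=
      `|h| * (hnorm (h^-1 *: (x (t + h) - x t) - y t) + hnorm (y t)).
    rewrite -[X in hnorm X <= _]scale1r -(mulfV h0) -scalerA hnormZ//.
    apply: ler_wpM2l => //; rewrite -[X in hnorm X <= _](subrK (y t)).
    exact: hnormD.
  have hp : 0 < `|h| by rewrite normr_gt0.
  rewrite -(ler_pM2l hp) -normrM mulrBr (mulrA h) mulfV// mul1r.
  apply: (le_trans (key h)); rewrite n1 [leRHS]mulrDr; apply: lerD.
    by rewrite le_eqVlt; apply/orP; left; apply/eqP; ring.
  rewrite [leRHS]mulrA; apply: ler_wpM2r => //.
  by rewrite mulr_ge0 ?addr_ge0.
have q1 : (fun h => h^-1 *: ((observable_mean \o shift t) (h *: (1 : R)) - observable_mean t)) =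
    (fun h => h^-1 * (observable_mean (t + h) - observable_mean t)).
  by apply/funext => h /=; rewrite [h *: 1]mulr1 [h + t]addrC.
apply: DeriveDef; first by rewrite /derivable q1; apply/cvg_ex; exists (observable_rate t).
by rewrite /derive q1; apply/cvg_lim.
Unshelve. all: by end_near. Qed.

End observable.

End prehilbert.

(** * Translation invariance of Lebesgue measure *)

Section borel_rV.
Context {R : realType}.

Lemma measurable_fun_rV dX (X : measurableType dX) d (g : X -> 'rV[R]_d) :
  (forall i, measurable_fun setT (fun x => g x 0 i : measurableTypeR R)) ->
  measurable_fun setT g.
Proof.
move=> mg _ Y mY; rewrite setTI.
have sI : (\big[setU/set0]_(i < d) preimage_set_system setT
    (fun x : 'rV[R]_d => x 0 i : measurableTypeR R) measurable)
    `<=` [set A | measurable (g @^-1` A)].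
  rewrite -bigcup_seq => A [i _ [B mB <-]] /=; rewrite setTI.
  by rewrite -comp_preimage -[X in measurable X]setTI; exact: mg.
move: Y mY; apply: smallest_sub sI; split => /=.
- by rewrite preimage_set0; exact: measurable0.
- by move=> A mA; rewrite setTD preimage_setC; exact: measurableC.
- by move=> F mF; rewrite preimage_bigcup; exact: bigcup_measurable.
Qed.

Lemma measurable_box d (B : 'I_d -> set (measurableTypeR R)) :
  (forall i, measurable (B i)) -> measurable [set x : 'rV[R]_d | forall i, B i (x 0 i)].
Proof.
move=> mB; rewrite (_ : mkset _ = \bigcap_(i in [set` 'I_d])
    ((fun x : 'rV[R]_d => x 0 i : measurableTypeR R) @^-1` B i)).
  apply: fin_bigcap_measurable => // i _; rewrite -[X in measurable X]setTI.
  exact: measurable_coord_rV.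
by apply/seteqP; split=> x /= h i => //; [move=> _|]; exact: h.
Qed.

(** The sigma-algebra is generated by the coordinates, and balls of the sup norm are boxes: an open
    set is the countable union of the boxes with rational centre and half-width that it contains. *)
Lemma open_measurable_rV d (O : set 'rV[R]_d) : open O -> measurable O.
Proof.
move=> oO.
pose box (p : 'rV[rat]_d * rat) : set 'rV[R]_d :=
  [set x | forall i, `](ratr (p.1 0 i - p.2)), (ratr (p.1 0 i + p.2))[%classic (x 0 i)].
have -> : O = \bigcup_p (if `[< box p `<=` O >] then box p else set0).
  apply/seteqP; split => [x Ox|x [p _]]; last by case: asboolP => // h /h.
  have /nbhs_ballP[e /= e0 xeO] : nbhs x O by exact: open_nbhs_nbhs.
  have e2 : 0 < e / 2 by rewrite divr_gt0.
  have [r] := rat_in_itvoo e2.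
  rewrite in_itv /= => /andP[r0 re].
  have /choice[c cP] (i : 'I_d) : exists q : rat, ratr q \in `](x 0 i - ratr r), (x 0 i + ratr r)[.
    by apply: rat_in_itvoo; rewrite ltrD2l; apply: (@lt_trans _ _ 0); rewrite // oppr_lt0.
  exists (\row_i c i, r) => //; rewrite asboolT => [i|y yb] /=.
    have := cP i; rewrite mxE !in_itv /= rmorphB rmorphD /= => /andP[? ?].
    by apply/andP; split; lra.
  apply: xeO; split => // i j; rewrite (ord1 i).
  have := yb j; have := cP j; rewrite /= mxE !in_itv /= rmorphB rmorphD /=.
  move=> /andP[? ?] /andP[? ?].
  by rewrite /ball /= ltr_norml; apply/andP; split; lra.
apply: countable_bigcupT_measurable; first exact: countableP.
move=> p; case: ifPn => // _; rewrite /box.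
apply: (measurable_box d (fun i => `](ratr (p.1 0 i - p.2)), (ratr (p.1 0 i + p.2))[%classic)) => i.
exact: measurable_itv.
Qed.

Lemma continuous_measurable_rV d (f : 'rV[R]_d -> R) :
  continuous f -> measurable_fun setT f.
Proof.
move=> /continuousP cf; apply: (measurability _ (RGenOpens.measurableE R)).
move=> _ [_ [a [b ->] <-]]; rewrite setTI; apply: open_measurable_rV.
exact/cf/interval_open.
Qed.

Lemma lebesgue_measure_shift (h : R) (A : set (measurableTypeR R)) : measurable A ->
  lebesgue_measure ((fun t : measurableTypeR R => t + h : measurableTypeR R) @^-1` A) =
  lebesgue_measure A.
Proof.
move=> mA.
have mh : measurable_fun setT (fun t : measurableTypeR R => t + h : measurableTypeR R).
  by apply: measurable_funD => //; exact: measurable_cst.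
apply/esym.
apply: (@lebesgue_measure_unique R (pushforward (@lebesgue_measure R)
   (fun t : measurableTypeR R => t + h : measurableTypeR R))) => // _ [[a b]] _ <-.
rewrite /= /pushforward.
rewrite (_ : _ @^-1` _ = `](a - h), (b - h)]%classic); last first.
  by apply/seteqP; split => x /=; rewrite !in_itv /= ltrBlDr lerBrDr.
by rewrite /= !lebesgue_measure_itv /= !lte_fin ltrD2r -!EFinD opprB addrA addrNK.
Qed.

Definition shift_rV d (z x : 'rV[R]_d) : 'rV[R]_d := x + z.

Lemma measurable_shift_rV d (z : 'rV[R]_d) : measurable_fun setT (shift_rV d z).
Proof.
apply: measurable_fun_rV => i; rewrite /shift_rV.
under eq_fun do rewrite mxE.
apply: measurable_funD; first exact: measurable_coord_rV.
exact: measurable_cst.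
Qed.

(** Induction on d. In each section over the last d - 1 coordinates, the shift of the first
    coordinate is absorbed by the one-dimensional invariance; the remaining shift [z'] is a change
    of variables for the measure of the induction hypothesis. *)
Lemma lebesgue_rV_shift d (z : 'rV[R]_d) (A : set 'rV[R]_d) : measurable A ->
  lebesgue_rV d (shift_rV d z @^-1` A) = lebesgue_rV d A.
Proof.
elim: d z A => [|d IH] z A mA.
  congr (lebesgue_rV _ _); apply/funext => x /=; congr (A _).
  by apply/rowP; case.
rewrite /= /push_cons /pushforward /product_measure2.
set B := @cons_rV R d @^-1` A.
have mB : measurable B by rewrite -[X in measurable X]setTI; exact: measurable_cons_rV.
pose z' : 'rV[R]_d := \row_i z 0 (lift ord0 i).
pose phi (y : [the measurableType _ of 'rV[R]_d]) := @lebesgue_measure R (ysection B y).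
have mphi : measurable_fun setT phi by exact: measurable_fun_ysection.
transitivity (\int[lebesgue_rV d]_y (phi \o shift_rV d z') y)%E.
  apply: eq_integral => y _ /=; rewrite /phi.
  rewrite -(lebesgue_measure_shift (z 0 0) (ysection B _)); last exact: measurable_ysection.
  congr (lebesgue_measure _); apply/seteqP; split => t; rewrite /ysection /= !inE /B /=.
    congr (A _); apply/rowP => i; rewrite !mxE.
    by case: unliftP => [j ->|->]; rewrite ?mxE.
  congr (A _); apply/rowP => i; rewrite !mxE.
  by case: unliftP => [j ->|->]; rewrite ?mxE.
have := ge0_integral_pushforward (measurable_shift_rV d z') (lebesgue_rV d) (D := setT) (f := phi).
rewrite preimage_setT => <- //.
apply: eq_measure_integral => [|? C mC _]; first exact: measurable_shift_rV.
exact: IH.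
Qed.

Lemma integrable_shift_rV d (z : 'rV[R]_d) (f : 'rV[R]_d -> \bar R) :
  (lebesgue_rV d).-integrable setT f ->
  (lebesgue_rV d).-integrable setT (f \o shift_rV d z).
Proof.
move=> /integrableP[mf fi]; apply/integrableP; split.
  by apply: measurableT_comp mf _; exact: measurable_shift_rV.
apply: le_lt_trans fi.
have := ge0_integral_pushforward (measurable_shift_rV d z) (lebesgue_rV d) (D := setT)
  (f := fun x => `|f x|%E).
rewrite preimage_setT => <- //; last exact: measurableT_comp.
rewrite le_eqVlt; apply/orP; left; apply/eqP.
apply: eq_measure_integral => [|? C mC _]; first exact: measurable_shift_rV.
exact: lebesgue_rV_shift.
Qed.

Lemma integral_shift_rV d (z : 'rV[R]_d) (f : 'rV[R]_d -> \bar R) :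
  (lebesgue_rV d).-integrable setT f ->
  (\int[lebesgue_rV d]_x f (shift_rV d z x) = \int[lebesgue_rV d]_x f x)%E.
Proof.
move=> fi; have [mf _] := integrableP _ _ _ fi.
have := @integral_pushforward _ _ _ _ R _ (measurable_shift_rV d z) (lebesgue_rV d) setT f mf.
rewrite preimage_setT => /(_ (integrable_shift_rV _ _ _ fi)) <- //.
apply: eq_measure_integral => [|? C mC _]; first exact: measurable_shift_rV.
exact: lebesgue_rV_shift.
Qed.

Lemma rV_norm_coord d (x : 'rV[R]_d) i : `|x 0 i| <= `|x|.
Proof.
rewrite [leRHS]/Num.norm /= mx_normrE.
exact: (le_bigmax _ (fun ij : 'I_1 * 'I_d => `|x ij.1 ij.2|) (0, i)).
Qed.

Lemma rV_norm_le d (x : 'rV[R]_d) (M : R) : 0 <= M ->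
  (forall i, `|x 0 i| <= M) -> `|x| <= M.
Proof.
move=> M0 xM; rewrite [leLHS]/Num.norm /= mx_normrE; apply: bigmax_le => // -[i j] _.
by rewrite (ord1 i).
Qed.

Lemma norm_delta_mx d (i : 'I_d) : `|delta_mx 0 i : 'rV[R]_d| <= 1.
Proof.
by apply: rV_norm_le => // j; rewrite mxE eqxx /=; case: (j == i); rewrite ?normr1 ?normr0.
Qed.

(** Compact support without a topological closure, so that stability under algebraic operations is
    pointwise. *)
Definition bounded_support d (f : 'rV[R]_d -> R) : Prop :=
  exists M : R, forall x, M < `|x| -> f x = 0.

Lemma bounded_supportS d (f g : 'rV[R]_d -> R) : bounded_support d f ->
  (forall x, f x = 0 -> g x = 0) -> bounded_support d g.
Proof. by move=> [M fM] fg; exists M => x /fM /fg. Qed.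

Lemma bounded_support2 d (f g h : 'rV[R]_d -> R) : bounded_support d f -> bounded_support d g ->
  (forall x, f x = 0 -> g x = 0 -> h x = 0) -> bounded_support d h.
Proof.
move=> [M fM] [N gN] fg; exists (Num.max M N) => x.
by rewrite gt_max => /andP[/fM f0 /gN g0]; exact: fg.
Qed.

Lemma continuous_bounded_support_le d (f : 'rV[R]_d -> R) :
  continuous f -> bounded_support d f -> exists2 K : R, 0 <= K & forall x, `|f x| <= K.
Proof.
move=> cf [M fM].
have cB : compact [set x : 'rV[R]_d | `|x| <= M].
  apply: bounded_closed_compact.
    by exists M; split; [exact: num_real|move=> N MN x /= /le_trans; apply; exact: ltW].
  apply: (@preimage_closed _ _ (@Num.norm R 'rV[R]_d) [set y | y <= M]).
    by move=> y _; exact: norm_continuous.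
  exact: closed_le.
have /compact_bounded [N [_ NP]] : compact (f @` [set x : 'rV[R]_d | `|x| <= M]).
  by apply: continuous_compact => //; apply: continuous_subspaceT.
exists `|N + 1| => // x; have [xM|/fM ->] := leP `|x| M; last by rewrite normr0.
apply: le_trans (ler_norm _); apply: (NP (N + 1)); first by rewrite ltrDl.
by exists x.
Qed.

Definition cube d (M : R) : set 'rV[R]_d := [set x | forall i, `[- M, M]%classic (x 0 i)].

Lemma measurable_cube d M : measurable (cube d M).
Proof. exact: (measurable_box d (fun=> `[- M, M]%classic)). Qed.

Lemma cube_measure_lty d M : (lebesgue_rV d (cube d M) < +oo)%E.
Proof.
rewrite (@lebesgue_rV_box R d (fun=> `[- M, M]%classic)); last by move=> i; exact: measurable_itv.
suff : (\prod_(i < d) lebesgue_measure (`[(- M)%R, M]%classic : set (measurableTypeR R)))%E \is a fin_num.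
  by rewrite fin_numElt => /andP[].
elim/big_ind : _ => // [x y|_ _]; first exact: fin_numM.
by rewrite lebesgue_measure_itv; case: ifP.
Qed.

Lemma bounded_box_integrable d (f : 'rV[R]_d -> R) (K M : R) :
  measurable_fun setT f -> (forall x, `|f x| <= K) -> (forall x, M < `|x| -> f x = 0) ->
  (lebesgue_rV d).-integrable setT (EFin \o f).
Proof.
move=> mf fK fM.
pose B := cube d M; have mB : measurable B by exact: measurable_cube.
have -> : EFin \o f = (EFin \o f) \_ B.
  apply/funext => x; rewrite /patch; case: ifPn => // /negP xB.
  rewrite /= fM// ltNge; apply/negP => xM; apply: xB; rewrite inE => i /=.
  by rewrite in_itv /= -ler_norml; exact: le_trans (rV_norm_coord _ _ _) xM.
apply/(integrable_mkcond _ mB).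
apply: (@measurable_bounded_integrable _ _ _ _ f B) => //; first exact: cube_measure_lty.
  exact: measurable_funTS.
exists K; split; first exact: num_real.
by move=> N KN x _; exact: le_trans (fK x) (ltW KN).
Qed.

Lemma continuous_integrable d (f : 'rV[R]_d -> R) : continuous f -> bounded_support d f ->
  (lebesgue_rV d).-integrable setT (EFin \o f).
Proof.
move=> cf bf; have [K _ fK] := continuous_bounded_support_le _ _ cf bf.
have [M fM] := bf; apply: (bounded_box_integrable _ _ K M) => //.
exact: continuous_measurable_rV.
Qed.

Lemma is_derive_line (V : normedModType R) (f : V -> R) (x v : V) (s : R) :
  derivable f (x + s *: v) v ->
  is_derive s 1 (fun s : R => f (x + s *: v)) ('D_v f (x + s *: v)).
Proof.
have E : (fun h : R => h^-1 *: ((f \o shift (x + s *: v)) (h *: v) - f (x + s *: v))) =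
    (fun h : R => h^-1 *: (((fun s : R => f (x + s *: v)) \o shift s) (h *: (1 : R)) - f (x + s *: v))).
  by apply/funext => h /=; rewrite [h *: 1]mulr1 scalerDl addrCA.
by rewrite /derivable E => df; apply: DeriveDef => //; rewrite /derive E.
Qed.

Lemma line_mvt (V : normedModType R) (f : V -> R) (x v : V) (h : R) : 0 < h ->
  (forall y, derivable f y v) ->
  exists2 s, 0 < s < h & f (x + h *: v) - f x = 'D_v f (x + s *: v) * h.
Proof.
move=> h0 df.
have dl (s : R) : is_derive s 1 (fun s : R => f (x + s *: v)) ('D_v f (x + s *: v)).
  by apply: is_derive_line.
have cl : {within `[0, h], continuous (fun s : R => f (x + s *: v))}.
  apply: continuous_subspaceT => s; apply: differentiable_continuous.
  by apply/derivable1_diffP; have := dl s; case.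
have [s] := MVT h0 (fun s _ => dl s) cl.
by rewrite in_itv /= => sh; rewrite scale0r addr0 subr0 => ->; exists s.
Qed.

Lemma derive_bounded_support d (f : 'rV[R]_d -> R) v :
  bounded_support d f -> bounded_support d ('D_v f).
Proof.
move=> [M fM]; exists M => x Mx.
have oM : open [set y : 'rV[R]_d | M < `|y|].
  apply: (@open_comp _ _ (@Num.norm R 'rV[R]_d) [set r | M < r]).
    by move=> y _; exact: norm_continuous.
  exact: open_gt.
have nx : \near x, f x = cst 0 x.
  have : nbhs x [set y : 'rV[R]_d | M < `|y|] by exact: open_nbhs_nbhs.
  by apply: filterS => y /fM.
by rewrite (near_eq_derive v nx) derive_cst.
Qed.

(** By translation invariance all difference quotients of [f] have integral 0. They converge
    pointwise to the derivative, and by the mean value theorem they are bounded by its supremum on a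
    fixed cube, so that dominated convergence applies. *)
Lemma integral_derive0 d (f : 'rV[R]_d -> R) (i : 'I_d) :
  continuous f -> bounded_support d f -> (forall x, derivable f x (delta_mx 0 i)) ->
  continuous ('D_(delta_mx 0 i) f) ->
  (\int[lebesgue_rV d]_x ('D_(delta_mx 0 i) f x)%:E = 0)%E.
Proof.
move=> cf bf df cg; set e := delta_mx 0 i; set g := 'D_e f.
have bg : bounded_support d g by exact: derive_bounded_support.
have [K K0 gK] := continuous_bounded_support_le _ _ cg bg.
have [M fM] := bf.
have fi : (lebesgue_rV d).-integrable setT (EFin \o f) by exact: continuous_integrable.
pose h n : R := n.+1%:R^-1.
have h0 n : 0 < h n by rewrite invr_gt0.
have h1 n : h n <= 1 by rewrite invf_le1 // ler1n.
pose q n x := (h n)^-1 * (f (shift_rV d (h n *: e) x) - f x).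
have qi n : (\int[lebesgue_rV d]_x (q n x)%:E = 0)%E.
  have fsi := integrable_shift_rV d (h n *: e) _ fi.
  rewrite (_ : (fun x => _) = (fun x => ((h n)^-1)%:E *
     ((EFin \o f) (shift_rV d (h n *: e) x) - (EFin \o f) x)))%E; last first.
    by apply/funext => x; rewrite /q EFinM EFinB.
  rewrite integralZl //; last exact: integrableB.
  rewrite integralB // integral_shift_rV// subee ?mule0//.
  exact: integrable_fin_num.
have qK n x : `|q n x| <= K.
  have [s _] := line_mvt _ _ x e (h n) (h0 n) df.
  rewrite /q /shift_rV => ->; rewrite mulrCA mulVf ?gt_eqF// mulr1; exact: gK.
(* The step [h n] is at most 1, so enlarging the support by 1 suffices for all n. *)
have q0 n x : M + 1 < `|x| -> q n x = 0.
  move=> Mx; rewrite /q !fM ?subrr ?mulr0//; first by lra.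
  rewrite /shift_rV; have := ler_normB (x + h n *: e) (h n *: e).
  rewrite addrK normrZ gtr0_norm//.
  have : h n * `|e| <= 1.
    rewrite -[leRHS]mulr1; apply: ler_pM => //; [exact: ltW|exact: norm_delta_mx].
  lra.
have mq n : measurable_fun setT (q n).
  apply: measurable_funM; first exact: measurable_cst.
  apply: measurable_funB; last exact: continuous_measurable_rV.
  apply: measurableT_comp; first exact: continuous_measurable_rV.
  exact: measurable_shift_rV.
pose D (x : 'rV[R]_d) : R := K * \1_(cube d (M + 1)) x.
have mB := measurable_cube d (M + 1).
have Di : (lebesgue_rV d).-integrable setT (EFin \o D).
  apply: (bounded_box_integrable _ _ K (M + 1)).
  - apply: measurable_funM; first exact: measurable_cst.
    exact: measurable_indic.
  - move=> x; rewrite /D normrM ger0_norm//.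
    by rewrite indicE; case: (_ \in _); rewrite ?normr1 ?normr0 ?mulr1 ?mulr0.
  move=> x Mx; rewrite /D indicE memNset ?mulr0// => /= xB.
  move: Mx; rewrite ltNge => /negP; apply; apply: rV_norm_le.
    have := xB i; rewrite /= in_itv /= => /andP[]; lra.
  by move=> j; have := xB j; rewrite /= in_itv /= ler_norml.
have qD n x : `|q n x| <= D x.
  rewrite /D indicE; have [xB|xB] := boolP (x \in _); first by rewrite mulr1.
  rewrite mulr0 q0 ?normr0// ltNge; apply/negP => xM; move/negP: xB; apply.
  rewrite inE => j /=; rewrite in_itv /= -ler_norml.
  exact: le_trans (rV_norm_coord _ _ _) xM.
have qg x : q n x @[n --> \oo] --> g x.
  have := df x; rewrite /derivable => /cvg_ex[l lP].
  have gl : g x = l by rewrite /g /derive; exact: cvg_lim lP.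
  rewrite gl.
  have hn : (forall n, h n != 0) /\ h n @[n --> \oo] --> (0 : R).
    by split; [move=> n; rewrite gt_eqF|exact: cvg_harmonic].
  have /cvgr_dnbhsP/(_ h hn) := lP; apply: cvg_trans; apply: near_eq_cvg.
  by apply: nearW => n /=; rewrite /q /shift_rV [x + _]addrC.
have mEq n : measurable_fun setT (EFin \o q n) by exact/measurable_EFinP.
have mEg : measurable_fun setT (EFin \o g).
  by apply/measurable_EFinP; exact: continuous_measurable_rV.
have qgE x : setT x -> (EFin \o q n) x @[n --> \oo] --> (EFin \o g) x.
  by move=> _; apply: cvg_EFin; [exact: nearW|exact: qg].
have [_ _] := @dominated_convergence _ _ _ (lebesgue_rV d) setT measurableT
  (fun n => EFin \o q n) (EFin \o g) (EFin \o D) mEq mEg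
  (aeW _ qgE) Di
  (aeW _ (fun x n _ => qD n x)).
move=> /cvg_lim => <- //.
rewrite (_ : (fun n => _) = cst 0%E) ?lim_cst//.
by apply/funext => n; exact: qi.
Qed.

End borel_rV.

(** * Smooth functions *)

Section flat_functions.
Context {R : realType}.

(* t^-k exp(-1/t) on t > 0; these functions span a space stable under differentiation. *)
Definition flat (k : nat) (t : R) : R := if 0 < t then t ^- k * expR (- t^-1) else 0.

Lemma flat_ge0 k t : 0 <= flat k t.
Proof.
rewrite /flat; case: ltP => // t0.
by rewrite mulr_ge0// ?expR_ge0// invr_ge0 exprn_ge0// ltW.
Qed.

(** Comes from the term of degree k + 2 of the exponential series at 1/t. The quadratic decay makes
    the difference quotients at 0 tend to 0, which is the only delicate point in differentiating
    [flat k]. *)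
Lemma flat_le k t : flat k t <= k.+2`!%:R * t ^+ 2.
Proof.
rewrite /flat; case: ltP => [t0|_]; last by rewrite mulr_ge0// sqr_ge0.
have tV : 0 < t^-1 by rewrite invr_gt0.
have := @expR_ge1Dxn R t^-1 k.+1 (ltW tV).
have f0 : 0 < (k.+2`!%:R : R) by rewrite ltr0n fact_gt0.
move=> h; have {}h : t^-1 ^+ k.+2 / k.+2`!%:R <= expR t^-1 by lra.
rewrite expRN ler_pdivrMr ?expR_gt0//.
apply: le_trans (ler_wpM2l _ h); last by rewrite mulr_ge0// sqr_ge0.
rewrite -exprVn expr2 !exprS.
have -> : k.+2`!%:R * (t * t) * (t^-1 * (t^-1 * t^-1 ^+ k) / k.+2`!%:R) =
  t^-1 ^+ k * (t * t^-1) * (t * t^-1) * (k.+2`!%:R * k.+2`!%:R^-1) by ring.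
by rewrite !mulfV ?gt_eqF// !mulr1.
Qed.

Lemma is_derive_flat k (t : R) :
  is_derive t 1 (flat k) (flat k.+2 t - k%:R * flat k.+1 t).
Proof.
have [t0|t0|<-] := ltgtP 0 t.
- apply: (@near_eq_is_derive _ _ _ (fun t : R => t^-1 ^+ k * expR (- t^-1))).
    by near=> s; rewrite /flat exprVn; case: ltP => // ; rewrite leNgt => /negP; case; near: s; exact: lt_nbhsr.
  have tn : t != 0 by rewrite gt_eqF.
  have dV : is_derive t 1 (fun s : R => s^-1) (- t ^- 2).
    apply: is_derive_eq; first exact: (is_deriveV tn).
    by rewrite scaleNr [_ *: _]mulr1.
  have dE : is_derive t 1 (fun s : R => expR (- s^-1)) (expR (- t^-1) * (- (- t ^- 2))).
    exact: (@is_derive1_comp _ expR (fun s : R => - s^-1)).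
  rewrite (_ : (fun t : R => _) = (fun s : R => s^-1) ^+ k * (fun s : R => expR (- s^-1))); last first.
    by apply/funext => s; rewrite !fctE.
  apply: is_derive_eq; rewrite !fctE /flat t0 /= -!exprVn.
  case: k => [|k].
    by rewrite /= !mul0r scale0r scaler0 !expr0 addr0 subr0 scale1r opprK mulrC.
  rewrite /= -![_ *: _]/(_ * _) !exprS; ring.
- apply: (@near_eq_is_derive _ _ _ (cst 0)).
    near=> s; rewrite /flat; case: ltP => // s0.
    have : s < 0 by near: s; exact: lt_nbhsl.
    by move=> /(lt_trans s0); rewrite ltxx.
  apply: is_derive_eq; rewrite /flat ltNge (ltW t0) /=; lra.
- have f0 : flat k 0 = 0 by rewrite /flat ltxx.
  have q0 : (fun h : R => h^-1 *: ((flat k \o shift 0) (h *: (1 : R)) - flat k 0)) @ 0^' --> (0 : R).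
    apply: norm_cvg0.
    have bd : (k.+2`!%:R * `|h|) @[h --> (0 : R)^'] --> (0 : R).
      rewrite -[X in _ --> X](mulr0 k.+2`!%:R); apply: cvgM; first exact: cvg_cst.
      rewrite -[X in _ --> X](@normr0 _ R); apply: cvg_norm; exact: nbhs_dnbhs.
    apply: (squeeze_cvgr _ (@cvg_cst _ _ _ _ _) bd).
    near=> h; have h0 : h != 0 by near: h; exact: nbhs_dnbhs_neq.
    rewrite normr_ge0 /= f0 subr0 addr0 [h *: 1]mulr1 normrM (ger0_norm (flat_ge0 _ _)).
    rewrite normfV ler_pdivrMl ?normr_gt0//.
    by apply: (le_trans (flat_le k h)); rewrite -(real_normK (num_real h)) expr2 mulrCA.
  have E : flat k.+2 0 - k%:R * flat k.+1 0 = 0 by rewrite /flat ltxx; lra.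
  apply: DeriveDef; first by apply/cvg_ex; exists 0.
  by rewrite E; apply/cvg_lim.
Unshelve. all: by end_near. Qed.

End flat_functions.

Lemma dist_le_of_halves {R : realType} (e p q r s : R) :
  `|p - r| < e / 2 -> `|q - s| < e / 2 -> s = r -> `|p - q| <= e.
Proof.
move=> pr + sr; rewrite {}sr => qr; rewrite -(subrKA r) (splitr e).
by apply: le_trans (ler_normD _ _) (lerD (ltW pr) _); rewrite distrC ltW.
Qed.

(** * The algebra of smooth functions and the symmetry of second derivatives *)

Section smooth_functions.
Context {R : realType} (d : nat).
Local Notation E := 'rV[R]_d.
Local Notation pd i f := ('D_(delta_mx 0 i) f).
Implicit Types f g : E -> R.

Lemma smooth_continuous f : smooth f -> continuous f.
Proof. by move=> /(_ [::])[]. Qed.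

Lemma smooth_derivable f i x : smooth f -> derivable f x (delta_mx 0 i).
Proof. by move=> /(_ [::])[_]. Qed.

Lemma smooth_derive f i : smooth f -> smooth (pd i f).
Proof.
move=> sf s; have := sf (rcons s i).
by rewrite /pderiv foldr_rcons.
Qed.

(** Coinduction principle: smoothness is proved at once for a whole class of functions stable under
    partial derivatives, without formulas for iterated derivatives. *)
Lemma smooth_coind (S : (E -> R) -> Prop) :
  (forall f, S f -> [/\ continuous f, forall i x, derivable f x (delta_mx 0 i)
     & forall i, S (pd i f)]) ->
  forall f, S f -> smooth f.
Proof.
move=> SP f Sf s; elim/last_ind: s f Sf => [|s i IH] f Sf.
  by have [] := SP f Sf.
by rewrite /pderiv foldr_rcons; apply: IH; have [] := SP f Sf.
Qed.

#[local] Opaque smooth.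

Lemma is_derive_coord_comp (g : R -> R) (dg : R) j i (x : E) :
  is_derive (x 0 j) 1 g dg ->
  is_derive x (delta_mx 0 i) (fun y : E => g (y 0 j)) ((i == j)%:R * dg).
Proof.
move=> [dgx <-].
have Eq : (fun h : R => h^-1 *: (((fun y : E => g (y 0 j)) \o shift x) (h *: delta_mx 0 i) - g (x 0 j))) =
  (if i == j then (fun h : R => h^-1 *: ((g \o shift (x 0 j)) (h *: (1 : R)) - g (x 0 j))) else cst 0).
  apply/funext => h /=; rewrite !mxE eqxx /= eq_sym.
  case: (i == j); first by [].
  by rewrite mulr0 add0r subrr scaler0.
apply: DeriveDef; rewrite /derivable /derive Eq; case: (i == j) => //.
- by apply/cvg_ex; exists 0; exact: cvg_cst.
- by rewrite mul1r.
- by rewrite mul0r; apply/cvg_lim => //; exact: cvg_cst.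
Qed.

(* Closed under partial derivatives (the derivative of flat k is in it), so that its elements are smooth. *)
Inductive smooth_alg : (E -> R) -> Prop :=
| SmoothAlg f of smooth f : smooth_alg f
| ConstAlg c : smooth_alg (cst c)
| CoordAlg j : smooth_alg (fun x => x 0 j)
| FlatAlg k j (s b : R) : smooth_alg (fun x => flat k (s * x 0 j + b))
| AddAlg f g of smooth_alg f & smooth_alg g : smooth_alg (f + g)
| MulAlg f g of smooth_alg f & smooth_alg g : smooth_alg (f * g).

Lemma smooth_alg_smooth f : smooth_alg f -> smooth f.
Proof.
apply: smooth_coind => {}f; elim => {f}.
- move=> f sf; split; first exact: smooth_continuous.
    by move=> i x; exact: smooth_derivable.
  by move=> i; apply: SmoothAlg; exact: smooth_derive.
- move=> c; split; first exact: cst_continuous.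
    by move=> i x; exact: derivable_cst.
  move=> i; rewrite (_ : pd i (cst c) = (fun=> 0)); first exact: ConstAlg.
  by apply/funext => x; rewrite derive_cst.
- move=> j; have dj i x := @is_derive_coord_comp id 1 j i x (is_derive_id _ _).
  split; first exact: coord_continuous.
    by move=> i x; have [] := dj i x.
  move=> i; rewrite (_ : pd i (fun x : E => x 0 j) = (fun=> (i == j)%:R * 1)); first exact: ConstAlg.
  by apply/funext => x; have [_ ->] := dj i x.
- move=> k j s b.
  have dl (t : R) : is_derive t 1 (fun t : R => s * t + b) s.
    by apply: is_derive_eq; rewrite addr0 [_ *: _]mulr1.
  have df (t : R) : is_derive t 1 (fun t : R => flat k (s * t + b))
      ((flat k.+2 (s * t + b) - k%:R * flat k.+1 (s * t + b)) * s).
    exact: (@is_derive1_comp _ (flat k) (fun t : R => s * t + b) _ _ _ (is_derive_flat _ _) (dl t)).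
  have dx i x := @is_derive_coord_comp _ _ j i x (df (x 0 j)).
  split.
  + move=> x; apply: (@continuous_comp _ _ _ (fun y : E => y 0 j) (fun t => flat k (s * t + b))).
      exact: coord_continuous.
    apply: differentiable_continuous; apply/derivable1_diffP.
    by have := df (x 0 j); case.
  + by move=> i x; have [] := dx i x.
  + move=> i; rewrite (_ : pd i (fun x : E => flat k (s * x 0 j + b)) = cst ((i == j)%:R * s) *
      ((fun x => flat k.+2 (s * x 0 j + b)) + cst (- k%:R) * (fun x => flat k.+1 (s * x 0 j + b)))).
      apply: MulAlg; first exact: ConstAlg.
      by apply: AddAlg; [exact: FlatAlg|apply: MulAlg; [exact: ConstAlg|exact: FlatAlg]].
    by apply/funext => x; have [_ ->] := dx i x; rewrite !fctE; ring.
- move=> f g af [cf df If] ag [cg dg Ig]; split.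
  + by move=> x; exact: (continuousD (cf x) (cg x)).
  + by move=> i x; apply: derivableD.
  + move=> i; rewrite (_ : pd i (f + g) = pd i f + pd i g); first exact: AddAlg.
    by apply/funext => x; rewrite deriveD.
- move=> f g af [cf df If] ag [cg dg Ig]; split.
  + by move=> x; exact: (continuousM (cf x) (cg x)).
  + by move=> i x; apply: derivableM.
  + move=> i; rewrite (_ : pd i (f * g) = f * pd i g + g * pd i f).
      by apply: AddAlg; apply: MulAlg.
    by apply/funext => x; rewrite deriveM.
Qed.

Lemma smooth_cst c : smooth (cst c : E -> R).
Proof. by apply: smooth_alg_smooth; exact: ConstAlg. Qed.

Lemma smooth_coord j : smooth (fun x : E => x 0 j).
Proof. by apply: smooth_alg_smooth; exact: CoordAlg. Qed.

Lemma smoothD f g : smooth f -> smooth g -> smooth (fun x => f x + g x).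
Proof.
move=> sf sg; apply: smooth_alg_smooth.
by apply: (AddAlg f g); exact: SmoothAlg.
Qed.

Lemma smoothM f g : smooth f -> smooth g -> smooth (fun x => f x * g x).
Proof.
move=> sf sg; apply: smooth_alg_smooth.
by apply: (MulAlg f g); exact: SmoothAlg.
Qed.

Lemma smoothN f : smooth f -> smooth (fun x => - f x).
Proof.
move=> sf; under eq_fun do rewrite -mulN1r.
apply: smoothM sf; exact: smooth_cst.
Qed.

Lemma smoothB f g : smooth f -> smooth g -> smooth (fun x => f x - g x).
Proof. by move=> sf sg; apply: smoothD; [exact: sf|exact: smoothN]. Qed.

Lemma smooth_sum (I : Type) (r : seq I) (F : I -> E -> R) :
  (forall i, smooth (F i)) -> smooth (fun x => \sum_(i <- r) F i x).
Proof.
move=> sF; elim: r => [|i r IH].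
  by under eq_fun do rewrite big_nil; exact: smooth_cst.
by under eq_fun do rewrite big_cons; apply: smoothD; [exact: sF|exact: IH].
Qed.

Lemma smooth_prod (I : Type) (r : seq I) (F : I -> E -> R) :
  (forall i, smooth (F i)) -> smooth (fun x => \prod_(i <- r) F i x).
Proof.
move=> sF; elim: r => [|i r IH].
  by under eq_fun do rewrite big_nil; exact: smooth_cst.
by under eq_fun do rewrite big_cons; apply: smoothM; [exact: sF|exact: IH].
Qed.

Lemma derivable_translate (V : normedModType R) (f : V -> R) (c x v : V) (df : R) :
  is_derive (x + c) v f df -> is_derive x v (fun y => f (y + c)) df.
Proof.
move=> [dfx <-].
have E : (fun h : R => h^-1 *: (((fun y => f (y + c)) \o shift x) (h *: v) - f (x + c))) =
   (fun h : R => h^-1 *: ((f \o shift (x + c)) (h *: v) - f (x + c))).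
  by apply/funext => h /=; rewrite addrA.
by apply: DeriveDef; rewrite /derivable /derive E.
Qed.

(** The second difference of [f] over a square of side h is symmetric in i and j. Two uses of the
    mean value theorem express it by one mixed derivative or by the other, at points close to x, and
    continuity of both concludes. *)
Lemma deriveC f i j x : smooth f -> pd i (pd j f) x = pd j (pd i f) x.
Proof.
move=> sf; apply/eqP; rewrite -subr_eq0 -normr_le0; apply/ler_addgt0Pr => e e0; rewrite add0r.
have e2 : 0 < e / 2 by rewrite divr_gt0.
have ci : continuous (pd i (pd j f)) by do ?apply: smooth_derive; apply: smooth_continuous; do 2!apply: smooth_derive.
have cj : continuous (pd j (pd i f)) by apply: smooth_continuous; do 2!apply: smooth_derive.
have /cvgrPdist_lt/(_ _ e2)/nbhs_ballP[r1 /= r10 r1P] := ci x.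
have /cvgrPdist_lt/(_ _ e2)/nbhs_ballP[r2 /= r20 r2P] := cj x.
(* The intermediate points lie within 2 h of x, hence in both balls of continuity. *)
pose h := Num.min r1 r2 / 3.
have h0 : 0 < h by rewrite divr_gt0// lt_min r10.
have hr : h * 2 < r1 /\ h * 2 < r2.
  have m1 : Num.min r1 r2 <= r1 by rewrite ge_min lexx.
  have m2 : Num.min r1 r2 <= r2 by rewrite ge_min lexx orbT.
  have m0 : 0 < Num.min r1 r2 by rewrite lt_min r10.
  by rewrite /h; split; lra.
have key a b : exists2 z : E, `|z - x| <= h * 2 &
   (f (x + h *: delta_mx 0 a + h *: delta_mx 0 b) - f (x + h *: delta_mx 0 a)) -
   (f (x + h *: delta_mx 0 b) - f x) = pd b (pd a f) z * h * h.
  pose p y := f (y + h *: delta_mx 0 b) - f y.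
  have ds y : is_derive y (delta_mx 0 a) p
     (pd a f (y + h *: delta_mx 0 b) - pd a f y).
    apply: is_deriveB; first exact/derivable_translate/derivableP/smooth_derivable.
    exact/derivableP/smooth_derivable.
  have dp y : derivable p y (delta_mx 0 a) by have [] := ds y.
  have [s1 /andP[s10 s1h]] := line_mvt _ _ x _ _ h0 dp.
  have [_ ->] := ds (x + s1 *: delta_mx 0 a).
  have dpa y : derivable (pd a f) y (delta_mx 0 b).
    exact/smooth_derivable/smooth_derive.
  have [s2 /andP[s20 s2h]] := line_mvt _ _ (x + s1 *: delta_mx 0 a) _ _ h0 dpa.
  rewrite /p => -> ->; exists (x + s1 *: delta_mx 0 a + s2 *: delta_mx 0 b) => //.
  rewrite (_ : _ - x = s1 *: delta_mx 0 a + s2 *: delta_mx 0 b); last first.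
    by rewrite -!addrA addrC addrA subrK.
  apply: le_trans (ler_normD _ _) _; rewrite !normrZ !gtr0_norm//.
  have na := @norm_delta_mx R d a; have nb := @norm_delta_mx R d b.
  nra.
have [z1 z1x E1] := key i j; have [z2 z2x E2] := key j i.
have mixed (A1 A2 p q r s : R) : p - q - (r - s) = A1 * h * h ->
    p - r - (q - s) = A2 * h * h -> A1 = A2.
  move=> e1 e3; apply: (mulIf (_ : h * h != 0)); first by rewrite mulf_neq0// gt_eqF.
  by rewrite [LHS]mulrA [RHS]mulrA -e1 -e3; ring.
rewrite (addrAC x (h *: delta_mx 0 i)) in E1.
have E := mixed _ _ _ _ _ _ E1 E2.
have [hr1 hr2] := hr.
have b1 : `|pd i (pd j f) x - pd i (pd j f) z2| < e / 2.
  by apply: r1P; rewrite -ball_normE /ball_ /= distrC; exact: le_lt_trans hr1.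
have b2 : `|pd j (pd i f) x - pd j (pd i f) z1| < e / 2.
  by apply: r2P; rewrite -ball_normE /ball_ /= distrC; exact: le_lt_trans hr2.
exact: dist_le_of_halves b1 b2 E.
Qed.

End smooth_functions.

(** * Test functions and states *)

(* Locked, as conversion otherwise unfolds limits and integrals. *)
HB.lock Definition partial {R : realType} {d : nat} (i : 'I_d) (f : 'rV[R]_d -> R) :
  'rV[R]_d -> R := 'D_(delta_mx 0 i) f.

Lemma partialE {R : realType} {d : nat} (i : 'I_d) (f : 'rV[R]_d -> R) :
  partial i f = 'D_(delta_mx 0 i) f.
Proof. by rewrite unlock. Qed.

HB.lock Definition rint {R : realType} (d : nat) (f : 'rV[R]_d -> R) : R :=
  \int[lebesgue_rV d]_x f x.

Lemma rintE {R : realType} (d : nat) (f : 'rV[R]_d -> R) :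
  rint d f = \int[lebesgue_rV d]_x f x.
Proof. by rewrite unlock. Qed.

(** * Integration of compactly supported functions *)

Section compactly_supported.
Context {R : realType} (d : nat).
Local Notation E := 'rV[R]_d.
Local Notation mu := (lebesgue_rV d).
Local Notation pd i f := (partial i f).
Implicit Types f g : E -> R.

Lemma smooth_partial f i : smooth f -> smooth (pd i f).
Proof. by rewrite partialE; exact: smooth_derive. Qed.

Lemma partialC f i j x : smooth f -> pd i (pd j f) x = pd j (pd i f) x.
Proof. by rewrite !partialE; exact: deriveC. Qed.

Definition test f : Prop := smooth f /\ bounded_support d f.

#[local] Opaque smooth bounded_support.

Lemma test_integrable f : test f -> mu.-integrable setT (EFin \o f).
Proof. by case=> sf bf; apply: continuous_integrable => //; exact: smooth_continuous. Qed.

Lemma testMl f g : test f -> smooth g -> test (fun x => g x * f x).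
Proof.
move=> [sf bf] sg; split; first exact: smoothM.
by apply: (bounded_supportS _ f) => // x ->; rewrite mulr0.
Qed.

Lemma testMr f g : test f -> smooth g -> test (fun x => f x * g x).
Proof.
move=> tf sg; rewrite (_ : (fun x => _) = (fun x => g x * f x)); first exact: testMl.
by apply/funext => x; rewrite mulrC.
Qed.

Lemma testD f g : test f -> test g -> test (fun x => f x + g x).
Proof.
move=> [sf bf] [sg bg]; split; first exact: smoothD.
by apply: (bounded_support2 _ f g) => // x -> ->; rewrite addr0.
Qed.

Lemma testN f : test f -> test (fun x => - f x).
Proof.
move=> [sf bf]; split; first exact: smoothN.
by apply: (bounded_supportS _ f) => // x ->; rewrite oppr0.
Qed.

Lemma testB f g : test f -> test g -> test (fun x => f x - g x).
Proof. by move=> tf tg; apply: testD => //; exact: testN. Qed.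

Lemma testZ (c : R) f : test f -> test (fun x => c * f x).
Proof. by move=> tf; apply: testMl => //; exact: smooth_cst. Qed.

Lemma testX f n : test f -> test (fun x => f x ^+ n.+1).
Proof.
move=> tf; elim: n => [|n IH]; first by under eq_fun do rewrite expr1.
under eq_fun do rewrite exprS; apply: testMl => //; exact: tf.1.
Qed.

Lemma test0 : test (fun=> 0 : R).
Proof. by split; [exact: smooth_cst|exists 0]. Qed.

Lemma test_sum (I : Type) (r : seq I) (F : I -> E -> R) :
  (forall i, test (F i)) -> test (fun x => \sum_(i <- r) F i x).
Proof.
move=> tF; elim: r => [|i r IH].
  by under eq_fun do rewrite big_nil; exact: test0.
by under eq_fun do rewrite big_cons; apply: testD; [exact: tF|exact: IH].
Qed.

Lemma test_derive f i : test f -> test (pd i f).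
Proof. move=> [sf bf]; rewrite partialE; by split; [exact: smooth_derive|exact: derive_bounded_support]. Qed.

Lemma derive_smoothM f g i x : smooth f -> smooth g ->
  pd i (fun x => f x * g x) x = f x * pd i g x + g x * pd i f x.
Proof.
by move=> sf sg; rewrite !partialE; apply: (@deriveM _ _ f g); apply: smooth_derivable.
Qed.

Lemma derive_smoothB f g i x : smooth f -> smooth g ->
  pd i (fun x => f x - g x) x = pd i f x - pd i g x.
Proof.
by move=> sf sg; rewrite !partialE; apply: (@deriveB _ _ _ f g); apply: smooth_derivable.
Qed.

Lemma derive_smoothZ (c : R) (f : E -> R) i x : smooth f ->
  pd i (fun x => c * f x) x = c * pd i f x.
Proof.
move=> sf; have := derive_smoothM (fun=> c) f i x (smooth_cst _ _) sf.
by rewrite [pd i (fun=> c)]partialE derive_cst mulr0 addr0.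
Qed.

Lemma derive_smoothD (f g : E -> R) i x : smooth f -> smooth g ->
  pd i (fun x => f x + g x) x = pd i f x + pd i g x.
Proof. by move=> sf sg; rewrite !partialE; apply: (@deriveD _ _ _ f g); apply: smooth_derivable. Qed.

Lemma derive_smooth_sum (I : Type) (r : seq I) (F : I -> E -> R) j x :
  (forall i, smooth (F i)) ->
  pd j (fun x => \sum_(i <- r) F i x) x = \sum_(i <- r) pd j (F i) x.
Proof.
move=> sF; elim: r => [|i r IH].
  rewrite big_nil (_ : (fun x => _) = cst 0); first by rewrite partialE; exact: derive_cst.
  by apply/funext => y; rewrite big_nil.
rewrite (_ : (fun x => _) = (fun x => F i x + \sum_(j <- r) F j x)).
  rewrite (derive_smoothD (F i) (fun x => \sum_(j <- r) F j x)) ?IH ?big_cons//.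
  exact: smooth_sum.
by apply/funext => y; rewrite big_cons.
Qed.

Lemma derive_smoothX2 f i x : smooth f -> pd i (fun x => f x ^+ 2) x = 2 * f x * pd i f x.
Proof.
move=> sf; transitivity (pd i (fun y => f y * f y) x); first by [].
by rewrite (derive_smoothM f f i x sf sf); ring.
Qed.

Local Notation rint := (@rint R d).

Lemma rintD f g : mu.-integrable setT (EFin \o f) -> mu.-integrable setT (EFin \o g) ->
  rint (fun x => f x + g x) = rint f + rint g.
Proof. by move=> ? ?; rewrite !rintE RintegralD. Qed.

Lemma rintZ (c : R) f : mu.-integrable setT (EFin \o f) -> rint (fun x => c * f x) = c * rint f.
Proof. by move=> ?; rewrite !rintE RintegralZl. Qed.

Lemma le_rint f g : mu.-integrable setT (EFin \o f) -> mu.-integrable setT (EFin \o g) ->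
  (forall x, f x <= g x) -> rint f <= rint g.
Proof. by move=> fi gi fg; rewrite !rintE; apply: le_Rintegral => // x _; exact: fg. Qed.

Lemma rint_ge0 f : (forall x, 0 <= f x) -> 0 <= rint f.
Proof. by move=> f0; rewrite rintE; apply: Rintegral_ge0. Qed.

Lemma integrableD_real f g : mu.-integrable setT (EFin \o f) ->
  mu.-integrable setT (EFin \o g) -> mu.-integrable setT (EFin \o (fun x => f x + g x)).
Proof. exact: (@integrableD _ _ _ mu _ measurableT). Qed.

Lemma integrableZ_real (c : R) f : mu.-integrable setT (EFin \o f) ->
  mu.-integrable setT (EFin \o (fun x => c * f x)).
Proof. exact: (@integrableZl _ _ _ mu _ measurableT c). Qed.

Lemma integrable_sum_real (I : Type) (r : seq I) (F : I -> E -> R) :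
  (forall i, mu.-integrable setT (EFin \o F i)) ->
  mu.-integrable setT (EFin \o (fun x => \sum_(i <- r) F i x)).
Proof.
move=> iF; elim: r => [|i r IH].
  by under eq_fun do rewrite big_nil; exact: integrable0.
under eq_fun do rewrite big_cons; exact: integrableD_real.
Qed.

Lemma rint0 : rint (fun=> 0) = 0.
Proof. by rewrite rintE /Rintegral integral0. Qed.

Lemma rint_sum (I : Type) (r : seq I) (F : I -> E -> R) :
  (forall i, mu.-integrable setT (EFin \o F i)) ->
  rint (fun x => \sum_(i <- r) F i x) = \sum_(i <- r) rint (F i).
Proof.
move=> iF; elim: r => [|i r IH].
  by rewrite big_nil; under eq_fun do rewrite big_nil; exact: rint0.
rewrite big_cons -IH -rintD//.
  by congr rint; apply/funext => x; rewrite big_cons.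
exact: integrable_sum_real.
Qed.

Lemma rint_derive f i : test f -> rint (pd i f) = 0.
Proof.
move=> [sf bf]; rewrite partialE rintE /Rintegral integral_derive0 //.
- exact: smooth_continuous.
- by move=> x; exact: smooth_derivable.
- exact/smooth_continuous/smooth_derive.
Qed.

(** Integration by parts in the form used throughout: two densities differing by the divergence of a
    compactly supported field have the same integral. Each identity below then amounts to exhibiting
    the field [G] and checking a pointwise equality. *)
Lemma rint_divergence f g (G : 'I_d -> E -> R) : test g -> (forall i, test (G i)) ->
  (forall x, f x = g x + \sum_i pd i (G i) x) -> rint f = rint g.
Proof.
move=> tg tG fE; have tdG i : test (pd i (G i)) by exact: test_derive.
have -> : f = (fun x => g x + \sum_i pd i (G i) x) by exact/funext.
rewrite rintD; first rewrite rint_sum.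
- by rewrite big1 ?addr0// => i _; exact: rint_derive.
- by move=> i; exact: test_integrable.
- exact: test_integrable.
- by apply: test_integrable; exact: test_sum.
Qed.

End compactly_supported.

Section states.
Context {R : realType} (d : nat).
Local Notation E := 'rV[R]_d.
Local Notation mu := (lebesgue_rV d).

(* The complex-valued function f is encoded as the pair (Re f, Im f). *)
Definition state : lmodType R := ((E -> R^o) * (E -> R^o))%type.

Definition square_integrable (f : E -> R) : Prop :=
  measurable_fun setT f /\ mu.-integrable setT (EFin \o (fun x => f x ^+ 2)).

Lemma integrable_mul_square f g : square_integrable f -> square_integrable g ->
  mu.-integrable setT (EFin \o (fun x => f x * g x)).
Proof.
move=> [mf fi] [mg gi].
apply: (le_integrable measurableT _ _ (integrableD_real _ _ _ fi gi)).
  by apply/measurable_EFinP; exact: measurable_funM.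
move=> x _ /=; rewrite lee_fin [leRHS]ger0_norm ?addr_ge0 ?sqr_ge0//.
by rewrite ler_norml; apply/andP; split; nra.
Qed.

Lemma square_integrableD f g : square_integrable f -> square_integrable g ->
  square_integrable (fun x => f x + g x).
Proof.
move=> sf sg; have [mf fi] := sf; have [mg gi] := sg.
split; first exact: measurable_funD.
rewrite (_ : (fun x => _) = (fun x => f x ^+ 2 + (g x ^+ 2 + 2 * (f x * g x)))).
  apply: integrableD_real => //; apply: integrableD_real => //.
  by apply: integrableZ_real; exact: integrable_mul_square.
by apply/funext => x; ring.
Qed.

Lemma square_integrableZ c f : square_integrable f -> square_integrable (fun x => c * f x).
Proof.
move=> [mf fi]; split; first by apply: measurable_funM => //; exact: measurable_cst.
rewrite (_ : (fun x => _) = (fun x => c ^+ 2 * f x ^+ 2)); first exact: integrableZ_real.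
by apply/funext => x; rewrite exprMn.
Qed.

Lemma test_square_integrable f : test d f -> square_integrable f.
Proof.
move=> tf; split; first by apply: continuous_measurable_rV; apply: smooth_continuous; exact: tf.1.
by apply: test_integrable; exact: testX.
Qed.

Definition in_L2 (u : state) : Prop := square_integrable u.1 /\ square_integrable u.2.

(** The real part of the Hermitian product: L^2 is treated as a real space, on which -i is one more
    linear operator. *)
Definition ip (u v : state) : R := rint d (fun x => u.1 x * v.1 x + u.2 x * v.2 x).

Lemma in_L2D u v : in_L2 u -> in_L2 v -> in_L2 (u + v).
Proof. by move=> [u1 u2] [v1 v2]; split; apply: square_integrableD. Qed.

Lemma in_L2Z (c : R) u : in_L2 u -> in_L2 (c *: u).
Proof. by move=> [u1 u2]; split; apply: square_integrableZ. Qed.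

Lemma ip_integrable u v : in_L2 u -> in_L2 v ->
  mu.-integrable setT (EFin \o (fun x => u.1 x * v.1 x + u.2 x * v.2 x)).
Proof.
move=> [u1 u2] [v1 v2].
by apply: integrableD_real; apply: integrable_mul_square.
Qed.

Lemma ipC u v : ip u v = ip v u.
Proof. by rewrite /ip; congr rint; apply/funext => x; ring. Qed.

Lemma ipDl u v w : in_L2 u -> in_L2 v -> in_L2 w -> ip (u + v) w = ip u w + ip v w.
Proof.
move=> Lu Lv Lw; rewrite /ip -rintD; [|exact: ip_integrable..].
by congr rint; apply/funext => x; rewrite !mulrDl addrACA.
Qed.

Lemma ipZl (c : R) u w : in_L2 u -> in_L2 w -> ip (c *: u) w = c * ip u w.
Proof.
move=> Lu Lw; rewrite /ip -rintZ; last exact: ip_integrable.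
by congr rint; apply/funext => x; rewrite mulrDr !mulrA.
Qed.

Lemma ip_ge0 u : 0 <= ip u u.
Proof. by apply: rint_ge0 => x; rewrite addr_ge0 // -expr2 sqr_ge0. Qed.

Definition test_state (u : state) : Prop := test d u.1 /\ test d u.2.

Lemma test_state_in_L2 u : test_state u -> in_L2 u.
Proof. by case=> ? ?; split; apply: test_square_integrable. Qed.

Lemma test_stateB u v : test_state u -> test_state v -> test_state (u - v).
Proof. by move=> [? ?] [? ?]; split; apply: testB. Qed.

End states.

Ltac prove_smooth := cbv beta; lazymatch goal with
  | |- smooth (fun x => @?f x + - @?g x) => refine (smoothB _ f g _ _); prove_smooth
  | |- smooth (fun x => @?f x + @?g x) => refine (smoothD _ f g _ _); prove_smooth
  | |- smooth (fun x => @?f x * @?g x) => refine (smoothM _ f g _ _); prove_smooth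
  | |- smooth (fun x => - @?f x) => refine (smoothN _ f _); prove_smooth
  | |- smooth (fun x => partial ?i ?f x) => refine (smooth_partial _ f i _); prove_smooth
  | |- smooth (partial ?i ?f) => refine (smooth_partial _ f i _); prove_smooth
  | |- smooth (fun x => ?f x) =>
      match goal with H : smooth ?g |- _ => constr_eq f g; exact H end
  | |- smooth ?f =>
      first [match goal with H : smooth ?g |- _ => constr_eq f g; exact H end
            |exact (smooth_cst _ _)]
  end.

(** A product is a test function as soon as one factor is and the other is smooth. Which factor it
    is cannot be read off the syntax, so both choices are tried to the end. *)
Ltac prove_test := cbv beta; lazymatch goal with
  | |- test _ (fun x => @?f x + - @?g x) => refine (testB _ f g _ _); prove_test
  | |- test _ (fun x => @?f x + @?g x) => refine (testD _ f g _ _); prove_test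
  | |- test _ (fun x => @?f x * @?g x) =>
      first [refine (testMl _ g f _ _); [solve [prove_test]|solve [prove_smooth]]
            |refine (testMr _ f g _ _); [solve [prove_test]|solve [prove_smooth]]]
  | |- test _ (fun x => - @?f x) => refine (testN _ f _); prove_test
  | |- test _ (fun x => @?f x ^+ 2) => refine (testX _ f 1 _); prove_test
  | |- test _ (fun x => bigop.body _ ?r (fun i => BigBody i _ _ (@?F x i))) =>
      refine (test_sum _ _ r (fun i x => F x i) _); intro; prove_test
  | |- test _ (fun x => partial ?i ?f x) => refine (test_derive _ f i _); prove_test
  | |- test _ (partial ?i ?f) => refine (test_derive _ f i _); prove_test
  | |- test _ (fun x => ?f x) =>
      match goal with H : test _ ?g |- _ => constr_eq f g; exact H end
  | |- test _ ?f =>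
      match goal with H : test _ ?g |- _ => constr_eq f g; exact H end
  end.

(** * Integrations by parts for the Hamiltonian *)

HB.lock Definition hamiltonian {R : realType} (d : nat) (V a : 'rV[R]_d -> R) : 'rV[R]_d -> R :=
  fun x => V x * a x - 2^-1 * \sum_i partial i (partial i a) x.

Section identities.
Context {R : realType} (d : nat).
Local Notation E := 'rV[R]_d.
Local Notation pd i f := (partial i f).
Local Notation test := (@test R d).
Local Notation rintd := (@rint R d).

#[local] Opaque smooth bounded_support.

Lemma testT (f : E -> R) : test f -> smooth f. Proof. by case. Qed.

Lemma rint_momentum_sym (v : E) (a b c e : E -> R) : test a -> test b -> test c -> test e ->
  rintd (fun x => (\sum_i v 0 i * pd i b x) * c x + (- \sum_i v 0 i * pd i a x) * e x) =
  rintd (fun x => a x * (\sum_i v 0 i * pd i e x) + b x * (- \sum_i v 0 i * pd i c x)).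
Proof.
move=> ta tb tc te; have sa := testT _ ta; have sb := testT _ tb.
have sc := testT _ tc; have se := testT _ te.
apply: (rint_divergence _ _ _ (fun i x => v 0 i * (b x * c x - a x * e x))).
- prove_test.
- by move=> i; prove_test.
move=> x; rewrite mulrN mulNr !mulr_suml !mulr_sumr -!sumrN -!big_split /=.
apply: eq_bigr => i _.
rewrite (derive_smoothZ _ (v 0 i) (fun x => b x * c x - a x * e x)); last by prove_smooth.
rewrite (derive_smoothB _ (fun x => b x * c x) (fun x => a x * e x)); [|prove_smooth..].
rewrite !derive_smoothM//.
move: (pd i c x) (pd i e x) (pd i a x) (pd i b x) => *; ring.
Qed.

Local Notation hamiltonian := (@hamiltonian R d).

Lemma hamiltonianE (V a : E -> R) (x : E) :
  hamiltonian V a x = V x * a x - 2^-1 * \sum_i pd i (pd i a) x.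
Proof. by rewrite unlock. Qed.

Lemma hamiltonian_test V a : smooth V -> test a -> test (hamiltonian V a).
Proof. by move=> sV ta; have sa := testT _ ta; rewrite unlock; prove_test. Qed.


Lemma rint_hamiltonian_form V (a b : E -> R) : smooth V -> test a -> test b ->
  rintd (fun x => a x * hamiltonian V b x) =
  rintd (fun x => V x * (a x * b x) + 2^-1 * \sum_i pd i a x * pd i b x).
Proof.
move=> sV ta tb; have sa := testT _ ta; have sb := testT _ tb.
apply: (rint_divergence _ _ _ (fun i x => - 2^-1 * (a x * pd i b x))).
- prove_test.
- by move=> i; prove_test.
move=> x; rewrite hamiltonianE mulrBr mulrCA -addrA; congr (_ + _).
rewrite mulrCA mulr_sumr !mulr_sumr -sumrN -big_split /=; apply: eq_bigr => i _.
rewrite (derive_smoothZ _ _ (fun x => a x * pd i b x)); last by prove_smooth.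
rewrite (derive_smoothM _ a (pd i b)); [|prove_smooth..].
move: (pd i (pd i b) x) (pd i a x) (pd i b x) (2^-1 : R) => *; ring.
Qed.

(** Commutator of the Hamiltonian with multiplication by [phi]: the potential cancels, and what
    remains is the pairing of grad phi with the probability current a grad b - b grad a. *)
Lemma rint_multiplier_rate V (phi a b : E -> R) : smooth V -> smooth phi -> test a -> test b ->
  2 * rintd (fun x => hamiltonian V b x * (phi x * a x) - hamiltonian V a x * (phi x * b x)) =
  rintd (fun x => \sum_i pd i phi x * (a x * pd i b x - b x * pd i a x)).
Proof.
move=> sV sp ta tb; have sa := testT _ ta; have sb := testT _ tb.
have sVb := testT _ (hamiltonian_test _ _ sV tb).
have sVa := testT _ (hamiltonian_test _ _ sV ta).
have tF : test (fun x => hamiltonian V b x * (phi x * a x) - hamiltonian V a x * (phi x * b x)).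
  have tVb := hamiltonian_test _ _ sV tb; have tVa := hamiltonian_test _ _ sV ta.
  by prove_test.
rewrite -(rintZ _ 2 _ (test_integrable _ _ tF)).
apply: (rint_divergence _ _ _ (fun i x => phi x * (b x * pd i a x - a x * pd i b x))).
- prove_test.
- by move=> i; prove_test.
move=> x; rewrite -big_split /=.
transitivity (\sum_i phi x * (b x * pd i (pd i a) x - a x * pd i (pd i b) x)).
  rewrite (hamiltonianE V a x) (hamiltonianE V b x).
  have alg (F G : 'I_d -> R) (v p p1 p2 : R) :
      2 * ((v * p2 - 2^-1 * \sum_i G i) * (p * p1) - (v * p1 - 2^-1 * \sum_i F i) * (p * p2)) =
      \sum_i p * (p2 * F i - p1 * G i).
    by rewrite -mulr_sumr sumrB -!mulr_sumr; field.
  exact: alg.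
apply: eq_bigr => i _.
rewrite (derive_smoothM _ phi (fun x => b x * pd i a x - a x * pd i b x)); [|prove_smooth..].
rewrite (derive_smoothB _ (fun x => b x * pd i a x) (fun x => a x * pd i b x)); [|prove_smooth..].
rewrite (derive_smoothM _ b (pd i a)); [|prove_smooth..].
rewrite (derive_smoothM _ a (pd i b)); [|prove_smooth..].
move: (pd i (pd i b) x) (pd i (pd i a) x) (pd i a x) (pd i b x) (pd i phi x) => *; ring.
Qed.

(* The kinetic part commutes with translations. *)
Lemma rint_hamiltonian_derive V (a : E -> R) j : smooth V -> test a ->
  2 * rintd (fun x => hamiltonian V a x * pd j a x) = rintd (fun x => - (pd j V x * a x ^+ 2)).
Proof.
move=> sV ta; have sa := testT _ ta.
have sVa := testT _ (hamiltonian_test _ _ sV ta).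
pose w x := V x * a x ^+ 2 + 2^-1 * \sum_k pd k a x ^+ 2.
have tw : test w by rewrite /w; prove_test.
rewrite -rintZ; last by apply: test_integrable; prove_test.
(* The field is the j-th row of the stress tensor. In its divergence the terms with grad a against
   second derivatives cancel, by symmetry of the latter. *)
apply: (rint_divergence _ _ _
  (fun i x => (i == j)%:R * w x - pd i a x * pd j a x)).
- prove_test.
- by move=> i; prove_test.
move=> x; have sw : smooth w by exact: testT.
have dw : pd j w x = 2 * V x * a x * pd j a x + pd j V x * a x ^+ 2 +
    \sum_k pd k a x * pd j (pd k a) x.
  have sa2 : smooth (fun x => a x ^+ 2) by apply: testT; prove_test.
  have sk2 k : smooth (fun x => pd k a x ^+ 2) by apply: testT; prove_test.
  have ss : smooth (fun x => \sum_k pd k a x ^+ 2) by exact: smooth_sum.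
  rewrite (derive_smoothD _ (fun x => V x * a x ^+ 2) (fun x => 2^-1 * \sum_k pd k a x ^+ 2)).
  - rewrite (derive_smoothM _ V (fun x => a x ^+ 2)) // derive_smoothX2//.
    rewrite (derive_smoothZ _ _ (fun x => \sum_k pd k a x ^+ 2)) // derive_smooth_sum//.
    congr (_ + _); first by move: (pd j a x) (pd j V x) => *; ring.
    rewrite mulr_sumr; apply: eq_bigr => k _.
    rewrite derive_smoothX2; last exact: smooth_partial.
    by move: (pd j (pd k a) x) (pd k a x) => *; field.
  - by prove_smooth.
  - by prove_smooth.
transitivity (- (pd j V x * a x ^+ 2) + (\sum_i - (pd i (pd i a) x * pd j a x +
    pd i a x * pd i (pd j a) x) + pd j w x)).
  rewrite dw sumrN big_split /= -mulr_suml.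
  have alg (Vx ax S p q T T' : R) : T = T' -> 2 * ((Vx * ax - 2^-1 * S) * p) =
      - (q * ax ^+ 2) + (- (S * p + T) + (2 * Vx * ax * p + q * ax ^+ 2 + T')).
    by move=> ->; field.
  rewrite hamiltonianE; apply: alg.
  apply: eq_bigr => i _.
  by rewrite (partialC _ a i j x sa).
congr (_ + _).
have -> : pd j w x = \sum_i (i == j)%:R * pd i w x.
  by rewrite (bigD1 j)//= eqxx mul1r big1 ?addr0// => i /negbTE ->; rewrite mul0r.
rewrite -big_split /=; apply: eq_bigr => i _.
rewrite (derive_smoothB _ (fun x => (i == j)%:R * w x) (fun x => pd i a x * pd j a x)).
- rewrite (derive_smoothZ _ _ w)// (derive_smoothM _ (pd i a) (pd j a)).
  + have alg (p q r s t : R) : - (p * q + r * s) + t = t - (r * s + q * p) by ring.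
    exact: alg.
  + by prove_smooth.
  + by prove_smooth.
- by prove_smooth.
- by prove_smooth.
Qed.

End identities.

(** * Bounds on the potential *)

Section potential.
Context {R : realType} (d : nat).
Local Notation E := 'rV[R]_d.
Local Notation pd i f := (partial i f).

#[local] Opaque smooth.

Definition dotv (v x : E) : R := \sum_i v 0 i * x 0 i.

Lemma smooth_dotv v : smooth (dotv v).
Proof.
apply: smooth_sum => i.
by apply: (smoothM _ (fun=> v 0 i) (fun x => x 0 i)); [exact: smooth_cst|exact: smooth_coord].
Qed.

Lemma derive_coord i j (x : E) : pd j (fun x : E => x 0 i) x = (j == i)%:R.
Proof.
rewrite partialE; have [_ ->] := is_derive_coord_comp d id 1 i j x (is_derive_id _ _).
by rewrite mulr1.
Qed.

Lemma derive_dotv v j (x : E) : pd j (dotv v) x = v 0 j.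
Proof.
rewrite /dotv (derive_smooth_sum d _ _ (fun i x => v 0 i * x 0 i)); last first.
  move=> i; apply: (smoothM _ (fun=> v 0 i) (fun x => x 0 i)); first exact: smooth_cst.
  exact: smooth_coord.
rewrite (bigD1 j)//= big1 ?addr0.
  by rewrite (derive_smoothZ _ _ (fun x => x 0 j)) ?derive_coord ?eqxx ?mulr1//; exact: smooth_coord.
move=> i ij; rewrite (derive_smoothZ _ _ (fun x => x 0 i)); last exact: smooth_coord.
by rewrite derive_coord eq_sym (negbTE ij) mulr0.
Qed.

Lemma quadraticE (A : 'M[R]_d) (x : E) :
  quadratic A x = 2^-1 * \sum_k dotv (row k A^T) x * x 0 k.
Proof.
rewrite /quadratic mxE; congr (_ * _); apply: eq_bigr => k _.
rewrite !mxE; congr (_ * _); apply: eq_bigr => i _.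
by rewrite !mxE mulrC.
Qed.

Lemma smooth_quadratic (A : 'M[R]_d) : smooth (quadratic A).
Proof.
rewrite (_ : quadratic A = (fun x => 2^-1 * \sum_k dotv (row k A^T) x * x 0 k)).
  apply: (smoothM _ (fun=> 2^-1) _); first exact: smooth_cst.
  apply: (smooth_sum _ _ _ (fun k x => dotv (row k A^T) x * x 0 k)) => k.
  apply: (smoothM _ (dotv (row k A^T)) (fun x => x 0 k)); first exact: smooth_dotv.
  exact: smooth_coord.
by apply/funext => x; exact: quadraticE.
Qed.

Lemma derive_quadratic (A : 'M[R]_d) j (x : E) : A^T = A ->
  pd j (quadratic A) x = (x *m A) 0 j.
Proof.
move=> sA; have -> : quadratic A = (fun x => 2^-1 * \sum_k dotv (row k A^T) x * x 0 k).
  by apply/funext => y; exact: quadraticE.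
have sk k : smooth (fun x => dotv (row k A^T) x * x 0 k).
  apply: (smoothM _ (dotv (row k A^T)) (fun x => x 0 k)); first exact: smooth_dotv.
  exact: smooth_coord.
rewrite (derive_smoothZ _ _ (fun x => \sum_k dotv (row k A^T) x * x 0 k)); last first.
  exact: (smooth_sum _ _ _ (fun k x => dotv (row k A^T) x * x 0 k)).
rewrite (derive_smooth_sum d _ _ (fun k x => dotv (row k A^T) x * x 0 k))//.
rewrite (eq_bigr (fun k => (k == j)%:R * dotv (row k A^T) x + x 0 k * A j k)); last first.
  move=> k _; rewrite (derive_smoothM _ (dotv (row k A^T)) (fun x => x 0 k)).
  - by rewrite derive_coord derive_dotv !mxE eq_sym mulrC.
  - exact: smooth_dotv.
  - exact: smooth_coord.
rewrite big_split /= [X in X + _](bigD1 j)//= eqxx mul1r big1 ?addr0; last first.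
  by move=> i /negbTE ->; rewrite mul0r.
rewrite mxE.
have -> : dotv (row j A^T) x = \sum_i x 0 i * A i j.
  by apply: eq_bigr => i _; rewrite !mxE mulrC.
have -> : \sum_i x 0 i * A j i = \sum_i x 0 i * A i j.
  by apply: eq_bigr => i _; rewrite -{1}sA mxE.
by move: (\sum_i _) => s; field.
Qed.

Lemma quadraticB (A : 'M[R]_d) (x z : E) : A^T = A ->
  quadratic A (x - z) = quadratic A x - dotv (z *m A) x + quadratic A z.
Proof.
move=> sA; have -> : dotv (z *m A) x = (z *m A *m x^T) 0 0.
  by rewrite /dotv mxE; apply: eq_bigr => i _; rewrite [x^T _ _]mxE.
have zx : (x *m A *m z^T) 0 0 = (z *m A *m x^T) 0 0.
  have -> : z *m A *m x^T = (x *m A *m z^T)^T by rewrite !trmx_mul trmxK sA mulmxA.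
  by rewrite [RHS]mxE.
rewrite /quadratic linearB /= mulmxBr !mulmxBl.
have entry (P Q S T : 'M[R]_1) : (P - Q - (S - T)) 0 0 = P 0 0 - Q 0 0 - (S 0 0 - T 0 0).
  by rewrite !mxE.
rewrite entry zx; move: ((x *m A *m x^T) 0 0) ((z *m A *m x^T) 0 0) ((z *m A *m z^T) 0 0) => p q r.
by field.
Qed.

Lemma enorm_ge0 (x : E) : 0 <= enorm x. Proof. exact: sqrtr_ge0. Qed.

Lemma enorm_sqr (x : E) : enorm x ^+ 2 = \sum_i x 0 i ^+ 2.
Proof. by rewrite sqr_sqrtr// sumr_ge0// => i _; exact: sqr_ge0. Qed.

Lemma enormZ (l : R) (x : E) : enorm (l *: x) ^+ 2 = l ^+ 2 * enorm x ^+ 2.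
Proof.
by rewrite !enorm_sqr mulr_sumr; apply: eq_bigr => i _; rewrite mxE exprMn.
Qed.

Lemma japanese_sqr (x : E) : japanese x ^+ 2 = 1 + enorm x ^+ 2.
Proof. by rewrite sqr_sqrtr// addr_ge0// sqr_ge0. Qed.

Lemma japanese_ge1 (x : E) : 1 <= japanese x.
Proof. by rewrite -[1]sqrtr1 ler_wsqrtr// lerDl sqr_ge0. Qed.

Lemma smooth_japanese_sqr : smooth (fun x : E => japanese x ^+ 2).
Proof.
rewrite (_ : (fun x : E => japanese x ^+ 2) = (fun x : E => 1 + \sum_i x 0 i * x 0 i)).
  apply: (smoothD _ (fun=> 1)); first exact: smooth_cst.
  apply: (smooth_sum _ _ _ (fun i x => x 0 i * x 0 i)) => i.
  by apply: (smoothM _ (fun x => x 0 i) (fun x => x 0 i)); exact: smooth_coord.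
by apply/funext => x; rewrite japanese_sqr enorm_sqr.
Qed.

Lemma mderiv0 (f : E -> R) : mderiv (fun=> 0%N) f = f.
Proof.
rewrite /mderiv (_ : flatten _ = [::])//.
by elim: (enum 'I_d) => //= i s ->.
Qed.

Lemma mlength0 : mlength (fun _ : 'I_d => 0%N) = 0%N.
Proof. exact: big1. Qed.

Lemma mderiv1 (f : E -> R) j : mderiv (fun i => (i == j) : nat) f = pd j f.
Proof.
rewrite partialE /mderiv (_ : flatten _ = [:: j])//.
have -> : flatten [seq nseq (i == j) i | i <- enum 'I_d] = [seq i <- enum 'I_d | i == j].
  by elim: (enum 'I_d) => //= i s ->; case: (i == j).
by rewrite -[RHS](filter_pred1_uniq (enum_uniq 'I_d) (mem_enum 'I_d j)).
Qed.

Lemma mlength1 j : mlength (fun i : 'I_d => (i == j) : nat) = 1%N.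
Proof. by rewrite /mlength (bigD1 j)//= eqxx big1 // => i /negbTE ->. Qed.

Section bounds.
Context (V : E -> R) (A : 'M[R]_d).
Hypothesis hV : assumption_V V.
Hypothesis hVA : has_principal_symbol V (quadratic A).

Lemma potential_lower_bound : exists c1 c0 : R, [/\ 0 < c1, 0 <= c0 &
  forall x, c1 * japanese x ^+ 2 <= V x + c0].
Proof.
have [_ [c [r [c_gt0 r_gt0 Vr]]] /(_ (fun=> 0%N))[C C_gt0 VC]] := hV.
(* Inside the ball of radius r only |V| <= C <x>^2 is available, so the additive constant has to
   absorb both C <x>^2 and c^-1 <x>^2 there. *)
exists c^-1, ((C + c^-1) * (1 + r ^+ 2)); split.
- by rewrite invr_gt0.
- by rewrite mulr_ge0 ?addr_ge0 ?sqr_ge0 ?invr_ge0// ltW.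
move=> x; have [rx|xr] := leP r (enorm x).
  have /andP[h _] := Vr x rx; apply: le_trans h _.
  by rewrite lerDl mulr_ge0 ?addr_ge0 ?sqr_ge0 ?invr_ge0// ltW.
have := VC x; rewrite mderiv0 mlength0 subr0 -exprnP ler_norml => /andP[h _].
have xr2 : japanese x ^+ 2 <= 1 + r ^+ 2.
  by rewrite japanese_sqr lerD2l lerXn2r ?nnegrE ?enorm_ge0 ?ltW.
have cV : 0 < c^-1 by rewrite invr_gt0.
have h1 : C * japanese x ^+ 2 <= C * (1 + r ^+ 2) by rewrite ler_pM2l.
have h2 : c^-1 * japanese x ^+ 2 <= c^-1 * (1 + r ^+ 2) by rewrite ler_pM2l.
by rewrite mulrDl; lra.
Qed.

Lemma perturbation_bound : exists2 c : R, 0 < c &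
  forall x, (V x - quadratic A x) ^+ 2 <= c * japanese x ^+ 2.
Proof.
have [c c_gt0 /= cP] := hVA (fun=> 0%N).
exists (c ^+ 2); first by rewrite exprn_gt0.
move=> x; have := cP x; rewrite mderiv0 mlength0 subr0 expr1z => h.
rewrite -(real_normK (num_real _)) -exprMn lerXn2r ?nnegrE//.
by rewrite mulr_ge0 ?(ltW c_gt0)// (le_trans _ (japanese_ge1 x)).
Qed.

(** For derivatives of order one the weight of the symbol estimate has exponent 1 - 1 = 0: the
    perturbation exerts a bounded force. The sum over j makes the constant uniform in the
    direction. *)
Lemma perturbation_gradient_bound : exists2 c : R, 0 <= c &
  forall j x, `|pd j (fun x => V x - quadratic A x) x| <= c.
Proof.
have /choice[c cP] (j : 'I_d) : exists c : R, forall x,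
    `|pd j (fun x => V x - quadratic A x) x| <= c.
  have [c _ cP] := hVA (fun i => (i == j) : nat); exists c => x.
  by have := cP x; rewrite mderiv1 mlength1 subrr expr0z mulr1.
exists (\sum_j `|c j|); first by rewrite sumr_ge0.
move=> j x; apply: le_trans (cP j x) _; apply: le_trans (ler_norm _) _.
by rewrite (bigD1 j)//= lerDl sumr_ge0.
Qed.

(* The ellipticity of V at infinity passes to its homogeneous principal part. *)
Lemma quadratic_lower_bound : exists2 c : R, 0 < c &
  forall x, c * enorm x ^+ 2 <= quadratic A x.
Proof.
have [c1 [c0 [c1_gt0 c0_ge0 Vc]]] := potential_lower_bound.
have [c c_gt0 Wc] := perturbation_bound.
exists (c1 / 2); first by rewrite divr_gt0.
move=> x.
have qZ l : quadratic A (l *: x) = l ^+ 2 * quadratic A x.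
  rewrite /quadratic linearZ /= -scalemxAr -!scalemxAl !mxE; ring.
(* Along the ray of x, the defect of the inequality is multiplied by l^2 while the error stays
   bounded, so the defect cannot be positive. *)
have key (l : R) : l ^+ 2 * (c1 / 2 * enorm x ^+ 2 - quadratic A x) <= c0 + c / (2 * c1).
  have h1 := Vc (l *: x); have h2 := Wc (l *: x).
  rewrite qZ japanese_sqr enormZ in h1 h2.
  set w := V _ - _ in h2; have Vw : V (l *: x) = w + l ^+ 2 * quadratic A x by rewrite /w subrK.
  rewrite Vw in h1.
  (* Young's inequality, with weights such that the bound on w^2 turns the first term into half of
     the elliptic term [c1 * japanese (l *: x) ^+ 2]. *)
  have : w <= w ^+ 2 * (c1 / (2 * c)) + c / (2 * c1).
    have -> : w ^+ 2 * (c1 / (2 * c)) + c / (2 * c1) =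
       w + (c1 * w - c) ^+ 2 / (2 * c * c1) by field; rewrite !gt_eqF.
    by rewrite lerDl divr_ge0 ?sqr_ge0// ?mulr_ge0// ltW.
  have : w ^+ 2 * (c1 / (2 * c)) <= c1 / 2 * (1 + l ^+ 2 * enorm x ^+ 2).
    have -> : c1 / 2 * (1 + l ^+ 2 * enorm x ^+ 2) =
      (c * (1 + l ^+ 2 * enorm x ^+ 2)) * (c1 / (2 * c)) by field; rewrite gt_eqF.
    by rewrite ler_wpM2r// divr_ge0 ?mulr_ge0// ltW.
  lra.
rewrite leNgt; apply/negP => lt0; rewrite -subr_gt0 in lt0.
set D := _ - _ in lt0 key; set B := c0 + _ in key.
have B0 : 0 <= B by rewrite addr_ge0// divr_ge0 ?mulr_ge0// ltW.
have BD : 0 <= (B + 1) / D by apply: divr_ge0; [lra|exact: ltW].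
(* With this l the left side of [key] is B + 1 and the right side is B. *)
have := key (Num.sqrt ((B + 1) / D)); rewrite sqr_sqrtr//.
by rewrite -mulrA mulVf ?gt_eqF// mulr1; lra.
Qed.

End bounds.
End potential.

(** * Observables and their rates *)

Section observables.
Context {R : realType} (d : nat).
Local Notation E := 'rV[R]_d.
Local Notation pd i f := (partial i f).
Local Notation test := (@test R d).
Local Notation state := (@state R d).
Local Notation test_state := (@test_state R d).
Local Notation ipd := (@ip R d).
Local Notation nrm := (hnorm R state (@ip R d)).
Local Notation rintd := (@rint R d).

#[local] Opaque smooth bounded_support.

Definition multiplier (phi : E -> R) (u : state) : state :=
  (fun x => phi x * u.1 x, fun x => phi x * u.2 x).

(* -i times the derivative in the direction v *)
Definition momentum (v : E) (u : state) : state :=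
  (fun x => \sum_i v 0 i * pd i u.2 x, fun x => - \sum_i v 0 i * pd i u.1 x).

Context (V : E -> R) (sV : smooth V).

Definition energy (u : state) : state := (hamiltonian d V u.1, hamiltonian d V u.2).

(* -i P *)
Definition generator (u : state) : state :=
  (hamiltonian d V u.2, fun x => - hamiltonian d V u.1 x).

Lemma multiplier_test phi u : smooth phi -> test_state u -> test_state (multiplier phi u).
Proof.
move: u => [a b] sp [ta tb]; rewrite /= in ta tb.
by split; rewrite /=; prove_test.
Qed.

Lemma momentum_test v u : test_state u -> test_state (momentum v u).
Proof.
move: u => [a b] [ta tb]; rewrite /= in ta tb.
by split; rewrite /=; prove_test.
Qed.

Lemma energy_test u : test_state u -> test_state (energy u).
Proof. by move: u => [a b] [ta tb]; split; apply: hamiltonian_test. Qed.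

Lemma generator_test u : test_state u -> test_state (generator u).
Proof.
by move: u => [a b] [ta tb]; split; [|apply: testN]; apply: hamiltonian_test.
Qed.

Lemma multiplierB phi u w : multiplier phi (u - w) = multiplier phi u - multiplier phi w.
Proof. by congr pair; apply/funext => x; rewrite mulrBr. Qed.

Lemma hamiltonianB a b : test a -> test b ->
  hamiltonian d V (fun x => a x - b x) = (fun x => hamiltonian d V a x - hamiltonian d V b x).
Proof.
move=> ta tb; apply/funext => x; rewrite !hamiltonianE.
have sa := testT _ _ ta; have sb := testT _ _ tb.
rewrite (eq_bigr (fun i => pd i (pd i a) x - pd i (pd i b) x)); last first.
  move=> i _; rewrite (_ : pd i (fun x => a x - b x) = (fun x => pd i a x - pd i b x)).
    by apply: derive_smoothB; exact: smooth_partial.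
  by apply/funext => y; exact: derive_smoothB.
rewrite sumrB; move: (\sum_i _) (\sum_i _) => p q; ring.
Qed.

Lemma momentumB v u w : test_state u -> test_state w ->
  momentum v (u - w) = momentum v u - momentum v w.
Proof.
move: u w => [a b] [c e] [ta tb] [tc te].
have alg (f g : E -> R) x : test f -> test g ->
    \sum_i v 0 i * pd i (fun x => f x - g x) x =
    \sum_i v 0 i * pd i f x - \sum_i v 0 i * pd i g x.
  move=> tf tg; rewrite -sumrB; apply: eq_bigr => i _.
  by rewrite -mulrBr (derive_smoothB _ f g i x (testT _ _ tf) (testT _ _ tg)).
congr pair; apply/funext => x; first exact: (alg b e).
by rewrite -[RHS]/(_ - - _) -opprD /=; congr (- _); exact: (alg a c).
Qed.

Lemma energyB u w : test_state u -> test_state w -> energy (u - w) = energy u - energy w.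
Proof.
by move: u w => [a b] [c e] [ta tb] [tc te]; congr pair; exact: hamiltonianB.
Qed.

Lemma generatorB u w : test_state u -> test_state w ->
  generator (u - w) = generator u - generator w.
Proof.
move: u w => [a b] [c e] [ta tb] [tc te]; congr pair; first exact: hamiltonianB.
apply/funext => x; rewrite -[RHS]/(- _ - - _) -opprD /=; congr (- _).
by have := hamiltonianB _ _ ta tc => /(congr1 (@^~ x)).
Qed.

Lemma ip_pair (a b c e : E -> R) :
  ipd ((a, b) : state) ((c, e) : state) = rintd (fun x => a x * c x + b x * e x).
Proof. by []. Qed.

#[local] Opaque ip.

Lemma multiplier_sym phi u w : ipd (multiplier phi u) w = ipd u (multiplier phi w).
Proof.
move: u w => [a b] [c e]; rewrite !ip_pair.
by congr (rint d _); apply/funext => x; rewrite !mulrA ![phi x * _]mulrC.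
Qed.

Lemma momentum_sym v u w : test_state u -> test_state w ->
  ipd (momentum v u) w = ipd u (momentum v w).
Proof.
move: u w => [a b] [c e] [ta tb] [tc te]; rewrite !ip_pair.
exact: rint_momentum_sym.
Qed.

Lemma ip_energy u w : test_state u -> test_state w ->
  ipd u (energy w) = rintd (fun x =>
    V x * (u.1 x * w.1 x + u.2 x * w.2 x) +
    2^-1 * \sum_i (pd i u.1 x * pd i w.1 x + pd i u.2 x * pd i w.2 x)).
Proof.
move: u w => [a b] [c e] [ta tb] [tc te]; rewrite ip_pair /= in ta tb tc te *.
have tVc := hamiltonian_test _ _ _ sV tc; have tVe := hamiltonian_test _ _ _ sV te.
have sa := testT _ _ ta; have sb := testT _ _ tb.
have sc := testT _ _ tc; have se := testT _ _ te.
rewrite rintD; [|by apply: test_integrable; prove_test..].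
rewrite !rint_hamiltonian_form// -rintD; [|by apply: test_integrable; prove_test..].
congr (rint d _); apply/funext => x; rewrite big_split /=.
by move: (\sum_i _) (\sum_i _) => p q; ring.
Qed.

Lemma energy_sym u w : test_state u -> test_state w -> ipd (energy u) w = ipd u (energy w).
Proof.
move=> tu tw; rewrite ipC !ip_energy//; congr (rint d _); apply/funext => x.
congr (_ * _ + _ * _); first by rewrite [w.1 x * _]mulrC [w.2 x * _]mulrC.
by apply: eq_bigr => i _; rewrite [X in X + _]mulrC [X in _ + X]mulrC.
Qed.

Lemma rintN f : (lebesgue_rV d).-integrable setT (EFin \o f) ->
  rintd (fun x => - f x) = - rintd f.
Proof.
move=> fi; rewrite -mulN1r -rintZ//; congr (rint d _); apply/funext => x.
by rewrite mulN1r.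
Qed.

Lemma energy_rate u : test_state u -> 2 * ipd (generator u) (energy u) = 0.
Proof.
move: u => [a b] _; rewrite ip_pair (_ : (fun x => _) = (fun=> 0)).
  by rewrite rint0 mulr0.
by apply/funext => x; rewrite mulNr mulrC subrr.
Qed.

Lemma multiplier_rate phi u : smooth phi -> test_state u ->
  2 * ipd (generator u) (multiplier phi u) =
  rintd (fun x => \sum_i pd i phi x * (u.1 x * pd i u.2 x - u.2 x * pd i u.1 x)).
Proof.
move: u => [a b] sp [ta tb]; rewrite ip_pair /=.
rewrite -(rint_multiplier_rate _ V phi a b sV sp ta tb); congr (_ * rint d _).
by apply/funext => x; rewrite mulNr.
Qed.

(** Ehrenfest's law: the mean momentum along v changes by the mean of the force - v . grad V. *)
Lemma momentum_rate v u : test_state u ->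
  2 * ipd (generator u) (momentum v u) =
  - rintd (fun x => (\sum_i v 0 i * pd i V x) * (u.1 x ^+ 2 + u.2 x ^+ 2)).
Proof.
move: u => [a b] [ta tb]; rewrite ip_pair /=.
have tVa := hamiltonian_test _ _ _ sV ta; have tVb := hamiltonian_test _ _ _ sV tb.
have sa := testT _ _ ta; have sb := testT _ _ tb.
rewrite -mulN1r.
have tF f i : test f -> test (fun x => hamiltonian d V f x * pd i f x).
  by move=> tf; have tVf := hamiltonian_test _ _ _ sV tf; have sf := testT _ _ tf; prove_test.
have tG f i : test f -> test (fun x => pd i V x * f x ^+ 2).
  by move=> tf; have sf := testT _ _ tf; prove_test.
rewrite (_ : (fun x => _) = (fun x => \sum_i v 0 i *
    (hamiltonian d V a x * pd i a x + hamiltonian d V b x * pd i b x))); last first.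
  apply/funext => x; rewrite mulrNN !mulr_sumr -big_split /=; apply: eq_bigr => i _.
  have alg (p q r s t : R) : p * (q * r) + s * (q * t) = q * (s * t + p * r) by ring.
  exact: alg.
rewrite [in RHS](_ : (fun x => _) = (fun x => \sum_i v 0 i *
    (pd i V x * a x ^+ 2 + pd i V x * b x ^+ 2))); last first.
  apply/funext => x; rewrite mulr_suml; apply: eq_bigr => i _.
  by rewrite -mulrA -mulrDr.
have tFi i : test (fun x => hamiltonian d V a x * pd i a x + hamiltonian d V b x * pd i b x).
  by apply: testD; exact: tF.
have tGi i : test (fun x => pd i V x * a x ^+ 2 + pd i V x * b x ^+ 2).
  by apply: testD; exact: tG.
rewrite !rint_sum; [|by move=> i; apply: test_integrable; apply: testZ..].
rewrite !mulr_sumr; apply: eq_bigr => i _.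
rewrite !rintZ; [|by apply: test_integrable..].
rewrite mulrCA [RHS]mulrCA; congr (_ * _).
have iF f (tf : test f) := test_integrable _ _ (tF f i tf).
have iG f (tf : test f) := test_integrable _ _ (tG f i tf).
rewrite (rintD _ _ _ (iF a ta) (iF b tb)) (rintD _ _ _ (iG a ta) (iG b tb)).
have Ha := rint_hamiltonian_derive _ V a i sV ta.
have Hb := rint_hamiltonian_derive _ V b i sV tb.
by rewrite mulrDr Ha Hb mulN1r opprD (rintN _ (iG a ta)) (rintN _ (iG b tb)).
Qed.

(** The other Ehrenfest law, obtained from the multiplier rate because the gradient of [dotv d v] is
    the constant v. *)
Lemma position_rate v u : test_state u ->
  2 * ipd (generator u) (multiplier (dotv d v) u) = ipd u (momentum v u).
Proof.
move=> tu; rewrite multiplier_rate//; last exact: smooth_dotv.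
move: u tu => [a b] [ta tb]; rewrite ip_pair; congr (rint d _); apply/funext => x /=.
rewrite mulrN !mulr_sumr -sumrN -big_split; apply: eq_bigr => i _ /=.
by rewrite derive_dotv; move: (pd i a x) (pd i b x) => p q; ring.
Qed.

Lemma identity_rate u : test_state u -> 2 * ipd (generator u) u = 0.
Proof.
move=> tu; have := multiplier_rate (fun=> 1) u (smooth_cst _ _) tu.
have -> : multiplier (fun=> 1) u = u.
  by rewrite /multiplier; case: (u) => a b; congr pair; apply/funext => x; rewrite mul1r.
move=> ->; rewrite -[RHS](rint0 d); congr (rint d _); apply/funext => x.
by apply: big1 => i _; rewrite partialE derive_cst mul0r.
Qed.

(** * Bounds by the graph norm from the growth of the potential *)

Section graph_bounds.
Context (c1 c0 : R) (c1_gt0 : 0 < c1) (c0_ge0 : 0 <= c0).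
Hypothesis V_lower : forall x, c1 * japanese x ^+ 2 <= V x + c0.

Let density (u : state) x := u.1 x ^+ 2 + u.2 x ^+ 2.

Lemma ip_self (u : state) : ipd u u = rintd (density u).
Proof. by case: u => a b; rewrite ip_pair. Qed.

Lemma nrm_sqr u : nrm u ^+ 2 = rintd (density u).
Proof. by rewrite -ip_self; exact: (hnorm_sqr R state ipd (ip_ge0 d)). Qed.

Lemma nrm_le u (C n : R) : 0 <= C -> 0 <= n -> ipd u u <= C * n ^+ 2 ->
  nrm u <= Num.sqrt C * n.
Proof.
move=> C0 n0 h; apply: le_trans (ler_wsqrtr h) _.
by rewrite sqrtrM// sqrtr_sqr ger0_norm.
Qed.

(** The pairing of u with Pu is the sum of the kinetic and the potential energy, and V + c0
    dominates c1 <x>^2; by Cauchy-Schwarz this pairing is at most |u| |Pu|. So the graph norm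
    controls one power of position and one derivative, which is what makes position, momentum and V
    - V_A admissible observables. *)
Lemma form_bound u : test_state u ->
  c1 * rintd (fun x => japanese x ^+ 2 * density u x) +
  2^-1 * rintd (fun x => \sum_i (pd i u.1 x ^+ 2 + pd i u.2 x ^+ 2)) <=
  (1 + c0) * (nrm u + nrm (generator u)) ^+ 2.
Proof.
move=> tu; have tPu := energy_test _ tu; have tKu := generator_test _ tu.
have := hcauchy_schwarz R state (in_L2 d) ipd (in_L2D d) (in_L2Z d) (ipC d) (ipDl d)
  (ipZl d) (ip_ge0 d) u (energy u) (test_state_in_L2 _ _ tu) (test_state_in_L2 _ _ tPu).
have -> : nrm (energy u) = nrm (generator u).
  rewrite /hnorm; congr Num.sqrt; case: (u) => a b; rewrite !ip_pair.
  by congr (rint d _); apply/funext => x; rewrite /= mulrNN addrC.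
move=> /(le_trans (ler_norm _)); rewrite ip_energy//.
have nu := nrm_sqr u.
have n0 : 0 <= nrm u by exact: sqrtr_ge0.
have nK0 : 0 <= nrm (generator u) by exact: sqrtr_ge0.
move=> hle.
have tdens : test (density u).
  by case: (u) tu => a b [ta tb]; apply: testD; apply: (testX _ _ 1).
have tj : test (fun x => japanese x ^+ 2 * density u x).
  exact: testMl tdens (smooth_japanese_sqr d).
have tg : test (fun x => \sum_i (pd i u.1 x ^+ 2 + pd i u.2 x ^+ 2)).
  by case: (u) tu => a b [ta tb]; rewrite /= in ta tb *; prove_test.
have tE : test (fun x => V x * (u.1 x * u.1 x + u.2 x * u.2 x) +
    2^-1 * \sum_i (pd i u.1 x * pd i u.1 x + pd i u.2 x * pd i u.2 x)).
  apply: testD; first by apply: testMl.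
  by apply: testZ; exact: tg.
have L : c1 * rintd (fun x => japanese x ^+ 2 * density u x) +
    2^-1 * rintd (fun x => \sum_i (pd i u.1 x ^+ 2 + pd i u.2 x ^+ 2)) <=
    rintd (fun x => V x * (u.1 x * u.1 x + u.2 x * u.2 x) +
      2^-1 * \sum_i (pd i u.1 x * pd i u.1 x + pd i u.2 x * pd i u.2 x)) +
    c0 * rintd (density u).
  rewrite -!rintZ ?(test_integrable)// -!rintD; try by apply: test_integrable; do ?apply: testZ.
  apply: le_rint.
  - by apply: test_integrable; apply: testD; apply: testZ.
  - by apply: test_integrable; apply: testD => //; apply: testZ.
  move=> x; rewrite [leRHS]addrAC lerD2r.
  have := V_lower x; have : 0 <= density u x by rewrite addr_ge0 ?sqr_ge0.
  rewrite -!expr2 -/(density u x) => h1 h2.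
  by rewrite mulrA -mulrDl ler_wpM2r.
apply: le_trans L _; rewrite -nu.
have alg (e p q : R) : 0 <= p -> 0 <= q -> e <= p * q -> e + c0 * p ^+ 2 <= (1 + c0) * (p + q) ^+ 2.
  move=> p0 q0 epq; have pq0 : 0 <= p * q by exact: mulr_ge0.
  have c0q : 0 <= c0 * (2 * (p * q) + q ^+ 2).
    by rewrite mulr_ge0// addr_ge0 ?sqr_ge0// mulr_ge0.
  have -> : (1 + c0) * (p + q) ^+ 2 = p ^+ 2 + q ^+ 2 + 2 * (p * q) + c0 * p ^+ 2 +
    c0 * (2 * (p * q) + q ^+ 2) by ring.
  by have := sqr_ge0 p; have := sqr_ge0 q; lra.
exact: alg.
Qed.

(** A multiplier of at most linear growth is absorbed by the weighted mass in [form_bound]. *)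
Lemma multiplier_bound phi c : smooth phi -> 0 <= c ->
  (forall x, phi x ^+ 2 <= c * japanese x ^+ 2) ->
  exists2 C : R, 0 <= C & forall u, test_state u ->
    nrm (multiplier phi u) <= C * (nrm u + nrm (generator u)).
Proof.
move=> sp c_ge0 pc; exists (Num.sqrt (c * (1 + c0) / c1)); first exact: sqrtr_ge0.
move=> u tu; have tm := multiplier_test phi u sp tu.
have n0 : 0 <= nrm u + nrm (generator u) by rewrite addr_ge0 ?sqrtr_ge0.
have C0 : 0 <= c * (1 + c0) / c1 by rewrite divr_ge0 ?mulr_ge0 ?addr_ge0// ltW.
apply: nrm_le => //; rewrite ip_self.
have tdens : test (density u).
  by case: (u) tu => a b [ta tb]; apply: testD; apply: (testX _ _ 1).
have tdm : test (density (multiplier phi u)).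
  by case: (multiplier phi u) tm => a b [ta tb]; apply: testD; apply: (testX _ _ 1).
have tj : test (fun x => japanese x ^+ 2 * density u x).
  exact: testMl tdens (smooth_japanese_sqr d).
have h1 : rintd (density (multiplier phi u)) <=
    c * rintd (fun x => japanese x ^+ 2 * density u x).
  rewrite -rintZ; last exact: test_integrable.
  apply: le_rint; [exact: test_integrable|by apply: test_integrable; apply: testZ|].
  move=> x; rewrite /density /= !exprMn -mulrDr mulrA ler_wpM2r//.
  by rewrite addr_ge0 ?sqr_ge0.
apply: le_trans h1 _; rewrite -[leRHS]mulrA -[leRHS]mulrA ler_wpM2l//.
rewrite mulrCA ler_pdivlMl//.
apply: le_trans (form_bound u tu); rewrite lerDl mulr_ge0// rint_ge0// => x.
by rewrite sumr_ge0// => i _; rewrite addr_ge0 ?sqr_ge0.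
Qed.

Lemma sum_cauchy_schwarz (p q : 'I_d -> R) :
  (\sum_i p i * q i) ^+ 2 <= (\sum_i p i ^+ 2) * (\sum_i q i ^+ 2).
Proof.
set P := \sum_i p i ^+ 2; set Q := \sum_i q i ^+ 2; set T := \sum_i p i * q i.
have P0 : 0 <= P by rewrite sumr_ge0// => i _; exact: sqr_ge0.
(* Multiplying by P turns the difference into a sum of squares with no division, as P may vanish. *)
have key : 0 <= P * (P * Q - T ^+ 2).
  have -> : P * (P * Q - T ^+ 2) = \sum_i (P * q i - T * p i) ^+ 2.
    rewrite (eq_bigr (fun i => P ^+ 2 * q i ^+ 2 + (- (2 * P * T)) * (p i * q i) +
        T ^+ 2 * p i ^+ 2)); last by move=> i _; ring.
    by rewrite !big_split /= -!mulr_sumr -/P -/Q -/T; ring.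
  by rewrite sumr_ge0// => i _; exact: sqr_ge0.
move: P0; rewrite le_eqVlt => /orP[/eqP P0|P0]; last first.
  by rewrite -subr_ge0 -(pmulr_rge0 _ P0).
have p0 i : p i = 0.
  have /eqP := P0; rewrite eq_sym psumr_eq0 => [/allP/(_ i)|j _]; last exact: sqr_ge0.
  by rewrite mem_index_enum => /(_ isT); rewrite sqrf_eq0 => /eqP.
rewrite -P0 mul0r (_ : T = 0) ?expr0n//.
by rewrite /T big1// => i _; rewrite p0 mul0r.
Qed.

Lemma momentum_bound v : exists2 C : R, 0 <= C & forall u, test_state u ->
  nrm (momentum v u) <= C * (nrm u + nrm (generator u)).
Proof.
set s := \sum_i v 0 i ^+ 2.
have s0 : 0 <= s by rewrite sumr_ge0// => i _; exact: sqr_ge0.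
(* The factor 2 undoes the 1/2 of the kinetic energy, and s comes from Cauchy-Schwarz in the
   components of v. *)
exists (Num.sqrt (s * 2 * (1 + c0))); first exact: sqrtr_ge0.
move=> u tu; have tm := momentum_test v u tu.
have n0 : 0 <= nrm u + nrm (generator u) by rewrite addr_ge0 ?sqrtr_ge0.
have C0 : 0 <= s * 2 * (1 + c0) by rewrite !mulr_ge0 ?addr_ge0.
apply: nrm_le => //; rewrite ip_self.
have tdm : test (density (momentum v u)).
  by case: (momentum v u) tm => a b [ta tb]; apply: testD; apply: (testX _ _ 1).
have tg : test (fun x => \sum_i (pd i u.1 x ^+ 2 + pd i u.2 x ^+ 2)).
  by case: (u) tu => a b [ta tb]; rewrite /= in ta tb *; prove_test.
have h1 : rintd (density (momentum v u)) <=
    s * rintd (fun x => \sum_i (pd i u.1 x ^+ 2 + pd i u.2 x ^+ 2)).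
  rewrite -rintZ; last exact: test_integrable.
  apply: le_rint; [exact: test_integrable|by apply: test_integrable; apply: testZ|].
  move=> x; rewrite /density /= sqrrN big_split mulrDr addrC.
  by apply: lerD; exact: (sum_cauchy_schwarz (fun i => v 0 i)).
apply: le_trans h1 _; rewrite -[leRHS]mulrA -[leRHS]mulrA ler_wpM2l//.
rewrite -ler_pdivrMl//.
apply: le_trans (form_bound u tu); rewrite lerDr mulr_ge0 ?(ltW c1_gt0)// rint_ge0// => x.
by rewrite mulr_ge0 ?sqr_ge0// addr_ge0 ?sqr_ge0.
Qed.

Lemma energy_bound u : test_state u -> nrm (energy u) <= 1 * (nrm u + nrm (generator u)).
Proof.
move=> tu; rewrite mul1r.
have -> : nrm (energy u) = nrm (generator u).
  rewrite /hnorm; congr Num.sqrt; case: (u) => a b; rewrite !ip_pair.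
  by congr (rint d _); apply/funext => x; rewrite /= mulrNN addrC.
by rewrite lerDr sqrtr_ge0.
Qed.

End graph_bounds.

End observables.

(** * Spread around a phase space point *)

Lemma smooth_dist_sqr {R : realType} (d : nat) (z : 'rV[R]_d) :
  smooth (fun x : 'rV[R]_d => enorm (x - z) ^+ 2).
Proof.
rewrite (_ : (fun x : 'rV[R]_d => enorm (x - z) ^+ 2) = (fun x => \sum_i (x 0 i - z 0 i) ^+ 2)).
  apply: (smooth_sum _ _ _ (fun i (x : 'rV[R]_d) => (x 0 i - z 0 i) ^+ 2)) => i.
  rewrite (_ : (fun x : 'rV[R]_d => (x 0 i - z 0 i) ^+ 2) =
      (fun x : 'rV[R]_d => (x 0 i - z 0 i) * (x 0 i - z 0 i))).
    have sc : smooth (fun x : 'rV[R]_d => x 0 i - z 0 i).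
      exact: (smoothB d (fun x => x 0 i) (cst (z 0 i)) (smooth_coord d i) (smooth_cst d _)).
    exact: (smoothM d _ _ sc sc).
  by apply/funext => x; rewrite expr2.
by apply/funext => x; rewrite enorm_sqr; apply: eq_bigr => i _; rewrite !mxE.
Qed.

Lemma moment_test {R : realType} (d : nat) (z : 'rV[R]_d) (u : state d) : test_state d u ->
  test d (fun x => enorm (x - z) ^+ 2 * (u.1 x ^+ 2 + u.2 x ^+ 2)).
Proof.
move: u => [a b] [ta tb]; rewrite /= in ta tb *.
exact: (testMl _ _ _ (testD _ _ _ (testX _ _ 1 ta) (testX _ _ 1 tb)) (smooth_dist_sqr d z)).
Qed.

Section spread.
Context {R : realType} (d : nat).
Local Notation E := 'rV[R]_d.
Local Notation pd i f := (partial i f).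
Local Notation test := (@test R d).
Local Notation state := (@state R d).
Local Notation test_state := (@test_state R d).
Local Notation ipd := (@ip R d).
Local Notation rintd := (@rint R d).
Local Notation multiplier := (@multiplier R d).
Local Notation momentum := (@momentum R d).

#[local] Opaque smooth bounded_support ip.

Context (V : E -> R) (sV : smooth V) (A : 'M[R]_d) (sA : A^T = A).
Local Notation W := (fun x => V x - quadratic A x).

(** The squares are the real and imaginary parts of (-i grad + rho v) u, for u = u.1 + i u.2. *)
Definition spread_density (rho : R) (v z : E) (u : state) (x : E) : R :=
  2^-1 * \sum_j ((pd j u.2 x + rho * v 0 j * u.1 x) ^+ 2 +
                 (pd j u.1 x - rho * v 0 j * u.2 x) ^+ 2) +
  quadratic A (x - z) * (u.1 x ^+ 2 + u.2 x ^+ 2).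

(* Energy of u relative to the phase space point (z, - rho v) *)
Definition spread rho v z u : R := rintd (spread_density rho v z u).

Lemma smooth_W : smooth W.
Proof. exact: (smoothB _ V (quadratic A) sV (smooth_quadratic d A)). Qed.

Lemma smooth_quadratic_shift z : smooth (fun x => quadratic A (x - z)).
Proof.
rewrite (_ : (fun x => _) = (fun x => quadratic A x - dotv d (z *m A) x + quadratic A z)).
  apply: (smoothD _ (fun x => quadratic A x - dotv d (z *m A) x)); last exact: smooth_cst.
  by apply: smoothB; [exact: smooth_quadratic|exact: smooth_dotv].
by apply/funext => x; exact: quadraticB.
Qed.

Lemma spread_density_test rho v z u : test_state u -> test (spread_density rho v z u).
Proof.
move: u => [a b] [ta tb]; rewrite /spread_density /= in ta tb *.
have sa := testT _ _ ta; have sb := testT _ _ tb.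
have sq := smooth_quadratic_shift z.
apply: testD; last first.
  exact: (testMl _ _ _ (testD _ _ _ (testX _ _ 1 ta) (testX _ _ 1 tb)) sq).
apply: testZ; apply: (test_sum _ _ _ (fun j x => (pd j b x + rho * v 0 j * a x) ^+ 2 +
   (pd j a x - rho * v 0 j * b x) ^+ 2)) => j.
apply: testD; apply: (testX _ _ 1).
  by apply: testD; [exact: test_derive|exact: testZ].
by apply: testB; [exact: test_derive|exact: testZ].
Qed.

(** Writes the spread through means of graph-bounded observables, which have time derivatives along
    the evolution. The kinetic term comes from the energy, and V_A is recovered as V - W. *)
Lemma spreadE rho v z u : test_state u ->
  spread rho v z u = ipd u (energy d V u) - ipd u (multiplier W u)
    + rho * ipd u (momentum v u) - ipd u (multiplier (dotv d (z *m A)) u)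
    + (2^-1 * rho ^+ 2 * (\sum_j v 0 j ^+ 2) + quadratic A z) * ipd u u.
Proof.
move=> tu; rewrite (ip_energy d V sV u u)//; move: u tu => [a b] [ta tb].
rewrite !ip_pair /= in ta tb *.
have sa := testT _ _ ta; have sb := testT _ _ tb.
have sq := smooth_quadratic d A; have sd := smooth_dotv d (z *m A).
have i1 : test (fun x => V x * (a x * a x + b x * b x) +
   2^-1 * \sum_i (pd i a x * pd i a x + pd i b x * pd i b x)) by prove_test.
have i2 : test (fun x => a x * ((V x - quadratic A x) * a x) +
    b x * ((V x - quadratic A x) * b x)) by prove_test.
have i3 : test (fun x => a x * (\sum_i v 0 i * pd i b x) +
    b x * (- \sum_i v 0 i * pd i a x)) by prove_test.
have i4 : test (fun x => a x * (dotv d (z *m A) x * a x) +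
    b x * (dotv d (z *m A) x * b x)) by prove_test.
have i5 : test (fun x => a x * a x + b x * b x) by prove_test.
set c := _ + quadratic A z.
rewrite -(rintZ _ rho _ (test_integrable _ _ i3)) -(rintZ _ c _ (test_integrable _ _ i5)).
rewrite -(rintN _ _ (test_integrable _ _ i2)) -(rintN _ _ (test_integrable _ _ i4)).
have i3' := testZ _ rho _ i3; have i5' := testZ _ c _ i5.
have i2' := testN _ _ i2; have i4' := testN _ _ i4.
rewrite -(rintD _ _ _ (test_integrable _ _ i1) (test_integrable _ _ i2')).
have j1 := testD _ _ _ i1 i2'.
rewrite -(rintD _ _ _ (test_integrable _ _ j1) (test_integrable _ _ i3')).
have j2 := testD _ _ _ j1 i3'.
rewrite -(rintD _ _ _ (test_integrable _ _ j2) (test_integrable _ _ i4')).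
have j3 := testD _ _ _ j2 i4'.
rewrite -(rintD _ _ _ (test_integrable _ _ j3) (test_integrable _ _ i5')).
rewrite /spread; congr (rint d _); apply/funext => x; rewrite /spread_density /=.
rewrite quadraticB//.
have -> : \sum_j ((pd j b x + rho * v 0 j * a x) ^+ 2 + (pd j a x - rho * v 0 j * b x) ^+ 2) =
   \sum_i (pd i a x * pd i a x + pd i b x * pd i b x) +
   2 * rho * (a x * (\sum_i v 0 i * pd i b x) - b x * (\sum_i v 0 i * pd i a x)) +
   rho ^+ 2 * (a x ^+ 2 + b x ^+ 2) * \sum_j v 0 j ^+ 2.
  rewrite !mulr_sumr -sumrB !mulr_sumr -!big_split /=; apply: eq_bigr => j _.
  by move: (pd j a x) (pd j b x) => p q; ring.
rewrite /c; move: (\sum_i _) (\sum_i _) (\sum_i _) (\sum_i _) => s1 s2 s3 s4.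
by move: (quadratic A x) (quadratic A z) (dotv _ _ _) => q1 q2 q3; field.
Qed.

Section rate.
Context (kappa : R) (kappa_ge0 : 0 <= kappa).
Hypothesis W_bound : forall j x, `|pd j W x| <= kappa.
Hypothesis quadratic_ge0 : forall x, 0 <= quadratic A x.
Context (v : E) (lam : R) (vA : v *m A = lam *: v).

(** The eigenvector enters here: v . grad V_A is lam times the position along v, which is again one
    of the observables in the spread. *)
Lemma sum_partial_V x : \sum_i v 0 i * pd i V x =
  (\sum_i v 0 i * pd i W x) + lam * dotv d v x.
Proof.
have sW := smooth_W; have sq := smooth_quadratic d A.
have pV i : pd i V x = pd i W x + (x *m A) 0 i.
  rewrite -derive_quadratic// -(derive_smoothD _ W (quadratic A))//.
  by congr (partial _ _ _); apply/funext => y; rewrite subrK.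
under eq_bigr do rewrite pV mulrDr; rewrite big_split /=; congr (_ + _).
have -> : \sum_i v 0 i * (x *m A) 0 i = (v *m (x *m A)^T) 0 0.
  by rewrite mxE; apply: eq_bigr => i _; rewrite [(_^T)%R _ _]mxE.
rewrite trmx_mul sA mulmxA vA -scalemxAl mxE; congr (_ * _).
by rewrite mxE; apply: eq_bigr => i _; rewrite [(_^T)%R _ _]mxE.
Qed.

(* The two sums over v^T grad V_A cancel, leaving the bounded gradient of W. *)
Lemma spread_rate rho z u : test_state u ->
  `| - (2 * ipd (generator d V u) (multiplier W u)) +
     rho * (2 * ipd (generator d V u) (momentum v u) + lam * ipd u (multiplier (dotv d v) u)) |
  <= kappa * (d%:R / 2 * ipd u u + spread rho v z u).
Proof.
move=> tu; have sW := smooth_W.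
rewrite (multiplier_rate d V sV _ u sW tu) (momentum_rate d V sV v u tu).
have td := spread_density_test rho v z u tu.
move: u tu td => [a b] [ta tb] td; rewrite !ip_pair /= in ta tb td *.
have sa := testT _ _ ta; have sb := testT _ _ tb; have sd := smooth_dotv d v.
have i1 : test (fun x => \sum_i pd i W x * (a x * pd i b x - b x * pd i a x)).
  apply: (test_sum _ _ _ (fun i x => pd i W x * (a x * pd i b x - b x * pd i a x))) => i.
  by apply: testMl; [prove_test|exact: smooth_partial].
have i2 : test (fun x => (\sum_i v 0 i * pd i V x) * (a x ^+ 2 + b x ^+ 2)).
  apply: testMl; first by prove_test.
  apply: (smooth_sum _ _ _ (fun i x => v 0 i * pd i V x)) => i; prove_smooth.
have i3 : test (fun x => a x * (dotv d v x * a x) + b x * (dotv d v x * b x)) by prove_test.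
have i5 : test (fun x => a x * a x + b x * b x) by prove_test.
(* The remaining rate is minus the mean of grad W against the current measured in the moving frame:
   shifting the derivatives by rho v adds exactly the term rho (a^2 + b^2) v . grad W left over from
   the momentum rate. *)
pose f x := - \sum_i pd i W x * (a x * (pd i b x + rho * v 0 i * a x) -
                              b x * (pd i a x - rho * v 0 i * b x)).
have -> : - rintd (fun x => \sum_i pd i W x * (a x * pd i b x - b x * pd i a x)) +
    rho * (- rintd (fun x => (\sum_i v 0 i * pd i V x) * (a x ^+ 2 + b x ^+ 2)) +
    lam * rintd (fun x => a x * (dotv d v x * a x) + b x * (dotv d v x * b x))) = rintd f.
  have i1' := testN _ _ i1; have i2' := testN _ _ i2; have i3' := testZ _ lam _ i3.
  have j := testD _ _ _ i2' i3'; have j' := testZ _ rho _ j.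
  rewrite -(rintN _ _ (test_integrable _ _ i1)) -(rintN _ _ (test_integrable _ _ i2)).
  rewrite -(rintZ _ lam _ (test_integrable _ _ i3)).
  rewrite -(rintD _ _ _ (test_integrable _ _ i2') (test_integrable _ _ i3')).
  rewrite -(rintZ _ rho _ (test_integrable _ _ j)).
  rewrite -(rintD _ _ _ (test_integrable _ _ i1') (test_integrable _ _ j')).
  congr (rint d _); apply/funext => x; rewrite /f sum_partial_V.
  have -> : \sum_i pd i W x * (a x * (pd i b x + rho * v 0 i * a x) -
                              b x * (pd i a x - rho * v 0 i * b x)) =
    \sum_i pd i W x * (a x * pd i b x - b x * pd i a x) +
    rho * (a x ^+ 2 + b x ^+ 2) * \sum_i v 0 i * pd i W x.
    rewrite mulr_sumr -big_split /=; apply: eq_bigr => i _.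
    by move: (pd i a x) (pd i b x) (pd i W x) => p q r; ring.
  by move: (\sum_i _) (\sum_i _) (dotv _ _ _) => s1 s2 s3; ring.
have tf : test f.
  apply: testN; apply: (test_sum _ _ _ (fun i x => pd i W x *
    (a x * (pd i b x + rho * v 0 i * a x) - b x * (pd i a x - rho * v 0 i * b x)))) => i.
  by apply: testMl; [prove_test|exact: smooth_partial].
pose g x := kappa * (d%:R / 2 * (a x * a x + b x * b x) + spread_density rho v z (a, b) x).
have tg : test g := testZ _ kappa _ (testD _ _ _ (testZ _ (d%:R / 2) _ i5) td).
have fg x : `|f x| <= g x.
  rewrite /f normrN; apply: le_trans (ler_norm_sum _ _ _) _.
  (* Half the mass density for each of the d coordinates gives the factor d/2; the shifted squares
     add up to the kinetic part of the spread, whose potential part is nonnegative. *)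
  apply: (@le_trans _ _ (\sum_(i < d) kappa * (2^-1 * (a x * a x + b x * b x) + 2^-1 *
    ((pd i b x + rho * v 0 i * a x) ^+ 2 + (pd i a x - rho * v 0 i * b x) ^+ 2)))).
    apply: ler_sum => i _; rewrite normrM; apply: ler_pM => //.
    have alg (p q r s : R) : `|p * r - q * s| <= 2^-1 * (p * p + q * q) + 2^-1 * (r ^+ 2 + s ^+ 2).
      have := sqr_ge0 (p - r); have := sqr_ge0 (p + r).
      have := sqr_ge0 (q - s); have := sqr_ge0 (q + s) => *.
      by rewrite ler_norml; apply/andP; split; lra.
    exact: alg.
  rewrite -mulr_sumr ler_wpM2l// big_split /= sumr_const card_ord -mulr_sumr.
  rewrite /spread_density /= addrA -[X in X <= _]addr0; apply: lerD; last first.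
    by rewrite mulr_ge0// addr_ge0 ?sqr_ge0.
  by rewrite -[X in X + _ <= _]mulr_natl mulrA.
have -> : kappa * (d%:R / 2 * rintd (fun x => a x * a x + b x * b x) + spread rho v z (a, b)) =
    rintd g.
  rewrite /spread -(rintZ _ _ _ (test_integrable _ _ i5)).
  have i5' := testZ _ (d%:R / 2) _ i5.
  rewrite -(rintD _ _ _ (test_integrable _ _ i5') (test_integrable _ _ td)).
  by rewrite -(rintZ _ kappa _ (test_integrable _ _ (testD _ _ _ i5' td))).
have If := test_integrable _ _ tf; have Ig := test_integrable _ _ tg.
rewrite ler_norml; apply/andP; split.
  rewrite -(rintN _ _ Ig); apply: le_rint => //.
    exact: test_integrable (testN _ _ tg).
  by move=> x; have := fg x; rewrite ler_norml => /andP[].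
by apply: le_rint => // x; exact: le_trans (ler_norm _) (fg x).
Qed.

End rate.

Lemma spread_ge0 rho v z u : (forall x, 0 <= quadratic A x) -> 0 <= spread rho v z u.
Proof.
move=> A0; apply: rint_ge0 => x; apply: addr_ge0.
  by rewrite mulr_ge0// sumr_ge0// => j _; rewrite addr_ge0 ?sqr_ge0.
by rewrite mulr_ge0// addr_ge0 ?sqr_ge0.
Qed.

(** The kinetic part of the spread is nonnegative and is dropped; the ellipticity of V_A bounds the
    potential part from below by the second moment around z. *)
Lemma spread_moment rho v (z : E) u (c : R) : 0 < c -> test_state u ->
  (forall x, c * enorm x ^+ 2 <= quadratic A x) ->
  c * rintd (fun x => enorm (x - z) ^+ 2 * (u.1 x ^+ 2 + u.2 x ^+ 2)) <= spread rho v z u.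
Proof.
move=> c0 tu Ac; have td := spread_density_test rho v z u tu.
have tm := moment_test d z u tu.
rewrite -(rintZ _ _ _ (test_integrable _ _ tm)).
apply: le_rint; [exact: test_integrable (testZ _ _ _ tm)|exact: test_integrable|].
move=> x; rewrite /spread_density mulrA -[X in X <= _]add0r; apply: lerD.
  by rewrite mulr_ge0// sumr_ge0// => j _; rewrite addr_ge0 ?sqr_ge0.
by rewrite ler_wpM2r// addr_ge0 ?sqr_ge0.
Qed.

End spread.

(** * Translated bumps as initial states *)

Lemma continuous_translate {R : realType} (W : normedModType R) (c : W) :
  continuous (fun y : W => y + c).
Proof. by move=> x; apply: cvgD; [exact: cvg_id|exact: cvg_cst]. Qed.

Section translation.
Context {R : realType} (d : nat).
Local Notation E := 'rV[R]_d.
Local Notation test := (@test R d).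
Local Notation state := (@state R d).
Local Notation test_state := (@test_state R d).

#[local] Opaque smooth bounded_support.

Lemma partial_shift (f : E -> R) c i x : smooth f ->
  partial i (fun y => f (y + c)) x = partial i f (x + c).
Proof.
move=> sf; rewrite !partialE.
have [_ ->] := @derivable_translate R E f c x (delta_mx 0 i) _
  (derivableP (smooth_derivable d f i (x + c) sf)).
by [].
Qed.

(** By coinduction, the translates by c of smooth functions being a class stable under partial
    derivatives. *)
Lemma smooth_shift (f : E -> R) c : smooth f -> smooth (fun y => f (y + c)).
Proof.
move=> sf; pose S g := exists2 h : E -> R, smooth h & g = fun y => h (y + c).
apply: (smooth_coind d S); last by exists f.
move=> _ [h sh ->]; split.
- move=> x; apply: (@continuous_comp _ _ _ (fun y : E => y + c) h).
    exact: (@continuous_translate R E c x).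
  exact: smooth_continuous.
- move=> i x; have [] := @derivable_translate R E h c x (delta_mx 0 i) _
    (derivableP (smooth_derivable d h i (x + c) sh)); by [].
- move=> i; exists (partial i h); first exact: smooth_partial.
  by apply/funext => x; rewrite -partial_shift// partialE.
Qed.

Lemma test_shift (f : E -> R) c : test f -> test (fun y => f (y + c)).
Proof.
move=> [sf [M fM]]; split; first exact: smooth_shift.
exists (M + `|c|) => x Mx; apply: fM.
have := ler_normB (x + c) c; rewrite addrK => xc.
by have := lt_le_trans Mx xc; rewrite ltrD2r.
Qed.

Lemma rint_shift (f : E -> R) c : test f -> rint d (fun y => f (y + c)) = rint d f.
Proof.
move=> tf; rewrite !rintE /Rintegral.
by rewrite -(integral_shift_rV d c _ (test_integrable d f tf)).
Qed.

Definition translate (z : E) (u : state) : state :=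
  ((fun x => u.1 (x - z)), (fun x => u.2 (x - z))).

Lemma translate_test z u : test_state u -> test_state (translate z u).
Proof. by move=> [t1 t2]; split; exact: test_shift. Qed.

Lemma ip_translate z u : test_state u -> ip d (translate z u) (translate z u) = ip d u u.
Proof.
move=> [t1 t2]; rewrite /ip /=.
apply: (rint_shift (fun x => u.1 x * u.1 x + u.2 x * u.2 x)).
apply: testD; apply: testMr => //; first by case: t1. by case: t2.
Qed.

(** Source of the uniformity in r: relative to its own centre, the translated bump has the same
    spread as the bump at the origin. *)
Lemma spread_translate (A : 'M[R]_d) (rho : R) v z u : A^T = A -> test_state u ->
  spread d A rho v z (translate z u) = spread d A rho v 0 u.
Proof.
move=> sA tu; have [[s1 _] [s2 _]] := tu.
rewrite /spread -(rint_shift (spread_density d A rho v 0 u) (- z)); last exact: spread_density_test.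
congr (rint d _); apply/funext => x; rewrite /spread_density /= subr0; congr (_ * _ + _).
by apply: eq_bigr => j _; rewrite !partial_shift.
Qed.

(** A product of exp(-1/t) bumps, positive in the open unit cube and zero elsewhere. The
    coefficients [1 *] and [- 1 *] fit the shape of [FlatAlg]. *)
Definition cutoff (x : E) : R := \prod_i (flat 0 (1 * x 0 i + 1) * flat 0 (- 1 * x 0 i + 1)).

Lemma cutoff_test : test cutoff.
Proof.
split.
  apply: (smooth_prod d _ _ (fun i x => flat 0 (1 * x 0 i + 1) * flat 0 (- 1 * x 0 i + 1))) => i.
  exact: (smooth_alg_smooth d _ (MulAlg d _ _ (FlatAlg d 0 i 1 1) (FlatAlg d 0 i (- 1) 1))).
exists 1 => x x1; have [i xi] : exists i, 1 < `|x 0 i|.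
  apply: contrapT => /forallNP h; move: x1; rewrite ltNge => /negP; apply.
  by apply: rV_norm_le => // i; rewrite leNgt; apply/negP; exact: h.
rewrite /cutoff (bigD1 i)//= /flat !expr0 !invr1.
have [x0|x0] := leP 0 (x 0 i).
  rewrite ger0_norm// in xi.
  rewrite [in X in _ * X * _ = _]ifF ?mulr0 ?mul0r//.
  by apply/negbTE; rewrite -leNgt; lra.
rewrite ltr0_norm// in xi.
rewrite ifF ?mul0r//.
by apply/negbTE; rewrite -leNgt; lra.
Qed.

Lemma cutoff_state : test_state (cutoff, fun=> 0).
Proof. by split; [exact: cutoff_test|exact: test0]. Qed.

(** On this cube each 1 + x_i and 1 - x_i is at least 1/2, where exp(-1/t) is at least exp(-2). *)
Lemma cutoff_lower_bound x : cube d (1 / 2) x -> expR (- 2) ^+ 2 ^+ d <= cutoff x.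
Proof.
move=> xB; rewrite -[X in _ ^+ X](card_ord d) -prodr_const; apply: ler_prod => i _.
have := xB i; rewrite /= in_itv /= => /andP[x1 x2].
rewrite sqr_ge0 /= expr2.
have h (t : R) : 1 / 2 <= t -> expR (- 2) <= flat 0 t.
  move=> t2; rewrite /flat (_ : 0 < t); last by lra.
  rewrite expr0 invr1 mul1r ler_expR lerN2 -[leRHS]invrK lef_pV2 ?posrE; lra.
by apply: ler_pM; rewrite ?expR_ge0//; apply: h; lra.
Qed.

(** The cube of half-side 1/2 has measure 1, so the lower bound on it gives positive mass. This mass
    is what observability would have to recover for every r. *)
Lemma cutoff_ip_gt0 : 0 < ip d (cutoff, fun=> 0) (cutoff, fun=> 0).
Proof.
pose m : R := expR (- 2) ^+ 2 ^+ d.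
have m0 : 0 < m by rewrite !exprn_gt0// expR_gt0.
pose B : set E := cube d (1 / 2); have mB : measurable B by exact: measurable_cube.
have Ib : (lebesgue_rV d).-integrable setT (EFin \o (\1_B : E -> R)).
  apply/integrableP; split; first by apply/measurable_EFinP; exact: measurable_indic.
  under eq_integral => x _ do rewrite /= ger0_norm// .
  rewrite integral_indic// setIT; exact: cube_measure_lty.
apply: (@lt_le_trans _ _ (rint d (fun x => m ^+ 2 * (\1_B x)))).
  rewrite rintZ// mulr_gt0 ?exprn_gt0//.
  rewrite rintE /Rintegral integral_indic// setIT.
  rewrite (@lebesgue_rV_box R d (fun=> `[- (1 / 2), 1 / 2]%classic)); last by move=> i; exact: measurable_itv.
  rewrite big1// => i _; rewrite lebesgue_measure_itv /= lte_fin.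
  have -> : - (1 / 2) < 1 / 2 :> R by lra.
  by rewrite -EFinD; congr EFin; field.
rewrite /ip; apply: le_rint.
- exact: integrableZ_real.
- have tb := cutoff_test; have sb := tb.1; have t0 : test (fun=> 0 : R) := test0 d; have s0 := t0.1.
  by apply: test_integrable; apply: testD; exact: testMr.
move=> x /=; rewrite mulr0 addr0 indicE; have [xB|xB] := boolP (x \in B).
  rewrite mulr1 -expr2 ler_sqr ?nnegrE ?(ltW m0)//.
    by apply: cutoff_lower_bound; rewrite inE in xB.
  by apply: le_trans (ltW m0) _; apply: cutoff_lower_bound; rewrite inE in xB.
by rewrite mulr0 -expr2 sqr_ge0.
Qed.

End translation.

(** * From the propagator to trajectories *)

Section complex_parts.
Context {R : realType}.
Implicit Types a b : R[i].

Lemma cReD a b : complex.Re (a + b) = complex.Re a + complex.Re b.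
Proof. by case: a b => [? ?] [? ?]. Qed.

Lemma cImD a b : complex.Im (a + b) = complex.Im a + complex.Im b.
Proof. by case: a b => [? ?] [? ?]. Qed.

Lemma cReN a : complex.Re (- a) = - complex.Re a.
Proof. by case: a. Qed.

Lemma cImN a : complex.Im (- a) = - complex.Im a.
Proof. by case: a. Qed.

Lemma cReM a b : complex.Re (a * b) = complex.Re a * complex.Re b - complex.Im a * complex.Im b.
Proof. by case: a b => [? ?] [? ?]. Qed.

Lemma cImM a b : complex.Im (a * b) = complex.Re a * complex.Im b + complex.Im a * complex.Re b.
Proof. by case: a b => [? ?] [? ?]. Qed.

End complex_parts.

Lemma near_norm_gt {R : realType} (W : normedModType R) (x : W) (K : R) :
  K < `|x| -> \forall y \near x, K < `|y|.
Proof. by move=> Kx; apply: (cvgr_gt `|x|) => //; exact: norm_continuous. Qed.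

Section states_of_complex_functions.
Context {R : realType} (d : nat).
Local Notation E := 'rV[R]_d.
Local Notation C := R[i].
Local Notation mu := (@lebesgue_rV R d).
Local Notation state := (@state R d).
Local Notation test_state := (@test_state R d).
Local Notation in_L2 := (@in_L2 R d).
Local Notation ipd := (@ip R d).
Local Notation nrm := (hnorm R state (@ip R d)).

#[local] Opaque smooth bounded_support.

Definition reim (u : E -> C) : state := (fun x => complex.Re (u x), fun x => complex.Im (u x)).

Definition of_state (s : state) : E -> C := fun x => (s.1 x +i* s.2 x)%C.

Lemma of_stateK s : reim (of_state s) = s. Proof. by case: s. Qed.

Lemma reimB f g : reim (fun x => f x - g x) = reim f - reim g.
Proof. by congr pair; apply/funext => x; rewrite ?cReD ?cReN ?cImD ?cImN. Qed.

Lemma L2_reim u : L2 u <-> in_L2 (reim u).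
Proof.
split=> [[mr mi lu]|[[mr ir] [mi ii]]].
  have mr2 : measurable_fun setT (fun x => complex.Re (u x) ^+ 2) by exact: measurable_funX.
  have mi2 : measurable_fun setT (fun x => complex.Im (u x) ^+ 2) by exact: measurable_funX.
  have I : mu.-integrable setT (EFin \o (fun x => complex.Re (u x) ^+ 2 + complex.Im (u x) ^+ 2)).
    apply/integrableP; split; first by apply/measurable_EFinP; exact: measurable_funD.
    apply: le_lt_trans lu; rewrite /L2norm2; apply: ge0_le_integral => //.
    - by apply: measurableT_comp => //; apply/measurable_EFinP; exact: measurable_funD.
    - by apply/measurable_EFinP; exact: measurable_funD.
    by move=> x _ /=; rewrite lee_fin ger0_norm// addr_ge0 ?sqr_ge0.
  split; split=> //; apply: le_integrable I => //; do ?[exact/measurable_EFinP];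
    move=> x _ /=; rewrite lee_fin !ger0_norm ?addr_ge0 ?sqr_ge0//.
    by rewrite lerDl sqr_ge0.
  by rewrite lerDr sqr_ge0.
split=> //; have /integrableP[_] := integrableD_real d _ _ ir ii.
apply: le_lt_trans; apply: ge0_le_integral => //.
- by move=> x _; rewrite lee_fin addr_ge0 ?sqr_ge0.
- by apply/measurable_EFinP; apply: measurable_funD; exact: measurable_funX.
- apply: measurableT_comp => //; apply/measurable_EFinP.
  by apply: measurable_funD; exact: measurable_funX.
by move=> x _ /=; rewrite lee_fin ger0_norm// addr_ge0 ?sqr_ge0.
Qed.

Lemma L2norm2E u : L2 u -> L2norm2 setT u = (ipd (reim u) (reim u))%:E.
Proof.
move=> lu; have /L2_reim iu := lu.
have I := ip_integrable d _ _ iu iu.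
rewrite /ip rintE /Rintegral fineK; last exact: integrable_fin_num.
by rewrite /L2norm2; apply: eq_integral => x _; rewrite -!expr2.
Qed.

Lemma L2norm2_ae f g : L2 f -> L2 g -> {ae mu, forall x, f x = g x} ->
  L2norm2 setT f = L2norm2 setT g.
Proof.
have m h : L2 h -> measurable_fun setT
    (fun x : E => (complex.Re (h x) ^+ 2 + complex.Im (h x) ^+ 2)%:E).
  by move=> [mr mi _]; apply/measurable_EFinP; apply: measurable_funD; exact: measurable_funX.
move=> lf lg fg; apply: ge0_ae_eq_integral => //; do ?[exact: m];
  do ?[by move=> x _; rewrite lee_fin addr_ge0 ?sqr_ge0].
by apply: filterS fg => x + _ => ->.
Qed.

Lemma L2_lin (a : C) (f g : E -> C) : L2 f -> L2 g -> L2 (fun x => a * f x + g x).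
Proof.
move=> /L2_reim[fr fi] /L2_reim[gr gi]; apply/L2_reim; split => /=.
  rewrite (_ : (fun x => _) = (fun x => complex.Re a * complex.Re (f x) +
    (- complex.Im a * complex.Im (f x) + complex.Re (g x)))).
    by do 2?[apply: square_integrableD => //]; exact: square_integrableZ.
  by apply/funext => x; rewrite cReD cReM -addrA mulNr.
rewrite (_ : (fun x => _) = (fun x => complex.Re a * complex.Im (f x) +
  (complex.Im a * complex.Re (f x) + complex.Im (g x)))).
  by do 2?[apply: square_integrableD => //]; exact: square_integrableZ.
by apply/funext => x; rewrite cImD cImM -addrA.
Qed.

Lemma L2_scale (a : C) (f : E -> C) : L2 f -> L2 (fun x => a * f x).
Proof.
move=> lf; rewrite (_ : (fun x => _) = (fun x => (a - 1) * f x + f x)); first exact: L2_lin.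
by apply/funext => x; ring.
Qed.

Lemma L2_sub (f g : E -> C) : L2 f -> L2 g -> L2 (fun x => f x - g x).
Proof.
move=> lf lg; rewrite (_ : (fun x => _) = (fun x => (- 1) * g x + f x)); first exact: L2_lin.
by apply/funext => x; ring.
Qed.

Lemma nrm_reim_ae0 f g : L2 f -> L2 g -> {ae mu, forall x, f x = g x} ->
  nrm (reim f - reim g) = 0.
Proof.
move=> lf lg fg; have lfg := L2_sub f g lf lg; rewrite -reimB.
have l0 : L2 (fun x => g x - g x) by exact: L2_sub.
have := L2norm2_ae _ _ lfg l0; rewrite !L2norm2E// /hnorm => h.
have /h[->] : {ae mu, forall x, f x - g x = g x - g x} by apply: filterS fg => x ->.
rewrite /ip (_ : (fun x : E => _) = (fun=> 0)); first by rewrite rint0 sqrtr0.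
by apply/funext => x /=; rewrite subrr/= mulr0 addr0.
Qed.

Lemma cvg_hnorm {T : Type} {F : set_system T} {FF : Filter F} (f : T -> E -> C) :
  (forall t, L2 (f t)) -> L2norm2 setT (f t) @[t --> F] --> 0%E ->
  nrm (reim (f t)) @[t --> F] --> (0 : R).
Proof.
move=> lf f0; rewrite -[0](@sqrtr0 R).
apply: (@cvg_comp _ _ _ (fun t => ipd (reim (f t)) (reim (f t))) (@Num.sqrt R) F (nbhs (0:R))).
  apply: (@fine_cvg R T F FF (fun t => (ipd (reim (f t)) (reim (f t)))%:E) 0).
  by under eq_fun do rewrite -L2norm2E//.
exact: sqrt_continuous.
Qed.

Lemma test_function_reim f : test_function f -> test_state (reim f).
Proof.
move=> [sr si cf]; have [M [_ fM]] := compact_bounded cf.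
have h x : M + 1 < `|x| -> f x = 0.
  move=> Mx; apply/eqP; apply/negPn/negP => fx.
  have := fM (M + 1); rewrite ltrDl ltr01 => /(_ isT x).
  by move=> /(_ (@subset_closure _ [set x | f x != 0] x fx)); rewrite /= leNgt Mx.
by split; split; [exact: sr|exists (M + 1) => x /h /= ->|exact: si|exists (M + 1) => x /h /= ->].
Qed.

Lemma test_function_of_state s : test_state s -> test_function (of_state s).
Proof.
move: s => [a b] [[sa [M aM]] [sb [N bN]]]; split; [exact: sa|exact: sb|].
apply: bounded_closed_compact; last exact: closed_closure.
pose K := Num.max 0 (Num.max M N).
exists K; split; first exact: num_real.
move=> L KL x xS; apply: le_trans (ltW KL).
rewrite leNgt; apply/negP => Kx.
have /xS := @near_norm_gt R E x K Kx; move=>[y [/= fy Ky]]; move: fy => /eqP; apply.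
move: Ky; rewrite !gt_max => /and3P[_ My Ny].
by rewrite /of_state (aM _ My) (bN _ Ny).
Qed.

Lemma reim_schrodinger0 V f : test_function f -> reim (schrodinger0 V f) = energy d V (reim f).
Proof.
have lap (g : E -> R) x : laplacian g x = \sum_i partial i (partial i g) x.
  by apply: eq_bigr => i _; rewrite !partialE.
move=> tf; congr pair; apply/funext => x; rewrite hamiltonianE -lap.
  by rewrite /schrodinger0 cReD cReN !cReM /= !mul0r !subr0.
by rewrite /schrodinger0 cImD cImN !cImM /= !mul0r !addr0.
Qed.

End states_of_complex_functions.

(** * Trajectories of the unitary group *)

Section trajectories.
Context {R : realType} (d : nat).
Local Notation E := 'rV[R]_d.
Local Notation C := R[i].
Local Notation mu := (@lebesgue_rV R d).
Local Notation state := (@state R d).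
Local Notation test_state := (@test_state R d).
Local Notation in_L2 := (@in_L2 R d).
Local Notation nrm := (hnorm R state (@ip R d)).
Local Notation hcvgd := (hcvg R state (@ip R d)).
Local Notation reim := (@reim R d).
Local Notation of_state := (@of_state R d).

#[local] Opaque smooth bounded_support.

(** A curve [x] differentiable in L^2 with continuous velocity [y]; at each time [e t] approximates
    the pair (x t, y t) by the graph of -iP over test functions. This is the input of the abstract
    differentiation of means. *)
Record trajectory (V : E -> R) (x y : R -> state) (e : R -> nat -> state) : Prop := Trajectory {
  trajectory_L2 : forall t, in_L2 (x t);
  trajectory_velocity_L2 : forall t, in_L2 (y t);
  trajectory_test : forall t n, test_state (e t n);
  trajectory_cvg : forall t, hcvgd (e t) (x t);
  trajectory_generator_cvg : forall t, hcvgd (fun n => generator d V (e t n)) (y t);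
  trajectory_derive : forall t,
    nrm (h^-1 *: (x (t + h) - x t) - y t) @[h --> 0^'] --> (0 : R);
  trajectory_velocity_continuous : forall t,
    nrm (y (t + h) - y t) @[h --> 0^'] --> (0 : R) }.

(* Multiplication by -i *)
Definition rot (s : state) : state := (s.2, fun x => - s.1 x).

Lemma nrm_rot s : nrm (rot s) = nrm s.
Proof.
rewrite /hnorm /ip; congr (Num.sqrt (rint d _)); apply/funext => x /=.
by rewrite mulrNN addrC.
Qed.

Lemma rotB s r : rot (s - r) = rot s - rot r.
Proof. by congr pair; apply/funext => x; rewrite -[RHS]/(- _ - - _) -opprD. Qed.

Lemma rot_in_L2 s : in_L2 s -> in_L2 (rot s).
Proof.
move=> [s1 s2]; split=> //=; rewrite (_ : (fun x => _) = (fun x => - 1 * s.1 x)).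
  exact: square_integrableZ.
by apply/funext => x; rewrite mulN1r.
Qed.

Context (V : E -> R) (sV : smooth V) (U : R -> (E -> C) -> E -> C) (hU : is_propagator V U).

Lemma propagator_L2 t u : L2 u -> L2 (U t u).
Proof. by case: hU => iso _ _ _ _ /(iso t)[]. Qed.

Lemma propagator_isometry t u : L2 u -> L2norm2 setT (U t u) = L2norm2 setT u.
Proof. by case: hU => iso _ _ _ _ /(iso t)[]. Qed.

Lemma propagator_lin3 t (a b c : C) (u v w : E -> C) : L2 u -> L2 v -> L2 w ->
  {ae mu, forall x, U t (fun y => a * u y + (b * v y + c * w y)) x =
    a * U t u x + (b * U t v x + c * U t w x)}.
Proof.
move=> lu lv lw; case: hU => _ lin _ _ _.
have lcw := L2_scale d c w lw.
have h1 := lin t a u _ lu (L2_lin d b v _ lv lcw).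
have h2 := lin t b v _ lv lcw.
(* Linearity is available for a u + v only, so c w is written (c - 1) w + w. *)
have h3 := lin t (c - 1) w w lw lw.
have e3 : (fun y => (c - 1) * w y + w y) = (fun y => c * w y) by apply/funext => y; ring.
rewrite e3 in h3; apply: filterS3 h1 h2 h3 => x -> -> ->; ring.
Qed.

Lemma propagatorB t (u v : E -> C) : L2 u -> L2 v ->
  {ae mu, forall x, U t (fun y => u y - v y) x = U t u x - U t v x}.
Proof.
move=> lu lv; case: hU => _ lin _ _ _; have := lin t (- 1) v u lv lu.
have -> : (fun y => - 1 * v y + u y) = (fun y => u y - v y) by apply/funext => y; ring.
by apply: filterS => x ->; ring.
Qed.

(** The quotient at t is the image under the isometry U t of the quotient at 0, since U (t + h) = U
    t U h almost everywhere. *)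
Lemma difference_quotient_cvg (f g : E -> C) t : L2 f -> L2 g -> schrodinger V f g ->
  L2norm2 setT (fun x => (h^-1)%:C%C * (U (t + h) f x - U t f x) + 'i%C * U t g x)
    @[h --> 0^'] --> 0%E.
Proof.
move=> lf lg; have [_ _ [_ grp] _ gen] := hU => /(gen _ _ lf lg).
apply: cvg_trans; apply: near_eq_cvg; near=> h.
pose q x := (h^-1)%:C%C * U h f x + (- (h^-1)%:C%C * f x + 'i%C * g x).
have lUhf := propagator_L2 h f lf.
have lq : L2 q by apply: L2_lin => //; apply: L2_lin => //; exact: L2_scale.
have -> : (fun x => (h^-1)%:C%C * (U h f x - f x) + 'i%C * g x) = q.
  by apply/funext => x; rewrite /q; ring.
rewrite -(propagator_isometry t _ lq); apply: L2norm2_ae.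
- exact: propagator_L2.
- rewrite (_ : (fun x => _) = (fun x => (h^-1)%:C%C * U (t + h) f x +
     (- (h^-1)%:C%C * U t f x + 'i%C * U t g x))); last by apply/funext => x; ring.
  do 2![apply: L2_lin; first exact: propagator_L2].
  by apply: L2_scale; exact: propagator_L2.
have h1 := propagator_lin3 t (h^-1)%:C%C (- (h^-1)%:C%C) 'i%C _ _ _ lUhf lf lg.
apply: filterS2 h1 (grp t h f lf) => x -> ->; ring.
Unshelve. all: by end_near. Qed.

(** Composing in the other order, U (h + t) = U h U t, the same quotient is the one at 0 of the
    orbit of U t f, and the converse half of the description of the generator places (U t f, U t g)
    in the graph. This supplies approximating test functions at every time. *)
Lemma propagator_graph (f g : E -> C) t : L2 f -> L2 g -> schrodinger V f g ->
  schrodinger V (U t f) (U t g).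
Proof.
move=> lf lg fg; have [_ _ [_ grp] _ gen] := hU.
have lUf := propagator_L2 t f lf; have lUg := propagator_L2 t g lg.
apply/(gen _ _ lUf lUg); apply: cvg_trans (difference_quotient_cvg f g t lf lg fg).
apply: near_eq_cvg; near=> h; apply: L2norm2_ae.
- apply: L2_lin; last exact: L2_scale.
  by apply: L2_sub; exact: propagator_L2.
- apply: L2_lin; last exact: L2_scale.
  by apply: L2_sub => //; exact: propagator_L2.
by have := grp h t f lf; rewrite addrC; apply: filterS => x ->.
Unshelve. all: by end_near. Qed.

Lemma L2norm2_subrr (f : E -> C) : L2norm2 setT (fun x => f x - f x) = 0%E.
Proof.
by rewrite /L2norm2; apply: integral0_eq => x _; rewrite subrr/= expr0n addr0.
Qed.

Lemma test_schrodinger f : test_function f -> L2 f /\ L2 (schrodinger0 V f) /\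
  schrodinger V f (schrodinger0 V f).
Proof.
move=> tf; have trf := test_function_reim d f tf.
have lf : L2 f by apply/L2_reim; exact: test_state_in_L2.
have lPf : L2 (schrodinger0 V f).
  by apply/L2_reim; rewrite reim_schrodinger0//; apply: test_state_in_L2; exact: energy_test.
split=> //; split=> //; split=> //; exists (fun=> f); split=> // .
  by rewrite L2norm2_subrr; exact: cvg_cst.
by rewrite L2norm2_subrr; exact: cvg_cst.
Qed.

Lemma propagator_trajectory u0 : test_state u0 -> exists y e,
  trajectory V (fun t => reim (U t (of_state u0))) y e /\ e 0 = fun=> u0.
Proof.
move=> tu0; have tf := test_function_of_state d u0 tu0.
set f := of_state u0 in tf *; have fE : reim f = u0 by exact: of_stateK.
have [lf [lg fg]] := test_schrodinger f tf; set g := schrodinger0 V f in lg fg.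
have lUf t := propagator_L2 t f lf; have lUg t := propagator_L2 t g lg.
have [iso _ [U0 grp] str _] := hU.
pose x t := reim (U t f); pose y t := rot (reim (U t g)).
have Ke s : generator d V s = rot (energy d V s) by [].
have [e eP] : {e : R -> nat -> state & forall t,
    [/\ forall n, test_state (e t n), hcvgd (e t) (x t),
        hcvgd (fun n => generator d V (e t n)) (y t) & t = 0 -> e t = fun=> u0]}.
  apply: (choice (P := fun t (s : nat -> state) => [/\ forall n, test_state (s n), hcvgd s (x t),
        hcvgd (fun n => generator d V (s n)) (y t) & t = 0 -> s = fun=> u0])) => t.
  (* At time 0 the constant sequence is imposed, so that the initial spread is computed exactly on
     the initial state. *)
  have [->|t0] := eqVneq t 0.
    exists (fun=> u0); split=> //; rewrite /hcvg.
      rewrite -fE /x nrm_reim_ae0//; first exact: cvg_cst.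
      by apply: filterS (U0 f lf) => z ->.
    rewrite /y Ke -rotB nrm_rot -fE -reim_schrodinger0// nrm_reim_ae0//; first exact: cvg_cst.
    by apply: filterS (U0 g lg) => z ->.
  have [_ _ [s [ts sf sg]]] := propagator_graph f g t lf lg fg.
  have ls n : L2 (s n) by exact: (test_schrodinger _ (ts n)).1.
  have lPs n : L2 (schrodinger0 V (s n)) by exact: (test_schrodinger _ (ts n)).2.1.
  exists (fun n => reim (s n)); split.
  - by move=> n; exact: test_function_reim.
  - rewrite /hcvg /x; under eq_fun do rewrite -reimB.
    exact: (cvg_hnorm d _ (fun n => L2_sub d _ _ (ls n) (lUf t)) sf).
  - rewrite /hcvg /y; under eq_fun do rewrite Ke -rotB nrm_rot -reim_schrodinger0// -reimB.
    exact: (cvg_hnorm d _ (fun n => L2_sub d _ _ (lPs n) (lUg t)) sg).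
  - by move=> h; rewrite h eqxx in t0.
exists y, e; split; last by have [_ _ _] := eP 0; exact.
have Lx t : in_L2 (x t) by apply/L2_reim.
have Ly t : in_L2 (y t) by apply: rot_in_L2; apply/L2_reim.
split; [exact: Lx|exact: Ly|by move=> t; case: (eP t)|by move=> t; case: (eP t)|
  by move=> t; case: (eP t)| |].
- move=> t; have dq := difference_quotient_cvg f g t lf lg fg.
  apply: cvg_trans (cvg_hnorm d _ _ dq) => [|h]; last first.
    apply: L2_lin; last exact: L2_scale.
    exact: L2_sub.
  apply: near_eq_cvg; near=> h; congr (hnorm _ _ _ _); congr pair; apply/funext => z.
    rewrite cReD !cReM cReD cReN /= /x /y /=.
    by rewrite !mul0r mul1r sub0r subr0.
  rewrite cImD !cImM cImD cImN /= /x /y /=.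
  by rewrite !mul0r mul1r add0r addr0 opprK.
(* By isometry and linearity the increment of the velocity at t has the norm of its increment at 0,
   where strong continuity applies. *)
- move=> t; have L h : L2 (fun z => U h g z - g z) by apply: L2_sub.
  have strg : L2norm2 setT (fun z => U h g z - g z) @[h --> 0^'] --> 0%E.
    exact: cvg_trans (cvg_app _ (@nbhs_dnbhs R 0)) (str g lg).
  apply: cvg_trans (cvg_hnorm d _ L strg).
  apply: near_eq_cvg; near=> h; rewrite /y -rotB nrm_rot -reimB.
  rewrite /hnorm; congr Num.sqrt; apply: EFin_inj.
  rewrite -!L2norm2E//; last exact: L2_sub.
  rewrite -(propagator_isometry t _ (L h)); apply: L2norm2_ae.
  + exact: propagator_L2.
  + exact: L2_sub.
  have h1 := propagatorB t _ _ (lUg h) lg.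
  by apply: filterS2 h1 (grp t h g lg) => z -> ->.
Unshelve. all: by end_near. Qed.

End trajectories.

(** * Evolution of the spread *)

Section real_derivatives.
Context {R : realType}.
Implicit Types (f g : R -> R) (t : R).

Lemma is_derive_linear (k : R) t : is_derive t (1 : R) (fun t => k * t) k.
Proof.
by apply: (is_derive_eq (is_deriveZ k (is_derive_id t (1 : R)))); rewrite /GRing.scale /= mulr1.
Qed.

Lemma is_derive_addr f g t df dg : is_derive t (1 : R) f df -> is_derive t (1 : R) g dg ->
  is_derive t (1 : R) (fun t => f t + g t) (df + dg).
Proof. exact: is_deriveD. Qed.

Lemma is_derive_mulr f g t df dg : is_derive t (1 : R) f df -> is_derive t (1 : R) g dg ->
  is_derive t (1 : R) (fun t => f t * g t) (df * g t + f t * dg).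
Proof.
move=> fD gD; apply: (is_derive_eq (is_deriveM fD gD)).
by rewrite /GRing.scale /= addrC mulrC.
Qed.

Lemma is_derive_constl (k : R) f t df : is_derive t (1 : R) f df ->
  is_derive t (1 : R) (fun t => k * f t) (k * df).
Proof. by move=> fD; exact: (is_deriveZ k fD). Qed.

Lemma is_derive_comp_linear f df (k : R) t : is_derive (k * t) (1 : R) f df ->
  is_derive t (1 : R) (fun t => f (k * t)) (df * k).
Proof. by move=> fD; exact: (is_derive1_comp fD (is_derive_linear k t)). Qed.

End real_derivatives.

Lemma gronwall {R : realType} (G dG : R -> R) (k T : R) :
  (forall t, is_derive t (1 : R) G (dG t)) -> (forall t, dG t <= k * G t) -> 0 <= T ->
  G T <= G 0 * expR (k * T).
Proof.
move=> GD Gk T0; pose h (t : R) := G t * expR (- k * t).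
have hD (t : R) : is_derive t (1 : R) h ((dG t - k * G t) * expR (- k * t)).
  have eD : is_derive t (1 : R) (fun t : R => expR (- k * t)) (expR (- k * t) * - k).
    exact: is_derive_comp_linear.
  by apply: (is_derive_eq (is_derive_mulr _ _ _ _ _ (GD t) eD)); ring.
have : h T <= h 0.
  apply: (@ler0_derive1_nincr R h 0 T) => //.
  - move=> t _; rewrite derive1E; have [_ ->] := hD t.
    by rewrite mulr_le0_ge0 ?expR_ge0// subr_le0.
  - apply: continuous_subspaceT => t; apply: differentiable_continuous.
    by apply/derivable1_diffP; case: (hD t).
by rewrite /h mulr0 expR0 mulr1 mulNr expRN ler_pdivrMr ?expR_gt0.
Qed.

Section observables.
Context {R : realType} (d : nat).
Local Notation E := 'rV[R]_d.
Local Notation state := (@state R d).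
Local Notation test_state := (@test_state R d).
Local Notation in_L2 := (@in_L2 R d).
Local Notation ipd := (@ip R d).
Local Notation nrm := (hnorm R state (@ip R d)).
Local Notation multiplier := (@multiplier R d).
Local Notation momentum := (@momentum R d).

#[local] Opaque smooth bounded_support ip.

Context (V : E -> R) (sV : smooth V).
Local Notation generator := (@generator R d V).
Local Notation energy := (@energy R d V).

Definition observable (B : state -> state) : Prop :=
  [/\ forall u, test_state u -> test_state (B u),
      forall u w, test_state u -> test_state w -> B (u - w) = B u - B w,
      forall u w, test_state u -> test_state w -> ipd (B u) w = ipd u (B w)
    & exists2 c : R, 0 <= c & forall u, test_state u -> nrm (B u) <= c * (nrm u + nrm (generator u))].

Section along.
Context (x y : R -> state) (e : R -> nat -> state) (tr : trajectory d V x y e).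

Lemma observable_limits B : observable B -> exists m r : R -> R,
  [/\ forall t, ipd (e t n) (B (e t n)) @[n --> \oo] --> m t,
      forall t, 2 * ipd (generator (e t n)) (B (e t n)) @[n --> \oo] --> r t
    & forall t, is_derive t (1 : R) m (r t)].
Proof.
move=> [Bt BB Bs [c c0 Bc]]; case: tr => Lx Ly te ex ey xy yc.
have KL u (tu : test_state u) := test_state_in_L2 d _ (generator_test d V sV u tu).
have BL u (tu : test_state u) := test_state_in_L2 d _ (Bt u tu).
exists (observable_mean R state ipd B e), (observable_rate R state ipd generator B e); split.
- exact: (observable_mean_cvg R state in_L2 ipd (in_L2D d) (in_L2Z d) (ipC d) (ipDl d)
    (ipZl d) (ip_ge0 d) test_state generator B c c0 (test_state_in_L2 d) (test_stateB d)
    KL (generatorB d V) BL BB Bs Bc x y e Lx Ly te ex ey).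
- exact: (observable_rate_cvg R state in_L2 ipd (in_L2D d) (in_L2Z d) (ipC d) (ipDl d)
    (ipZl d) (ip_ge0 d) test_state generator B c c0 (test_state_in_L2 d) (test_stateB d)
    KL (generatorB d V) BL BB Bc x y e Lx Ly te ex ey).
- exact: (observable_mean_derive R state in_L2 ipd (in_L2D d) (in_L2Z d) (ipC d) (ipDl d)
    (ipZl d) (ip_ge0 d) test_state generator B c c0 (test_state_in_L2 d) (test_stateB d)
    KL (generatorB d V) BL BB Bs Bc x y e Lx Ly te ex ey xy yc).
Qed.

End along.

Lemma identity_observable : observable id.
Proof.
split=> //; exists 1 => // u _; rewrite mul1r lerDl.
exact: hnorm_ge0.
Qed.

Lemma energy_observable : observable energy.
Proof.
split.
- exact: energy_test.
- exact: energyB.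
- exact: energy_sym.
- by exists 1 => // u tu; exact: energy_bound.
Qed.

Context (c1 c0 : R) (c1_gt0 : 0 < c1) (c0_ge0 : 0 <= c0).
Hypothesis V_lower : forall x, c1 * japanese x ^+ 2 <= V x + c0.

Lemma momentum_observable v : observable (momentum v).
Proof.
split.
- exact: momentum_test.
- exact: momentumB.
- exact: momentum_sym.
- exact: (momentum_bound d V sV c1 c0 c1_gt0 c0_ge0 V_lower v).
Qed.

Lemma multiplier_observable phi c : smooth phi -> 0 <= c ->
  (forall x, phi x ^+ 2 <= c * japanese x ^+ 2) -> observable (multiplier phi).
Proof.
move=> sp c_ge0 pc; split.
- by move=> u; exact: multiplier_test.
- by move=> u w _ _; exact: multiplierB.
- by move=> u w _ _; exact: multiplier_sym.
- exact: (multiplier_bound d V sV c1 c0 c1_gt0 c0_ge0 V_lower phi c sp c_ge0 pc).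
Qed.

Lemma dotv_observable v : observable (multiplier (dotv d v)).
Proof.
apply: (multiplier_observable _ (enorm v ^+ 2)).
- exact: smooth_dotv.
- exact: sqr_ge0.
move=> x; rewrite enorm_sqr; apply: le_trans (sum_cauchy_schwarz d _ _) _.
apply: ler_wpM2l; first by rewrite sumr_ge0// => i _; exact: sqr_ge0.
by rewrite japanese_sqr -enorm_sqr lerDr.
Qed.

End observables.

(** * Restriction to a Borel set and Chebyshev's inequality *)

Section indicator.
Context {R : realType} (d : nat).
Local Notation E := 'rV[R]_d.
Local Notation ipd := (@ip R d).
Context (G : set E) (mG : measurable G).
Local Notation restrict := (multiplier d \1_G).

Lemma square_integrable_indic (f : E -> R) : square_integrable d f ->
  square_integrable d (fun x => \1_G x * f x).
Proof.
move=> [mf fi]; have m1 : measurable_fun setT (fun x => \1_G x * f x).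
  by apply: measurable_funM => //; exact: measurable_indic.
split=> //; apply: le_integrable fi => //.
  by apply/measurable_EFinP; exact: measurable_funX.
move=> x _ /=; rewrite lee_fin !ger0_norm ?sqr_ge0// exprMn.
by rewrite indicE; case: (x \in G); rewrite ?expr1n ?mul1r// expr0n mul0r sqr_ge0.
Qed.

Lemma ip_indic_le u : in_L2 d u -> ipd (restrict u) (restrict u) <= ipd u u.
Proof.
move=> Lu; have Lru : in_L2 d (restrict u).
  by case: Lu => ? ?; split; exact: square_integrable_indic.
apply: le_rint; [exact: ip_integrable|exact: ip_integrable|].
move=> x /=; rewrite indicE; case: (x \in G) => /=; first by rewrite !mul1r.
by rewrite !mul0r addr0 addr_ge0// -expr2 sqr_ge0.
Qed.

Lemma ip_indic_moment (b : R) z u : test_state d u -> 0 <= b ->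
  (forall x, G x -> b <= enorm (x - z) ^+ 2) ->
  b * ipd (restrict u) (restrict u) <=
  rint d (fun x => enorm (x - z) ^+ 2 * (u.1 x ^+ 2 + u.2 x ^+ 2)).
Proof.
move=> tu b0 Gb; have Lu := test_state_in_L2 d _ tu.
have Lru : in_L2 d (restrict u).
  by case: Lu => ? ?; split; exact: square_integrable_indic.
have Ir := ip_integrable d _ _ Lru Lru.
rewrite /ip -(rintZ _ _ _ Ir); apply: le_rint.
- exact: integrableZ_real.
- exact: test_integrable (moment_test d z u tu).
move=> x /=; have n0 : 0 <= u.1 x ^+ 2 + u.2 x ^+ 2 by rewrite addr_ge0 ?sqr_ge0.
rewrite indicE; have [xG|xG] := boolP (x \in G) => /=.
  by rewrite !mul1r -!expr2; apply: ler_wpM2r => //; apply: Gb; rewrite inE in xG.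
by rewrite !mul0r addr0 mulr0 mulr_ge0 ?sqr_ge0.
Qed.

End indicator.

(** * Growth of the spread and localization near the orbit *)

Section spread_evolution.
Context {R : realType} (d : nat).
Local Notation E := 'rV[R]_d.
Local Notation state := (@state R d).
Local Notation test_state := (@test_state R d).
Local Notation in_L2 := (@in_L2 R d).
Local Notation ipd := (@ip R d).
Local Notation hcvgd := (hcvg R state (@ip R d)).
Local Notation multiplier := (@multiplier R d).
Local Notation momentum := (@momentum R d).
Local Notation spread := (@spread R d).

#[local] Opaque smooth bounded_support ip.

Context (V : E -> R) (A : 'M[R]_d) (sA : A^T = A).
Hypothesis hV : assumption_V V.
Hypothesis hVA : has_principal_symbol V (quadratic A).
Context (v : E) (nu : R) (vA : v *m A = nu ^+ 2 *: v).
Local Notation W := (fun x => V x - quadratic A x).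

Let sV : smooth V. Proof. by case: hV. Qed.

Context (kappa : R) (kappa_ge0 : 0 <= kappa).
Hypothesis W_bound : forall j x, `|partial j W x| <= kappa.
Context (c : R) (c_gt0 : 0 < c).
Hypothesis A_lower : forall x, c * enorm x ^+ 2 <= quadratic A x.

Let quadratic_nonneg x : 0 <= quadratic A x.
Proof. by apply: le_trans (A_lower x); rewrite mulr_ge0 ?sqr_ge0// ltW. Qed.

(** Kinetic and potential energy of the classical orbit add up to r^2 nu^2 |v|^2 / 2 by sin^2 +
    cos^2 = 1, so the coefficient of the mass is constant in time. *)
Lemma spread_orbitE r t u : test_state u ->
  spread A (r * nu * sin (nu * t)) v ((r * cos (nu * t)) *: v) u =
  ipd u (energy d V u) - ipd u (multiplier W u)
  + r * nu * sin (nu * t) * ipd u (momentum v u)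
  - r * nu ^+ 2 * cos (nu * t) * ipd u (multiplier (dotv d v) u)
  + 2^-1 * r ^+ 2 * nu ^+ 2 * (\sum_j v 0 j ^+ 2) * ipd u u.
Proof.
move=> tu; rewrite (spreadE d V sV A sA _ _ _ u tu).
set s := sin _; set k := cos _; have ks : k ^+ 2 = 1 - s ^+ 2 by rewrite -(cos2Dsin2 (nu * t)) addrK.
have -> : ipd u (multiplier (dotv d ((r * k) *: v *m A)) u) =
    r * k * nu ^+ 2 * ipd u (multiplier (dotv d v) u).
  have i : test d (fun x => u.1 x * (dotv d v x * u.1 x) + u.2 x * (dotv d v x * u.2 x)).
    case: (u) tu => a b [ta tb]; rewrite /= in ta tb *; have sa := testT _ _ ta; have sb := testT _ _ tb.
    have sd := smooth_dotv d v; by prove_test.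
  case: (u) i => a b i; rewrite !ip_pair -(rintZ _ _ _ (test_integrable _ _ i)).
  congr (rint d _); apply/funext => x /=.
  have -> : dotv d ((r * k) *: v *m A) x = r * k * nu ^+ 2 * dotv d v x.
    rewrite -scalemxAl vA scalerA /dotv mulr_sumr; apply: eq_bigr => i' _.
    by rewrite mxE mulrA.
  by move: (dotv _ _ _) => q; ring.
have -> : quadratic A ((r * k) *: v) = 2^-1 * ((r * k) ^+ 2 * nu ^+ 2 * \sum_j v 0 j ^+ 2).
  have vT : ((r * k) *: v)^T = (r * k) *: v^T by rewrite linearZ.
  rewrite /quadratic vT -scalemxAl vA -!scalemxAl -scalemxAr !scalerA mxE.
  congr (_ * (_ * _)); first by ring.
  by rewrite mxE; apply: eq_bigr => j _; rewrite [(_^T)%R _ _]mxE expr2.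
rewrite !exprMn ks.
by move: (ipd _ _) (ipd _ _) (ipd _ _) (ipd _ _) (ipd _ _) (\sum_j _) => *; field.
Qed.

Section along.
Context (x y : R -> state) (e : R -> nat -> state) (tr : trajectory d V x y e).
Context (M : R) (xM : forall t, ipd (x t) (x t) = M).

(** The coefficients p of momentum and q of position obey p' = q and q' = - nu^2 p. With the
    Ehrenfest laws, the terms in q cancel and the energy and the mass are conserved; what remains is
    the limit along [e t] of the expression bounded in [spread_rate]. *)
Lemma spread_evolution r : exists F dF : R -> R,
  [/\ forall t, spread A (r * nu * sin (nu * t)) v ((r * cos (nu * t)) *: v) (e t n)
        @[n --> \oo] --> F t,
      forall t, is_derive t (1 : R) F (dF t)
    & forall t, `|dF t| <= kappa * (d%:R / 2 * M + F t)].
Proof.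
have [c1 [c0 [c1_gt0 c0_ge0 Vc]]] := potential_lower_bound d V hV.
have [cW cW_gt0 Wc] := perturbation_bound d V A hVA.
have sW := smooth_W d V sV A.
have te := trajectory_test _ _ _ _ _ tr.
have [m1 [r1 [m1P r1P m1D]]] := observable_limits d V sV x y e tr _ (energy_observable d V sV).
have [m2 [r2 [m2P r2P m2D]]] := observable_limits d V sV x y e tr _
  (multiplier_observable d V sV c1 c0 c1_gt0 c0_ge0 Vc _ cW sW (ltW cW_gt0) Wc).
have [m3 [r3 [m3P r3P m3D]]] := observable_limits d V sV x y e tr _
  (momentum_observable d V sV c1 c0 c1_gt0 c0_ge0 Vc v).
have [m4 [r4 [m4P r4P m4D]]] := observable_limits d V sV x y e tr _
  (dotv_observable d V sV c1 c0 c1_gt0 c0_ge0 Vc v).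
have [m5 [r5 [m5P r5P m5D]]] := observable_limits d V sV x y e tr _ (identity_observable d V).
have uniq (s : nat -> R) (l l' : R) : s @ \oo --> l -> s @ \oo --> l' -> l = l'.
  by move=> sl sl'; exact: (cvg_unique (@norm_hausdorff R R) sl sl').
have cM (k : R) (s : nat -> R) (l : R) : s @ \oo --> l -> k * s n @[n --> \oo] --> k * l.
  by move=> sl; apply: cvgM => //; exact: cvg_cst.
have r1E t : r1 t = 0.
  apply: uniq (r1P t) _; under eq_fun do rewrite energy_rate//; exact: cvg_cst.
have r5E t : r5 t = 0.
  apply: uniq (r5P t) _; under eq_fun do rewrite (identity_rate d V sV _ (te _ _)); exact: cvg_cst.
have r4E t : r4 t = m3 t.
  apply: uniq (r4P t) _; under eq_fun do rewrite (position_rate d V sV v _ (te _ _)); exact: m3P.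
have m5E t : m5 t = M.
  apply: uniq (m5P t) _; rewrite -(xM t) -(hnorm_sqr R state ipd (ip_ge0 d)).
  under eq_fun do rewrite -(hnorm_sqr R state ipd (ip_ge0 d)).
  apply: (@cvg_comp _ _ _ _ (fun s : R => s ^+ 2)); last exact: exprn_continuous.
  exact: (hcvg_norm R state in_L2 ipd (in_L2D d) (in_L2Z d) (ipC d) (ipDl d)
    (ipZl d) (ip_ge0 d) _ _ (fun n => test_state_in_L2 d _ (te t n))
    (trajectory_L2 _ _ _ _ _ tr t) (trajectory_cvg _ _ _ _ _ tr t)).
pose p t := r * nu * sin (nu * t); pose q t := r * nu ^+ 2 * cos (nu * t).
pose K := 2^-1 * r ^+ 2 * nu ^+ 2 * \sum_j v 0 j ^+ 2.
pose F t := m1 t + - 1 * m2 t + p t * m3 t + - 1 * (q t * m4 t) + K * m5 t.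
exists F, (fun t => - r2 t + p t * (r3 t + nu ^+ 2 * m4 t)).
have FP t : spread A (r * nu * sin (nu * t)) v ((r * cos (nu * t)) *: v) (e t n)
    @[n --> \oo] --> F t.
  under eq_fun do rewrite (spread_orbitE r t _ (te _ _)).
  rewrite /F !mulN1r; do 4?[apply: cvgD]; rewrite -?/(p t) -?/(q t) -?/K.
  - exact: m1P.
  - by apply: cvgN; exact: m2P.
  - by apply: cM; exact: m3P.
  - by apply: cvgN; apply: cM; exact: m4P.
  - by apply: cM; exact: m5P.
split=> // t.
- have pD : is_derive t (1 : R) p (q t * 1).
    have := is_derive_constl (r * nu) _ _ _ (is_derive_comp_linear _ _ nu t (is_derive_sin (nu * t))).
    by move=> D; apply: (is_derive_eq D); rewrite /q; ring.
  have qD : is_derive t (1 : R) q (- (nu ^+ 2 * p t)).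
    have := is_derive_constl (r * nu ^+ 2) _ _ _ (is_derive_comp_linear _ _ nu t (is_derive_cos (nu * t))).
    by move=> D; apply: (is_derive_eq D); rewrite /p; ring.
  have := is_derive_addr _ _ _ _ _ (is_derive_addr _ _ _ _ _ (is_derive_addr _ _ _ _ _
    (is_derive_addr _ _ _ _ _ (m1D t) (is_derive_constl (- 1) _ _ _ (m2D t)))
    (is_derive_mulr _ _ _ _ _ pD (m3D t)))
    (is_derive_constl (- 1) _ _ _ (is_derive_mulr _ _ _ _ _ qD (m4D t))))
    (is_derive_constl K _ _ _ (m5D t)).
  by move=> D; apply: (is_derive_eq D); rewrite r1E r5E r4E; ring.
have h1 := cvgD (cvgN (r2P t)) (cM (p t) _ _ (cvgD (r3P t) (cM (nu ^+ 2) _ _ (m4P t)))).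
have h2 := cM kappa _ _ (cvgD (cM (d%:R / 2) _ _ (m5P t)) (FP t)).
rewrite m5E in h2.
apply: (ler_cvg_to (cvg_norm (h1 _ _ _)) (h2 _)); near=> n.
exact: (spread_rate d V sV A sA kappa kappa_ge0 W_bound quadratic_nonneg v (nu ^+ 2) vA
  (p t) _ (e t n) (te t n)).
Unshelve. all: by end_near. Qed.

(** Gronwall's inequality is applied to d/2 M + F rather than F, which makes the differential
    inequality homogeneous. At t = 0 the orbit is at r v with zero momentum, so the initial value is
    independent of r. *)
Lemma spread_growth r u t : test_state u -> e 0 = (fun=> translate d (r *: v) u) -> 0 <= t ->
  exists2 F : R, spread A (r * nu * sin (nu * t)) v ((r * cos (nu * t)) *: v) (e t n)
      @[n --> \oo] --> F &
    F <= (d%:R / 2 * M + spread A 0 v 0 u) * expR (kappa * t).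
Proof.
move=> tu e0 t0; have [F [dF [FP FD dFb]]] := spread_evolution r; exists (F t) => //.
have M0 : 0 <= M by rewrite -(xM 0); exact: ip_ge0.
have F0 : F 0 = spread A 0 v 0 u.
  have := FP 0; rewrite mulr0 sin0 cos0 mulr0 mulr1 e0 (spread_translate d A _ _ _ _ sA tu).
  by move=> h; apply/esym; apply: (cvg_unique (@norm_hausdorff R R) (cvg_cst _) h).
have GD s : is_derive s (1 : R) (fun s => d%:R / 2 * M + F s) (0 + dF s).
  by apply: is_derive_addr => //; exact: is_derive_cst.
have := gronwall _ _ kappa t GD _ t0; rewrite F0 => /(_ _)/le_trans.
move=> /(_ _ _ (lexx _)) h; apply: le_trans (h _); first by rewrite lerDr mulr_ge0// divr_ge0.
by move=> s; rewrite add0r; apply: le_trans (ler_norm _) (dFb s).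
Qed.

(** The moment inequality is available for test functions, so it is applied to the approximants at
    time t. Restriction to [G] is a contraction of L^2, hence the masses in [G] converge and the
    bound passes to [x t]. *)
Lemma localization r u t (G : set E) (b : R) : test_state u ->
  e 0 = (fun=> translate d (r *: v) u) -> 0 <= t -> measurable G -> 0 <= b ->
  (forall z, G z -> b <= enorm (z - (r * cos (nu * t)) *: v) ^+ 2) ->
  c * (b * ipd (multiplier \1_G (x t)) (multiplier \1_G (x t))) <=
  (d%:R / 2 * M + spread A 0 v 0 u) * expR (kappa * t).
Proof.
move=> tu e0 t0 mG b0 Gb; have [F FP] := spread_growth r u t tu e0 t0; apply: le_trans.
set z := (_ *: v) in FP Gb.
have L s : in_L2 s -> in_L2 (multiplier \1_G s).
  by move=> [s1 s2]; split; exact: square_integrable_indic.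
have Le n := test_state_in_L2 d _ (trajectory_test _ _ _ _ _ tr t n).
have Lx := trajectory_L2 _ _ _ _ _ tr t.
have cv : hcvgd (fun n => multiplier \1_G (e t n)) (multiplier \1_G (x t)).
  apply: (squeeze_cvgr _ (cvg_cst 0) (trajectory_cvg _ _ _ _ _ tr t)); near=> n.
  rewrite hnorm_ge0 -multiplierB /hnorm ler_wsqrtr//; apply: (ip_indic_le d G mG).
  exact: (hsubspaceB R state in_L2 (in_L2D d) (in_L2Z d)).
have h1 : ipd (multiplier \1_G (e t n)) (multiplier \1_G (e t n)) @[n --> \oo] -->
    ipd (multiplier \1_G (x t)) (multiplier \1_G (x t)).
  rewrite -(hnorm_sqr R state ipd (ip_ge0 d)).
  under eq_fun do rewrite -(hnorm_sqr R state ipd (ip_ge0 d)).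
  apply: (@cvg_comp _ _ _ _ (fun s : R => s ^+ 2)); last exact: exprn_continuous.
  exact: (hcvg_norm R state in_L2 ipd (in_L2D d) (in_L2Z d) (ipC d) (ipDl d)
    (ipZl d) (ip_ge0 d) _ _ (fun n => L _ (Le n)) (L _ Lx) cv).
have cM (k : R) (s : nat -> R) (l : R) : s @ \oo --> l -> k * s n @[n --> \oo] --> k * l.
  by move=> sl; apply: cvgM => //; exact: cvg_cst.
apply: (ler_cvg_to (cM c _ _ (cM b _ _ h1)) FP); near=> n.
have tn := trajectory_test _ _ _ _ _ tr t n.
apply: le_trans (spread_moment d A sA _ _ _ _ c c_gt0 tn A_lower).
apply: ler_wpM2l; first exact: ltW.
exact: ip_indic_moment.
Unshelve. all: by end_near. Qed.

End along.

End spread_evolution.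

(** * The observed mass *)

(* No measurability: the integral of a nonnegative function is a supremum over simple functions. *)
Lemma le_integral_nonneg dT (T : measurableType dT) (R : realType)
    (m : {measure set T -> \bar R}) (D D' : set T) (f g : T -> \bar R) :
  D `<=` D' -> (forall x, 0 <= f x)%E -> (forall x, 0 <= g x)%E ->
  (forall x, D x -> f x <= g x)%E ->
  (\int[m]_(x in D) f x <= \int[m]_(x in D') g x)%E.
Proof.
move=> DD f0 g0 fg; rewrite !ge0_integralE//; apply: ereal_sup_le => _ [h hf <-].
exists h => // x; apply: le_trans (hf x) _; rewrite /patch.
case: ifPn => [|_]; last by case: ifP.
by rewrite inE => xD; rewrite ifT ?fg// inE; exact: DD.
Qed.

(** After shifting by n pi, which changes the cosine by a sign only, injectivity of cos on [0, pi]
    leaves at most one zero between n pi and (n + 1) pi. *)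
Lemma countable_cos_zeros (R : realType) (nu : R) : 0 < nu ->
  countable [set t : R | 0 <= t /\ cos (nu * t) = 0].
Proof.
move=> nu0; have pi0 : 0 < pi :> R by exact: pi_gt0.
pose Z (n : nat) := [set t : R | n%:R * pi <= nu * t <= n.+1%:R * pi /\ cos (nu * t) = 0].
have cZ n : countable (Z n).
  have [->|/set0P[s [sn s0]]] := eqVneq (Z n) set0; first exact: countable0.
  apply: (sub_countable (B := [set s])); last exact: countable1.
  apply: subset_card_le => t [tn t0] /=.
  have shift (q : R) : n%:R * pi <= nu * q <= n.+1%:R * pi -> cos (nu * q) = 0 ->
      nu * q - n%:R * pi \in `[0, pi]%R /\ cos (nu * q - n%:R * pi) = 0.
    move=> /andP[q1 q2] q0; split.
      rewrite in_itv /= subr_ge0 q1 /= lerBlDl; apply: le_trans q2 _.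
      by rewrite -[n.+1]addn1 natrD mulrDl mul1r.
    have := alternatingn (@cosDpi R) n (nu * q - n%:R * pi).
    rewrite mulr_natl subrK q0 => /esym/eqP; rewrite mulf_eq0 signr_eq0 /=.
    by move/eqP.
  have [sI sc] := shift s sn s0; have [tI tc] := shift t tn t0.
  have /addIr/mulfI := cos_inj tI sI (etrans tc (esym sc)).
  by apply; rewrite gt_eqF.
apply: (sub_countable (B := \bigcup_n Z n)); last exact: bigcup_countable.
apply: subset_card_le => t [t0 ct]; pose n := Num.truncn (nu * t / pi).
have x0 : 0 <= nu * t / pi by rewrite divr_ge0 ?mulr_ge0// ltW.
exists n => //; split => //; have /andP[h1 h2] := truncn_itv x0.
by rewrite -ler_pdivlMr// h1 /= -ler_pdivrMr// ltW.
Qed.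

Section decay.
Context (R : realType) (K k nu T : R) (K0 : 0 <= K) (k0 : 0 < k) (nu0 : 0 < nu).

Lemma cvg_natS_sqr (q : R) : 0 < q -> K / (1 + q * n.+1%:R ^+ 2) @[n --> \oo] --> (0 : R).
Proof.
move=> q0; have h : K / q * n.+1%:R^-1 @[n --> \oo] --> (0 : R).
  rewrite -[0](mulr0 (K / q)); apply: cvgM; first exact: cvg_cst.
  exact: cvg_harmonic.
apply: (squeeze_cvgr _ (cvg_cst 0) h); near=> n.
have n1 : 1 <= n.+1%:R :> R by rewrite ler1n.
have n0 : 0 < n.+1%:R :> R by exact: lt_le_trans n1.
have p0 : 0 < 1 + q * n.+1%:R ^+ 2 by rewrite addr_gt0// mulr_gt0// exprn_gt0.
rewrite divr_ge0 ?(ltW p0)//= -mulrA -invfM ler_wpM2l// lef_pV2 ?posrE//; last exact: mulr_gt0.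
apply: (@le_trans _ _ (q * n.+1%:R ^+ 2)); last by rewrite lerDr.
by rewrite ler_pM2l// expr2 ler_peMr// ltW.
Unshelve. all: by end_near. Qed.

(** The denominators are at least 1, so the constant K dominates on the bounded interval; the
    integrand tends to 0 wherever cos (nu t) is nonzero, hence off a countable set. *)
Lemma integral_decay :
  (\int[lebesgue_measure]_(t in `[0%R, T]) (K / (1 + k * n.+1%:R ^+ 2 * cos (nu * t) ^+ 2))%:E)%E
    @[n --> \oo] --> (0 : \bar R).
Proof.
pose g n (t : R) := K / (1 + k * n.+1%:R ^+ 2 * cos (nu * t) ^+ 2).
have den n t : 1 <= 1 + k * n.+1%:R ^+ 2 * cos (nu * t) ^+ 2.
  by rewrite lerDl mulr_ge0 ?sqr_ge0// mulr_ge0 ?sqr_ge0// ltW.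
have den0 n t : 0 < 1 + k * n.+1%:R ^+ 2 * cos (nu * t) ^+ 2 by exact: lt_le_trans (den n t).
have cg n : continuous (g n).
  move=> t; apply: cvgM; first exact: cvg_cst.
  apply: cvgV; first by rewrite gt_eqF.
  apply: cvgD; first exact: cvg_cst.
  apply: cvgM; first exact: cvg_cst.
  apply: (@cvg_comp _ _ _ (fun t => cos (nu * t)) (fun s : R => s ^+ 2)); last exact: exprn_continuous.
  apply: (@cvg_comp _ _ _ (fun t => nu * t) cos); last exact: continuous_cos.
  by apply: cvgM; [exact: cvg_cst|exact: cvg_id].
have [| | | | | _ _] := @dominated_convergence _ _ R lebesgue_measure `[0, T]
  (measurable_itv _) (fun n t => (g n t)%:E) (cst 0%E) (cst K%:E).
- move=> n; apply/measurable_EFinP; apply: measurable_funTS.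
  exact: continuous_measurable_fun.
- exact: measurable_cst.
- have cZ := countable_cos_zeros R nu nu0.
  exists [set t : R | 0 <= t /\ cos (nu * t) = 0]; split.
  + exact: countable_measurable.
  + exact: countable_lebesgue_measure0.
  move=> t /= ht; apply: contrapT => nt; apply: ht; rewrite in_itv /= => /andP[t0 _].
  have ct : 0 < k * cos (nu * t) ^+ 2.
    rewrite mulr_gt0// exprn_even_gt0//=; apply/eqP => c0; exact: nt.
  apply: cvg_EFin; first by near=> n.
  apply: cvg_trans (cvg_natS_sqr _ ct); apply: near_eq_cvg; near=> n.
  by rewrite /g /= [in RHS]mulrAC.
- apply/integrableP; split; first exact: measurable_cst.
  by rewrite integral_cst//= lebesgue_measure_itv /=; case: ifP => _; rewrite ?mule0 // -EFinD -EFinM ltry.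
- apply: aeW => t n _; rewrite lee_fin ger0_norm; last by rewrite divr_ge0// ltW.
  by rewrite ler_pdivrMr// ler_peMr.
by rewrite integral0.
Unshelve. all: by end_near. Qed.

End decay.

(** * Distance from the cone to the orbit *)

Lemma not_closure_dist (R : realType) (W : normedModType R) (S : set W) (p : W) :
  ~ closure S p -> exists2 eps : R, 0 < eps & forall x, S x -> eps <= `|x - p|.
Proof.
move=> Sp; have [B [nB SB]] : exists B, nbhs p B /\ ~ (S `&` B !=set0).
  apply: contrapT => h; apply: Sp => B nB; apply: contrapT => SB; apply: h; by exists B.
have [eps /= eps0 pB] := (nbhs_normP p B).1 nB.
exists eps => // x Sx; rewrite leNgt; apply/negP => xp; apply: SB; exists x; split=> //.
by apply: pB; rewrite /= distrC.
Qed.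

Section cone.
Context {R : realType} (d : nat).
Local Notation E := 'rV[R]_d.

Lemma norm_le_enorm (x : E) : `|x| <= enorm x.
Proof.
apply: rV_norm_le; first exact: enorm_ge0.
move=> i; rewrite -sqrtr_sqr ler_wsqrtr// (bigD1 i)//= lerDl sumr_ge0// => j _.
exact: sqr_ge0.
Qed.

(** Rescaling by |s| keeps the point in the cone and sends s v to v or - v according to the sign of
    s. Both directions are needed, as the orbit passes through the origin and comes out on the other
    side. *)
Lemma conical_dist (w : set E) (v : E) : conical w -> ~ closure w v -> ~ closure w (- v) ->
  exists2 delta : R, 0 < delta &
    forall x (s : R), w x -> (delta * s) ^+ 2 <= enorm (x - s *: v) ^+ 2.
Proof.
move=> cw /not_closure_dist[e1 e10 h1] /not_closure_dist[e2 e20 h2].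
exists (Num.min e1 e2); first by rewrite lt_min e10.
move=> x s wx; have m0 : 0 < Num.min e1 e2 by rewrite lt_min e10.
have [->|s0] := eqVneq s 0; first by rewrite mulr0 expr0n sqr_ge0.
have ns : 0 < `|s| by rewrite normr_gt0.
pose y := `|s|^-1 *: x; have wy : w y by apply/(cw x `|s|^-1); rewrite ?invr_gt0.
have -> : enorm (x - s *: v) ^+ 2 = s ^+ 2 * enorm (y - Num.sg s *: v) ^+ 2.
  rewrite -(real_normK (num_real s)) -enormZ scalerBr !scalerA mulfV ?gt_eqF// scale1r.
  by rewrite mulrC -numEsg.
rewrite exprMn mulrC ler_wpM2l ?sqr_ge0// ler_sqr ?nnegrE ?enorm_ge0//; last exact: ltW.
apply: le_trans (norm_le_enorm _).
have [sp|sn|s0'] := ltrgtP s 0; last by rewrite s0' eqxx in s0.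
  rewrite ltr0_sg// scaleN1r; apply: le_trans (h2 y wy).
  by rewrite ge_min lexx orbT.
rewrite gtr0_sg// scale1r; apply: le_trans (h1 y wy).
by rewrite ge_min lexx.
Qed.

(** Replaces [w] by a Borel set containing it, on which the mass is a real inner product to which
    [localization] applies. *)
Lemma L2norm2_le_restrict (w G : set E) (u : E -> R[i]) : measurable G -> w `<=` G -> L2 u ->
  (L2norm2 w u <= (ip d (multiplier d \1_G (reim d u)) (multiplier d \1_G (reim d u)))%:E)%E.
Proof.
move=> mG wG lu; have /L2_reim Lu := lu.
have Lr : in_L2 d (multiplier d \1_G (reim d u)).
  by case: Lu => ? ?; split; exact: square_integrable_indic.
have I := ip_integrable d _ _ Lr Lr.
rewrite /ip rintE /Rintegral fineK; last exact: integrable_fin_num.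
apply: le_integral_nonneg => //.
- by move=> x; rewrite lee_fin addr_ge0 ?sqr_ge0.
- by move=> x /=; rewrite lee_fin addr_ge0// -expr2 sqr_ge0.
move=> x wx /=; rewrite lee_fin indicE mem_set ?mul1r -?expr2//; exact: wG.
Qed.

Lemma L2norm2_le (w : set E) (u : E -> R[i]) : (L2norm2 w u <= L2norm2 setT u)%E.
Proof.
by apply: le_integral_nonneg => // x; rewrite lee_fin addr_ge0 ?sqr_ge0.
Qed.

End cone.

(** * Concentrating solutions and the failure of observability *)

Section concentration.
Context {R : realType} (d : nat).
Local Notation E := 'rV[R]_d.
Local Notation state := (@state R d).
Local Notation ipd := (@ip R d).

#[local] Opaque smooth bounded_support ip.

Context (V : E -> R) (A : 'M[R]_d) (sA : A^T = A).
Hypothesis A_pos : forall x : 'rV[R]_d, x != 0 -> 0 < (x *m A *m x^T) 0 0.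
Hypothesis hV : assumption_V V.
Hypothesis hVA : has_principal_symbol V (quadratic A).
Context (U : R -> (E -> R[i]) -> E -> R[i]) (hU : is_propagator V U).
Context (w : set E) (v : E) (a : R) (v0 : v != 0) (vA : v *m A = a *: v).
Context (delta : R) (delta0 : 0 < delta).
Hypothesis w_dist : forall x (s : R), w x -> (delta * s) ^+ 2 <= enorm (x - s *: v) ^+ 2.

Lemma eigenvalue_gt0 : 0 < a.
Proof.
have := A_pos v v0; rewrite vA -scalemxAl mxE.
have -> : (v *m v^T) 0 0 = enorm v ^+ 2.
  by rewrite enorm_sqr mxE; apply: eq_bigr => i _; rewrite [(_^T)%R _ _]mxE expr2.
by rewrite !ltNge; apply: contra => a0; rewrite mulr_le0_ge0// sqr_ge0.
Qed.

(** Sum of two bounds on the observed mass N: N <= M by conservation of mass, and k (r cos (nu t))^2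
    N <= S by localization. The first keeps the quotient bounded where the orbit crosses the
    origin. *)
Lemma observed_mass_bound (T : R) : 0 <= T -> exists M K k nu : R,
  [/\ 0 < M, 0 <= K, 0 < k, 0 < nu & forall r, exists f,
    [/\ L2 f, L2norm2 setT f = M%:E & forall t, 0 <= t <= T ->
      (L2norm2 w (U t f) <= (K / (1 + k * r ^+ 2 * cos (nu * t) ^+ 2))%:E)%E]].
Proof.
move=> T0; have a0 := eigenvalue_gt0; have sV : smooth V by case: hV.
pose nu := Num.sqrt a; have nu0 : 0 < nu by rewrite sqrtr_gt0.
have nuA : v *m A = nu ^+ 2 *: v by rewrite sqr_sqrtr// ltW.
have [kappa kappa0 Wk] := perturbation_gradient_bound d V A hVA.
have [c c0 Ac] := quadratic_lower_bound d V A hV hVA.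
pose u0 : state := (cutoff d, fun=> 0); have tu0 : test_state d u0 := cutoff_state d.
pose M := ipd u0 u0; have M0 : 0 < M := cutoff_ip_gt0 d.
(* Taken at the final time T, so that the bound holds on all of [0, T] with one constant. *)
pose S := (d%:R / 2 * M + spread d A 0 v 0 u0) * expR (kappa * T).
have S0 : 0 <= spread d A 0 v 0 u0.
  apply: spread_ge0 => z; apply: le_trans (Ac z); rewrite mulr_ge0 ?sqr_ge0//; exact: ltW.
have dM0 : 0 <= d%:R / 2 * M by rewrite mulr_ge0 ?divr_ge0// ltW.
exists M, (M + S), (c * delta ^+ 2), nu; split=> //.
- by rewrite addr_ge0 ?(ltW M0)// mulr_ge0 ?expR_ge0// addr_ge0.
- by rewrite mulr_gt0// exprn_gt0.
move=> r; pose ur := translate d (r *: v) u0.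
have tur : test_state d ur := translate_test d _ _ tu0.
exists (of_state d ur).
have Lf : L2 (of_state d ur) by apply/L2_reim; rewrite of_stateK; exact: test_state_in_L2.
have Mf : L2norm2 setT (of_state d ur) = M%:E.
  by rewrite L2norm2E// of_stateK ip_translate.
split=> // t /andP[t0 tT].
have [y [e [tr e0]]] := propagator_trajectory d V sV U hU ur tur.
have xM s : ipd (reim d (U s (of_state d ur))) (reim d (U s (of_state d ur))) = M.
  apply: EFin_inj; rewrite -L2norm2E; last exact: (propagator_L2 d V U hU).
  by rewrite (propagator_isometry d V U hU).
(* [b] is the squared distance guaranteed between the cone and the orbit at time t; [G] is the
   closed set of all points that far away. *)
pose b := (delta * (r * cos (nu * t))) ^+ 2.
pose G := [set z : E | b <= enorm (z - (r * cos (nu * t)) *: v) ^+ 2].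
have mG : measurable G.
  have mf : measurable_fun setT (fun z : E => enorm (z - (r * cos (nu * t)) *: v) ^+ 2).
    by apply: continuous_measurable_rV; apply: smooth_continuous; exact: smooth_dist_sqr.
  have -> : G = setT `&` (fun z : E => enorm (z - (r * cos (nu * t)) *: v) ^+ 2) @^-1` `[b, +oo[.
    by rewrite setTI; apply/seteqP; split=> z /=; rewrite in_itv /= andbT.
  by apply: mf => //; exact: measurable_itv.
have wG : w `<=` G by move=> z wz; exact: w_dist.
have Lx := propagator_L2 d V U hU t _ Lf.
have h1 := L2norm2_le_restrict d w G _ mG wG Lx.
have h2 : (L2norm2 w (U t (of_state d ur)) <= M%:E)%E.
  by apply: le_trans (L2norm2_le d _ _) _; rewrite (propagator_isometry d V U hU)// Mf.
have h3 := localization d V A sA hV hVA v nu nuA kappa kappa0 Wk c c0 Ac _ y e tr M xM r u0 t G b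
  tu0 e0 t0 mG (sqr_ge0 _) (fun z Gz => Gz).
have eT : expR (kappa * t) <= expR (kappa * T) by rewrite ler_expR ler_wpM2l.
have {}h3 := le_trans h3 (ler_wpM2l (addr_ge0 dM0 S0) eT); rewrite -/S in h3.
set L := ipd _ _ in h1 h3; set N := L2norm2 w _ in h1 h2 *.
have den : 0 < 1 + c * delta ^+ 2 * r ^+ 2 * cos (nu * t) ^+ 2.
  apply: ltr_pwDl; first exact: ltr01.
  by rewrite mulr_ge0 ?sqr_ge0// mulr_ge0 ?sqr_ge0// mulr_ge0 ?sqr_ge0// ltW.
have N0 : (0 <= N)%E by apply: integral_ge0 => x _; rewrite lee_fin addr_ge0 ?sqr_ge0.
have Nfin : N \is a fin_num by rewrite ge0_fin_numE//; apply: le_lt_trans h2 _; exact: ltry.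
move: N0 h1 h2; rewrite -(fineK Nfin) !lee_fin => N0 h1 h2.
rewrite ler_pdivlMr// mulrDr mulr1; apply: lerD => //.
apply: le_trans h3; rewrite /b.
apply: (@le_trans _ _ (c * ((delta * (r * cos (nu * t))) ^+ 2 * fine N))).
  by rewrite le_eqVlt; apply/orP; left; apply/eqP; ring.
by rewrite ler_wpM2l ?(ltW c0)// ler_wpM2l// sqr_ge0.
Qed.

Lemma not_observes T : 0 < T -> ~ observes U w T.
Proof.
move=> T0 [C C0 obs].
have [M [K [k [nu [M0 K0 k0 nu0 conc]]]]] := observed_mass_bound T (ltW T0).
have dec := integral_decay R K k nu T K0 k0 nu0.
have h n : (M%:E <= C%:E * \int[lebesgue_measure]_(t in `[0%R, T])
    (K / (1 + k * n.+1%:R ^+ 2 * cos (nu * t) ^+ 2))%:E)%E.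
  have [f [Lf <- fw]] := conc n.+1%:R; apply: le_trans (obs f Lf) _.
  rewrite lee_pmul2l//; rewrite integral_mkcond [leRHS]integral_mkcond.
  have den t : 0 <= K / (1 + k * n.+1%:R ^+ 2 * cos (nu * t) ^+ 2).
    apply: divr_ge0 => //; apply: addr_ge0; first exact: ler01.
    by rewrite mulr_ge0 ?sqr_ge0// mulr_ge0 ?sqr_ge0// ltW.
  apply: le_integral_nonneg => //.
  - move=> t; rewrite /patch; case: ifP => // _.
    by apply: integral_ge0 => x _; rewrite lee_fin addr_ge0 ?sqr_ge0.
  - by move=> t; rewrite /patch; case: ifP => // _; rewrite lee_fin.
  - move=> t _; rewrite /patch; case: ifPn => // tT; apply: fw.
    by move: tT; rewrite inE /= in_itv.
have : (M%:E <= C%:E * 0)%E.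
  by apply: (cvge_ge _ (cvgeZl _ dec)) => //; exact: nearW.
by rewrite mule0 lee_fin leNgt M0.
Qed.

End concentration.

Theorem proposition1p4 (R : realType) (d : nat) (hd : (1 <= d)%N)
    (A : 'M[R]_d) (A_sym : A^T = A)
    (A_pos : forall x : 'rV[R]_d, x != 0 -> 0 < (x *m A *m x^T) 0 0)
    (V : 'rV[R]_d -> R) (hV : assumption_V V)
    (hVA : has_principal_symbol V (quadratic A))
    (U : R -> ('rV[R]_d -> R[i]) -> 'rV[R]_d -> R[i]) (hU : is_propagator V U)
    (w : set 'rV[R]_d) (mw : lebesgue_measurable w) (cw : conical w)
    (hobs : exists2 T : R, 0 < T & observes U w T)
    (v : 'rV[R]_d) (a : R) (v0 : v != 0) (hv : (v <= eigenspace A a)%MS) :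
  closure w v \/ closure w (- v).
Proof.
apply: contrapT => /not_orP[wv wNv].
have [delta delta0 w_dist] := conical_dist d w v cw wv wNv.
have [T T0] := hobs.
exact: (not_observes d V A A_sym A_pos hV hVA U hU w v a v0 (eigenspaceP hv) delta delta0 w_dist).
Qed.
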